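(* For every cuspidal function $m\in C^\infty(G)$ that has compact support modulo $Z(G)$, there exists a polynomial $\alpha\in\mathbb{N}[t]$ such that for every $x\in G^{rss}$ and every $i\in\mathbb{N}$, $$|\mathcal{A}_i(m)(x)|\le \alpha\big(ov_{G^{rss}}(x)\big)\,\Omega(|m|)(x).$$
   Context: $F$ is a non-Archimedean local field of arbitrary characteristic, $O_F$ its ring of integers, $\mathrm{val}$ the normalized valuation. $G=\mathrm{GL}_n(F)$, $Z(G)$ its center, $G^{ad}=G/Z(G)$. For $x\in G$, $ov_G(x)=\max\big(\max_{i,j}(-\mathrm{val}(x_{ij})),\mathrm{val}(\det x)\big)$, $G_i=\{x: ov_G(x)\le i\}$, $(G^{ad})_i$ its image in $G^{ad}$. $\Delta(x)$ is the discriminant of the characteristic polynomial, $G^{rss}=\{\Delta\ne0\}$, $ov_{G^{rss}}(x)=\max(ov_G(x),\mathrm{val}\Delta(x))$. Measures: $\mu_G$ Haar on $G$ with $\mu_G(\mathrm{GL}_n(O_F))=1$; $\mu_{Z(G)}$ Haar on $Z(G)\cong F^\times$ with $O_F^\times$ of measure 1; $\mu_{G^{ad}}$ the quotient measure. For $x\in G^{rss}$, $\mu_{G_x}$ is the Haar measure on the centralizer torus $G_x$ giving its maximal compact subgroup measure 1, and $\mu_{G\cdot x}$ the invariant measure on the conjugacy class $G\cdot x\cong G/G_x$ corresponding to $\mu_G,\mu_{G_x}$. For $f$ smooth and compactly supported mod center, $\Omega(f)(x)=\int_{G\cdot x}f\,d\mu_{G\cdot x}$, and $\mathcal{A}_i(f)(x)=\int_{(G^{ad})_i}f(gxg^{-1})\,d\mu_{G^{ad}}(g)$.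 A function $f\in C^\infty(G)$ is cuspidal if for the unipotent radical $U$ of every proper parabolic subgroup of $G$ and every $x\in G$, the function $u\mapsto f(ux)$ on $U$ is compactly supported and has integral $0$ with respect to a Haar measure of $U$. *)

(* Defs.v *)
From HB Require Import structures.
From mathcomp Require Import all_boot all_order all_algebra.
From mathcomp Require Import all_classical all_reals all_analysis.
From mathcomp Require Import complex.
Set Implicit Arguments. Unset Strict Implicit. Unset Printing Implicit Defensive.
Import Order.TTheory GRing.Theory Num.Theory.
Local Open Scope ring_scope.
Local Open Scope classical_set_scope.

(* the value [v 0] is irrelevant (val 0 = +oo is encoded by [vge]).          *)
Section LocalField.
Variables (F : fieldType) (v : F -> int).

(* vge k a  <=>  val a >= k   (with val 0 = +oo) *)
Definition vge (k : int) (a : F) : bool := (a == 0) || (k <= v a).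

Definition vcauchy (u : nat -> F) : Prop :=
  forall k : int, exists N : nat, forall p q : nat,
    (N <= p)%N -> (N <= q)%N -> vge k (u p - u q).

Definition vconverges (u : nat -> F) (l : F) : Prop :=
  forall k : int, exists N : nat, forall p : nat, (N <= p)%N -> vge k (u p - l).

Record nonarch_local_field : Prop := {
  val_mul : forall a b, a != 0 -> b != 0 -> v (a * b) = v a + v b;
  val_add : forall a b, a != 0 -> b != 0 -> a + b != 0 ->
              Num.min (v a) (v b) <= v (a + b);
  val_normalized : forall k : int, exists a, a != 0 /\ v a = k;
  val_complete : forall u, vcauchy u -> exists l, vconverges u l;
  val_finite_residue : exists s : seq F,
      forall a, vge 0 a -> exists2 b, b \in s & vge 1 (a - b) }.

End LocalField.

Section GLn.
Variables (F : fieldType) (v : F -> int) (n : nat).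

Definition MX := 'M[F]_n.
HB.instance Definition _ := Choice.on MX.
HB.instance Definition _ := isPointed.Build MX 0.

Definition Gset : set MX := [set g | \det g != 0].

(* ov_G(x) = max( max_{ij} (- val x_ij), val det x )  (x_ij = 0 contributes -oo) *)
Definition ovG (x : 'M[F]_n) : int :=
  \big[Num.max/v (\det x)]_(ij : 'I_n * 'I_n | x ij.1 ij.2 != 0)
      (- v (x ij.1 ij.2)).

Definition Gi (i : int) : set MX := [set g | \det g != 0 /\ ovG g <= i].

Definition Zset : set MX := [set g | exists a : F, a != 0 /\ g = a%:M].
Definition Zcpt : set MX := [set g | exists a : F, a != 0 /\ v a = 0 /\ g = a%:M].

(* preimage in G of (G^ad)_i, i.e. Z(G) G_i *)
Definition ZGi (i : int) : set MX :=
  [set g | exists z h, Zset z /\ Gi i h /\ g = z *m h].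

(* discriminant of the characteristic polynomial:
   (-1)^(n(n-1)/2) Res(chi, chi') for the monic chi of degree n *)
Definition discr (x : 'M[F]_n) : F :=
  (-1) ^+ 'C(n, 2) * resultant (char_poly x) (char_poly x)^`().

Definition rss (x : 'M[F]_n) : Prop := \det x != 0 /\ discr x != 0.

Definition ovrss (x : 'M[F]_n) : int := Num.max (ovG x) (v (discr x)).

(* centralizer G_x and its maximal compact subgroup (the elements t of the
   torus G_x generating a bounded subgroup {t^k : k in Z}) *)
Definition centralizer (x : 'M[F]_n) : set MX :=
  [set g | \det g != 0 /\ g *m x = x *m g].
Definition maxcpt (x : 'M[F]_n) : set MX :=
  [set t | centralizer x t /\ exists c : int, forall k : nat,
      ovG ((t : 'M[F]_n) ^+ k) <= c /\ ovG (invmx (t : 'M[F]_n) ^+ k) <= c].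

(* proper parabolic subgroups = stabilizers of nonempty flags
   0 < V_1 < ... < V_k < F^n of row spaces (G acting on row vectors);
   the unipotent radical is the set of u with V_{j+1} (u - 1) <= V_j. *)
Definition proper_flag (s : seq 'M[F]_n) : Prop :=
  s != [::] /\ path (fun A B : 'M[F]_n => (A < B)%MS) 0 (rcons s 1%:M).

Definition unip_rad (s : seq 'M[F]_n) : set MX :=
  [set u | \det u != 0 /\ forall j : nat, (j < (size s).+1)%N ->
      (nth 0 (rcons s 1%:M) j *m ((u : 'M[F]_n) - 1%:M) <= nth 0 (0 :: s) j)%MS].

Definition mball (a : 'M[F]_n) (k : int) : set MX :=
  [set y | forall i j, vge v k (y i j - a i j)].
Definition mballs : set (set MX) := [set B | exists a k, B = mball a k].

(* Borel sigma-algebra of M_n(F) (the topology is second countable and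
   generated by the balls) *)
Definition MXm := g_sigma_algebraType mballs.

Definition conjg (g x : 'M[F]_n) : 'M[F]_n := g *m x *m invmx g.

End GLn.

Arguments Gset {F n}.
Arguments Zset {F n}.

Section Measures.
Variables (R : realType) (F : fieldType) (v : F -> int) (n : nat).
Local Notation MXm := (MXm v n).

(* nu is the Haar measure of the closed subgroup H of G, normalized by
   nu(K) = 1 (K a compact open subgroup of H): nu is carried by H and
   invariant under left translation by elements of H. *)
Definition haar_for (H K : set MXm) (nu : {measure set MXm -> \bar R}) : Prop :=
  [/\ nu (~` H) = 0%E,
      forall (h : MXm) (A : set MXm), H h -> measurable A ->
        nu [set (h : 'M[F]_n) *m (a : 'M[F]_n) | a in A] = nu A
    & nu K = 1%E].

(* psi is a weight computing the quotient measure on G/H from mu_G and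
   mu_H = nuH: int_H psi(g t) d nuH(t) = 1 for all g in G, so that
   int_{G/H} h d mu_{G/H} = int_G h psi d mu_G for right-H-invariant h. *)
Definition quot_weight (nuH : {measure set MXm -> \bar R}) (psi : MXm -> R) : Prop :=
  [/\ forall g, 0 <= psi g, measurable_fun setT psi &
      forall g : MXm, \det (g : 'M[F]_n) != 0 ->
        (\int[nuH]_t (psi ((g : 'M[F]_n) *m (t : 'M[F]_n) : MXm))%:E)%E = 1%E].

Definition cmod (z : R[i]) : R := Num.sqrt (complex.Re z ^+ 2 + complex.Im z ^+ 2).

Definition cint (mu : {measure set MXm -> \bar R}) (A : set MXm) (f : MXm -> R[i]) : R[i] :=
  Complex (fine (\int[mu]_(g in A) (complex.Re (f g))%:E)%E)
          (fine (\int[mu]_(g in A) (complex.Im (f g))%:E)%E).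

Definition smooth_on_G (m : MXm -> R[i]) : Prop :=
  forall x : MXm, \det (x : 'M[F]_n) != 0 ->
    exists k : int, forall y : MXm, mball v x k y -> m y = m x.

(* compact support modulo Z(G): supp m is contained in Z(G) C for a compact
   C in G; every compact subset of G lies in some G_c. *)
Definition cpt_mod_center (m : MXm -> R[i]) : Prop :=
  exists c : int, forall g : MXm, \det (g : 'M[F]_n) != 0 -> m g != 0 -> ZGi v c g.

(* cuspidality: for the unipotent radical U of every proper parabolic and
   every x in G, u |-> m(u x) is compactly supported on U and has integral 0
   against the Haar measure of U (normalized by U cap GL_n(O_F)). *)
Definition cuspidal (m : MXm -> R[i]) : Prop :=
  forall s : seq 'M[F]_n, proper_flag s -> forall x : MXm, \det (x : 'M[F]_n) != 0 ->
    (exists c : int, forall u : MXm, unip_rad s u ->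
        m ((u : 'M[F]_n) *m (x : 'M[F]_n) : MXm) != 0 -> ovG v u <= c) /\
    (forall nu : {measure set MXm -> \bar R},
        haar_for (unip_rad s) (unip_rad s `&` Gi v 0) nu ->
        cint nu setT (fun u : MXm => m ((u : 'M[F]_n) *m (x : 'M[F]_n) : MXm)) = 0).

(* A_i(m)(x) = int_{(G^ad)_i} m(g x g^-1) d mu_{G^ad}(g), with mu_{G^ad} the
   quotient of mu_G by mu_Z, computed through a weight psiZ *)
Definition Acal (muG : {measure set MXm -> \bar R}) (psiZ : MXm -> R)
    (i : nat) (m : MXm -> R[i]) (x : 'M[F]_n) : R[i] :=
  cint muG (ZGi v i%:Z)
    (fun g : MXm => m (conjg g x : MXm) * (psiZ g)%:C%C).

(* Omega(|m|)(x) = int_{G . x} |m| d mu_{G.x} = int_{G/G_x} |m|(g x g^-1),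
   computed through a weight psix for the quotient of mu_G by mu_{G_x} *)
Definition Omega_abs (muG : {measure set MXm -> \bar R}) (psix : MXm -> R)
    (m : MXm -> R[i]) (x : 'M[F]_n) : \bar R :=
  (\int[muG]_(g in Gset) (cmod (m (conjg g x : MXm)) * psix g)%:E)%E.

End Measures.

(* Main.v *)
(** A function [g |-> m (g x g^-1)] is studied through the centralizer algebra
    F[x], a product of fields with idempotents e_a.  Power-bounded elements s of
    F[x] satisfy val (g s g^-1) >= -H whenever g x g^-1 lies in the support of m
    (or g = 1), with H linear in ov(x): in f(x) chi'(x) = sum_k tr(f(x) A_k) x^k
    the traces are integral, and chi' is inverted through the discriminant.
    Such g are called tame.

    If g is tame and g is not bounded modulo the center in terms of H, the lattice
    norms of the blocks g e_a differ widely; a minimal set J of blocks dominating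
    the other ones is canonically attached to g.  As long as g u stays tame, this
    set and membership in Z(G) G_i are unchanged when g is replaced by g u, for u
    in the unipotent group U_J = 1 + e_J M_n(F) (1 - e_J).  Since u x u^-1 x^-1
    runs bijectively over U_J, cuspidality kills the integral over each stratum.
    Hence A_i(m)(x) only depends on min(i, i0), with i0 linear in ov(x).

    Finally Z(G) G_{i0} modulo the center meets each coset g G_x in at most
    polynomially many translates of the maximal compact subgroup of G_x, because
    G_x modulo it is detected by r <= n valuations; folding the integral over
    G_x gives the bound by Omega(|m|)(x). *)

Require Import Defs.
From HB Require Import structures.
From mathcomp Require Import all_boot all_order all_algebra all_fingroup.
From mathcomp Require Import all_classical all_reals all_analysis.
From mathcomp Require Import complex separable measurable_realfun.
From mathcomp Require Import zify ring lra.
Set Implicit Arguments. Unset Strict Implicit. Unset Printing Implicit Defensive.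
Import Order.TTheory GRing.Theory Num.Theory.
Local Open Scope ring_scope.
Local Open Scope classical_set_scope.

(** * Valuations and integral matrices *)

(** Eigenvalues and logarithms are avoided, the characteristic being arbitrary: integrality in F[x]
    is power-boundedness, detected by Gauss's lemma on characteristic polynomials and, on one field
    factor, by the norm [\det (s + (1 - e a))]. The set J has to survive g -> g u although g u may
    be far from g. Therefore [good] measures the blocks outside J only modulo U_J, and tameness of
    both ends bounds the displacement, because g N g^-1 = g e_J g^-1 - (g u) e_J (g u)^-1 for u = 1
    + N; the gap 3H + 1 absorbs the losses. Cuspidality speaks of all Haar measures of a unipotent
    radical, so one has to be exhibited: it is the image of the Haar measure of G on a U_J-stable
    cell, mapped through u -> g (u x u^-1 x^-1) g^-1. Averaging over g u is a right translation
    while only left invariance is given; hence the uniqueness of Haar measure and the triviality of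
    the modular function. Integrals live in the extended reals and [fine] sends infinite values to
    0, so vanishing is expressed as equality of the finite integrals of positive and negative
    parts. *)

Section Valuation.
Variables (F : fieldType) (v : F -> int).
Hypothesis HF : nonarch_local_field v.
Local Notation vge := (vge v).

Lemma valM a b : a != 0 -> b != 0 -> v (a * b) = v a + v b.
Proof. exact: val_mul. Qed.

Lemma valD k a b : a != 0 -> b != 0 -> a + b != 0 ->
  k <= v a -> k <= v b -> k <= v (a + b).
Proof.
move=> a0 b0 ab ha hb; apply: le_trans (val_add HF a0 b0 ab).
by rewrite le_min ha.
Qed.

Lemma val1 : v 1 = 0.
Proof.
have : v 1 = v 1 + v 1 by rewrite -valM ?oner_neq0 // mulr1.
lia.
Qed.

Lemma valV a : a != 0 -> v a^-1 = - v a.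
Proof.
move=> a0; have : v 1 = v a + v a^-1 by rewrite -valM ?invr_neq0 // divff.
rewrite val1; lia.
Qed.

Lemma valN a : v (- a) = v a.
Proof.
have [->|a0] := eqVneq a 0; first by rewrite oppr0.
have n1 : (-1 : F) != 0 by rewrite oppr_eq0 oner_eq0.
have h : v 1 = v (-1) + v (-1) by rewrite -valM // mulrNN mulr1.
rewrite val1 in h.
by rewrite -mulN1r valM //; lia.
Qed.

Lemma valX a k : a != 0 -> v (a ^+ k) = v a *+ k.
Proof.
move=> a0; elim: k => [|k IH]; first by rewrite val1.
by rewrite exprS valM ?expf_neq0 // IH mulrS.
Qed.

Lemma vge0 k : vge k 0. Proof. by rewrite /Defs.vge eqxx. Qed.

Lemma vge_val k a : k <= v a -> vge k a.
Proof. by rewrite /Defs.vge => ->; rewrite orbT. Qed.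

Lemma vgeP k a : a != 0 -> vge k a = (k <= v a).
Proof. by rewrite /Defs.vge => /negbTE ->. Qed.

Lemma vge_nz k a : ~~ vge k a -> a != 0 /\ v a < k.
Proof. by rewrite /Defs.vge negb_or -ltNge => /andP[]. Qed.

Lemma vgeW k l a : l <= k -> vge k a -> vge l a.
Proof. by move=> lk /orP[/eqP->|h]; [exact: vge0|apply: vge_val; lia]. Qed.

Lemma vgeD k a b : vge k a -> vge k b -> vge k (a + b).
Proof.
have [->|a0] := eqVneq a 0; first by rewrite add0r.
have [->|b0] := eqVneq b 0; first by rewrite addr0.
have [->|ab] := eqVneq (a + b) 0; first by move=> *; exact: vge0.
by rewrite !vgeP // => ha hb; apply: valD.
Qed.

Lemma vgeN k a : vge k (- a) = vge k a.
Proof. by rewrite /Defs.vge oppr_eq0 valN. Qed.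

Lemma vgeB k a b : vge k a -> vge k b -> vge k (a - b).
Proof. by move=> ha hb; apply: vgeD => //; rewrite vgeN. Qed.

Lemma vgeM k l a b : vge k a -> vge l b -> vge (k + l) (a * b).
Proof.
have [->|a0] := eqVneq a 0; first by rewrite mul0r => *; exact: vge0.
have [->|b0] := eqVneq b 0; first by rewrite mulr0 => *; exact: vge0.
by rewrite !vgeP ?mulf_neq0 // valM // => ? ?; lia.
Qed.

Lemma vgeMl k l a b : a != 0 -> v a = l -> vge (l + k) (a * b) = vge k b.
Proof.
move=> a0 va; have [->|b0] := eqVneq b 0; first by rewrite mulr0 !vge0.
by rewrite !vgeP ?mulf_neq0 // valM // va; lia.
Qed.

Lemma vge_sum I (r : seq I) (P : pred I) (E : I -> F) k :
  (forall i, P i -> vge k (E i)) -> vge k (\sum_(i <- r | P i) E i).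
Proof.
move=> h; apply: (big_ind (fun x => vge k x)); first exact: vge0.
  by move=> a b; exact: vgeD.
by [].
Qed.

Lemma vge01 : vge 0 1. Proof. by apply: vge_val; rewrite val1. Qed.

Lemma vge_sign (k : nat) l a : vge l ((-1) ^+ k * a) = vge l a.
Proof. by rewrite -signr_odd; case: (odd k); rewrite ?mul1r ?mulN1r ?vgeN. Qed.

Lemma vge_prod I (r : seq I) (P : pred I) (E : I -> F) (k : I -> int) :
  (forall i, P i -> vge (k i) (E i)) ->
  vge (\sum_(i <- r | P i) k i) (\prod_(i <- r | P i) E i).
Proof.
move=> h; elim/big_rec2: _ => [|i x y Pi IH]; first exact: vge01.
by apply: vgeM => //; exact: h.
Qed.

Lemma vge_all a : (forall k, vge k a) -> a = 0.
Proof.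
move=> h; apply/eqP/negPn/negP => a0; have := h (v a + 1); rewrite vgeP //; lia.
Qed.

(** The isosceles property of an ultrametric: if the sum had larger valuation, so would a = (a + b)
    - b. *)
Lemma val_eqD a b k : a != 0 -> v a < k -> vge k b -> a + b != 0 /\ v (a + b) = v a.
Proof.
move=> a0 ak hb.
have nz : ~~ vge (v a + 1) (a + b).
  apply/negP => h; have : vge (v a + 1) a.
    rewrite -[X in vge _ X](addrK b); apply: vgeB => //; apply: vgeW hb; lia.
  rewrite vgeP //; lia.
have [ab lt] := vge_nz nz; split=> //.
have : vge (v a) (a + b) by apply: vgeD; [rewrite vgeP|apply: vgeW hb; lia].
rewrite vgeP //; lia.
Qed.

Definition unif : F := projT1 (cid (val_normalized HF 1)).

Lemma unif_neq0 : unif != 0.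
Proof. by rewrite /unif; case: cid => x []. Qed.

Lemma val_unif : v unif = 1.
Proof. by rewrite /unif; case: cid => x []. Qed.

(** Powers of one chosen uniformizer; rescaling by them reduces bounds at level k to the integral
    case. *)
Definition pw (k : int) : F := unif ^ k.

Lemma pw_neq0 k : pw k != 0. Proof. exact: expfz_neq0 unif_neq0. Qed.

Lemma val_pw k : v (pw k) = k.
Proof.
rewrite /pw; case: k => k.
  by rewrite -exprnP valX ?unif_neq0 // val_unif -mulr_natr mul1r natz.
rewrite NegzE -exprnN valV ?expf_neq0 ?unif_neq0 // valX ?unif_neq0 // val_unif.
by rewrite -mulr_natr mul1r natz.
Qed.

Lemma pwD k l : pw (k + l) = pw k * pw l.
Proof. exact: expfzDr unif_neq0. Qed.

Lemma pw0 : pw 0 = 1. Proof. by rewrite /pw expr0z. Qed.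

Lemma pwVK k : pw (- k) * pw k = 1.
Proof. by rewrite -pwD addNr pw0. Qed.

Lemma pwKV k : pw k * pw (- k) = 1.
Proof. by rewrite -pwD addrN pw0. Qed.

End Valuation.

Section MatrixValuation.
Variables (F : fieldType) (v : F -> int).
Hypothesis HF : nonarch_local_field v.
Local Notation vge := (vge v).
Local Notation pw := (pw HF).

Definition mge p q (k : int) (A : 'M[F]_(p, q)) : Prop := forall i j, vge k (A i j).

Section Basic.
Variables (p q r : nat).
Implicit Types A B : 'M[F]_(p, q).

Lemma mge0 k : mge k (0 : 'M[F]_(p, q)).
Proof. by move=> i j; rewrite mxE vge0. Qed.

Lemma mgeW k l A : l <= k -> mge k A -> mge l A.
Proof. by move=> lk h i j; apply: vgeW (h i j). Qed.

Lemma mgeD k A B : mge k A -> mge k B -> mge k (A + B).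
Proof. by move=> hA hB i j; rewrite mxE; apply: (vgeD HF). Qed.

Lemma mgeN k A : mge k (- A) <-> mge k A.
Proof. by split=> h i j; have := h i j; rewrite !mxE (vgeN HF). Qed.

Lemma mgeB k A B : mge k A -> mge k B -> mge k (A - B).
Proof. by move=> hA hB; apply: mgeD => //; apply/mgeN. Qed.

Lemma mgeBC k A B : mge k (A - B) -> mge k (B - A).
Proof. by move=> h; rewrite -opprB; apply/mgeN. Qed.

Lemma mge_sum I (s : seq I) (P : pred I) (E : I -> 'M[F]_(p, q)) k :
  (forall i, P i -> mge k (E i)) -> mge k (\sum_(i <- s | P i) E i).
Proof.
move=> h; apply: (big_ind (fun x => mge k x)); first exact: mge0.
  by move=> a b; exact: mgeD.
by [].
Qed.

Lemma mgeZ k l a A : vge l a -> mge k A -> mge (l + k) (a *: A).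
Proof. by move=> ha hA i j; rewrite mxE; apply: (vgeM HF). Qed.

Lemma mgeZ_pw k l A : mge (l + k) (pw l *: A) <-> mge k A.
Proof.
by split=> h i j; have := h i j; rewrite !mxE (vgeMl HF) ?pw_neq0 ?val_pw.
Qed.

Lemma mgeM k l A (B : 'M[F]_(q, r)) : mge k A -> mge l B -> mge (k + l) (A *m B).
Proof.
move=> hA hB i j; rewrite mxE; apply: (vge_sum HF) => t _; exact: (vgeM HF).
Qed.

Lemma mge_all A : (forall k, mge k A) -> A = 0.
Proof. by move=> h; apply/matrixP => i j; rewrite mxE; apply: vge_all => k; apply: h. Qed.

Lemma mge_ex A : exists k, mge k A.
Proof.
pose k := \big[Num.min/0]_(ij : 'I_p * 'I_q) v (A ij.1 ij.2).
exists k => i j; apply: vge_val.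
by rewrite /k (bigD1 (i, j)) //= ge_min lexx.
Qed.

Lemma mge_exN A : exists k : nat, mge (- k%:Z) A.
Proof.
have [k hk] := mge_ex A; exists `|k|%N; apply: mgeW hk; lia.
Qed.

(** Valuations are discrete, and [mge_all] excludes arbitrarily large lower bounds, so a largest one
    exists. This k0 is minus the logarithm of the maximum norm of A. *)
Lemma mge_nz A : A != 0 -> exists k0, forall k, mge k A <-> k <= k0.
Proof.
move=> A0.
have [k1 hk1] := mge_ex A.
have [k2 hk2] : exists k, ~ mge k A.
  by apply/not_existsP => h; move/eqP: A0; apply; apply: mge_all => k; apply/not_notP/h.
have : exists j : nat, `[< ~ mge (k1 + j%:Z) A >].
  exists `|k2 - k1|%N; apply/asboolP => h; apply: hk2; apply: mgeW h; lia.
move=> /ex_minnP [j /asboolP hj minj].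
have j0 : (0 < j)%N.
  by case: j hj minj => // hj _; case: hj; apply: mgeW hk1; lia.
exists (k1 + j%:Z - 1) => k; split => hk.
  rewrite leNgt; apply/negP => lt; apply: hj; apply: mgeW hk; lia.
apply: (@mgeW (k1 + j.-1%:Z)); first lia.
apply/not_notP => h; have := minj j.-1; move/asboolP: h => h /(_ h); lia.
Qed.

End Basic.

Lemma mge_scal n k a : vge k a -> mge k (a%:M : 'M[F]_n).
Proof. by move=> ha i j; rewrite mxE; case: (i == j) => //=; rewrite mulr0n vge0. Qed.

Lemma mge1 n : mge 0 (1%:M : 'M[F]_n).
Proof. apply: mge_scal; exact: (vge01 HF). Qed.

Lemma vge_det n k (A : 'M[F]_n) : mge k A -> vge (k *+ n) (\det A).
Proof.
move=> hA; apply: (vge_sum HF) => s _; rewrite vge_sign //.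
have -> : k *+ n = \sum_(i < n) k by rewrite sumr_const card_ord.
by apply: (vge_prod HF) => i _; apply: hA.
Qed.

Lemma mge_adj n k (A : 'M[F]_n) : mge k A -> mge (k *+ n.-1) (\adj A).
Proof.
move=> hA i j; rewrite mxE /cofactor vge_sign //; apply: vge_det => a b.
by rewrite !mxE; apply: hA.
Qed.

Lemma invmx_adj n (A : 'M[F]_n) : \det A != 0 -> invmx A = (\det A)^-1 *: \adj A.
Proof. by move=> d; rewrite /invmx unitmxE unitfE d. Qed.

Lemma mge_inv n k (A : 'M[F]_n) : \det A != 0 -> mge k A ->
  mge (k *+ n.-1 - v (\det A)) (invmx A).
Proof.
move=> d hA; rewrite invmx_adj // addrC; apply: mgeZ; last exact: mge_adj.
by apply: vge_val; rewrite (valV HF).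
Qed.

Lemma det_unit n (A : 'M[F]_n) : (A \in unitmx) = (\det A != 0).
Proof. by rewrite unitmxE unitfE. Qed.

Lemma val_detM n (A B : 'M[F]_n) : \det A != 0 -> \det B != 0 ->
  v (\det (A *m B)) = v (\det A) + v (\det B).
Proof. by move=> a b; rewrite det_mulmx (valM HF). Qed.

Lemma det_invmx_neq0 n (A : 'M[F]_n) : \det A != 0 -> \det (invmx A) != 0.
Proof. by move=> a; rewrite det_inv invr_eq0. Qed.

Lemma val_detV n (A : 'M[F]_n) : \det A != 0 -> v (\det (invmx A)) = - v (\det A).
Proof. by move=> a; rewrite det_inv (valV HF). Qed.

Lemma val_detX n (A : 'M[F]_n) k : \det A != 0 ->
  \det (A ^+ k) != 0 /\ v (\det (A ^+ k)) = v (\det A) *+ k.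
Proof.
move=> a; elim: k => [|k [IH1 IH2]]; first by rewrite det1 oner_neq0 (val1 HF).
by rewrite exprS det_mulmx mulf_neq0 // (valM HF) // IH2 mulrS.
Qed.

(** Telescoping: factors are exchanged one at a time, each exchange gaining l over the trivial
    bound. *)
Lemma prod_congr n (a b : 'I_n -> F) k l : 0 <= l ->
  (forall i, vge k (a i)) -> (forall i, vge k (b i)) ->
  (forall i, vge (k + l) (a i - b i)) ->
  vge (k *+ n + l) (\prod_i a i - \prod_i b i).
Proof.
elim: n a b => [|n IH] a b l0 ha hb hab; first by rewrite !big_ord0 subrr vge0.
rewrite !big_ord_recl.
set A := \prod_i _; set B := \prod_i _.
have -> : a ord0 * A - b ord0 * B = (a ord0 - b ord0) * A + b ord0 * (A - B) by ring.
rewrite mulrS; apply: (vgeD HF).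
  have -> : k + k *+ n + l = (k + l) + k *+ n by ring.
  apply: (vgeM HF) => //; have -> : k *+ n = \sum_(i < n) k by rewrite sumr_const card_ord.
  by apply: (vge_prod HF) => i _; apply: ha.
by rewrite -addrA; apply: (vgeM HF) => //; apply: IH.
Qed.

(** The determinant is Lipschitz on matrices with bounded denominators: [prod_congr] is applied to
    each term of the Leibniz expansion. *)
Lemma det_congr n k l (A B : 'M[F]_n) : 0 <= l -> mge k A -> mge k B ->
  mge (k + l) (A - B) -> vge (k *+ n + l) (\det A - \det B).
Proof.
move=> l0 hA hB hAB; rewrite /determinant -sumrB; apply: (vge_sum HF) => s _.
rewrite -mulrBr vge_sign //; apply: prod_congr => // i.
by have := hAB i ((s : {perm _}) i); rewrite !mxE.
Qed.

Lemma cong_det n (X : 'M[F]_n) : mge 1 X ->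
  \det (1%:M + X) != 0 /\ v (\det (1%:M + X)) = 0.
Proof.
move=> hX; have h : vge 1 (\det (1%:M + X) - \det (1%:M : 'M[F]_n)).
  have -> : 1 = (0 *+ n + 1 : int) by rewrite mul0rn add0r.
  apply: det_congr; rewrite ?add0r //; first 1 last.
  - exact: mge1.
  - by rewrite [1%:M + X]addrC addrK.
  by apply: mgeD; [exact: mge1|apply: mgeW hX].
rewrite det1 in h; have e : 1 + (\det (1%:M + X) - 1) = \det (1%:M + X).
  by rewrite addrC subrK.
have lt : v (1 : F) < 1 by rewrite (val1 HF).
by have := val_eqD HF (oner_neq0 F) lt h; rewrite e (val1 HF).
Qed.

(** The correction is - X (1 + X)^-1, where (1 + X)^-1 is integral because the determinant of 1 + X
    is a unit. *)
Lemma cong_inv n (X : 'M[F]_n) l : 1 <= l -> mge l X ->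
  exists2 Y : 'M[F]_n, mge l Y & invmx (1%:M + X) = 1%:M + Y.
Proof.
move=> l1 hX; have hX1 : mge 1 X by apply: mgeW hX.
have [d vd] := cong_det hX1.
exists (- (X *m invmx (1%:M + X))).
  apply/mgeN; rewrite -[l]addr0; apply: mgeM => //.
  have := @mge_inv n 0 (1%:M + X) d; rewrite vd mul0rn subr0; apply.
  by apply: mgeD; [exact: mge1|apply: mgeW hX1].
have u : 1%:M + X \in unitmx by rewrite det_unit.
apply: (can_inj (mulKmx u)); rewrite mulmxV // mulmxDr mulmx1 mulmxN.
rewrite mulmxA mulmxDl mul1mx.
have -> : X + X *m X = X *m (1%:M + X) by rewrite mulmxDr mulmx1.
by rewrite -mulmxA mulmxV // mulmx1 addrK.
Qed.

End MatrixValuation.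

(** * Compactness of balls from completeness and the finite residue field *)

Section Compactness.
Variables (F : fieldType) (v : F -> int).
Hypothesis HF : nonarch_local_field v.
Variable n : nat.
Local Notation vge := (vge v).
Local Notation pw := (pw HF).
Local Notation mge := (mge v).
Implicit Types A B X : 'M[F]_n.

Lemma residue_mx : exists S : seq 'M[F]_n,
  forall A, mge 0 A -> exists2 B, B \in S & mge 1 (A - B).
Proof.
have [s hs] := val_finite_residue HF.
exists [seq \matrix_(i, j) nth 0 s (f (i, j)) | f : {ffun 'I_n * 'I_n -> 'I_(size s)}].
move=> A hA.
have /choice[f hf] : forall ij : 'I_n * 'I_n, exists k : 'I_(size s),
    vge 1 (A ij.1 ij.2 - nth 0 s k).
  move=> ij; have [b bs hb] := hs _ (hA ij.1 ij.2).
  have lt : (index b s < size s)%N by rewrite index_mem.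
  by exists (Ordinal lt); rewrite /= nth_index.
exists (\matrix_(i, j) nth 0 s ([ffun ij => f ij] (i, j))).
  by apply/mapP; exists [ffun ij => f ij] => //; rewrite mem_enum.
by move=> i j; rewrite !mxE ffunE; apply: (hf (i, j)).
Qed.

(** Expansion to l digits: the remainder A - B is rescaled to an integral matrix, whose residue is
    the next digit. *)
Lemma cover_mx k (l : nat) : exists S : seq 'M[F]_n,
  forall A, mge k A -> exists2 B, B \in S & mge (k + l%:Z) (A - B).
Proof.
have [S0 hS0] := residue_mx.
elim: l => [|l [S hS]].
  by exists [:: 0] => A hA; exists 0; [rewrite mem_head|rewrite (subr0 A); apply: mgeW hA; lia].
exists [seq B + pw (k + l%:Z) *: C | B <- S, C <- S0] => A /hS [B BS hB].
have /hS0 [C CS hC] : mge 0 (pw (- (k + l%:Z)) *: (A - B)).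
  by rewrite -(addNr (k + l%:Z)); apply/(mgeZ_pw HF).
exists (B + pw (k + l%:Z) *: C); first by apply/allpairsP; exists (B, C).
have -> : A - (B + pw (k + l%:Z) *: C) =
    pw (k + l%:Z) *: (pw (- (k + l%:Z)) *: (A - B) - C).
  by rewrite scalerBr scalerA pwKV scale1r opprD addrA.
have -> : k + l.+1%:Z = k + l%:Z + 1 by lia.
exact/(mgeZ_pw HF).
Qed.

Lemma mx_complete (u : nat -> 'M[F]_n) k :
  (forall j, mge (k + j%:Z) (u j.+1 - u j)) ->
  exists L, forall j, mge (k + j%:Z) (u j - L).
Proof.
move=> hu.
have hd : forall d j, mge (k + j%:Z) (u (j + d)%N - u j).
  elim=> [|d IH] j; first by rewrite addn0 subrr; apply: mge0.
  rewrite -[u (j + d.+1)%N](subrK (u (j + d)%N)) -addrA; apply: (mgeD HF) => //.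
  by rewrite addnS; apply: mgeW (hu _); lia.
have /choice[L hL] : forall ij : 'I_n * 'I_n, exists l,
    vconverges v (fun j => u j ij.1 ij.2) l.
  move=> [a b] /=; apply: (val_complete HF) => t.
  exists `|t - k|%N => p q hp hq.
  have main : forall p q, (`|t - k|%N <= p)%N -> (p <= q)%N -> vge t (u q a b - u p a b).
    move=> p' q' hp' /subnKC <-; have := hd (q' - p')%N p' a b.
    by rewrite !mxE; apply: vgeW; lia.
  have [pq|qp] := leqP p q; last exact: main (ltnW qp).
  by rewrite -opprB (vgeN HF); apply: main.
exists (\matrix_(i, j) L (i, j)) => j a b; rewrite !mxE.
have [N hN] := hL (a, b) (k + j%:Z).
rewrite -[u j a b](subrK (u (j + N)%N a b)) -addrA; apply: (vgeD HF).
  by have := hd N j a b; rewrite !mxE -opprB (vgeN HF).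
by apply: hN; rewrite leq_addl.
Qed.

Lemma mballE a k y : mball v a k y <-> mge k ((y : 'M[F]_n) - a).
Proof. by split=> h i j; have := h i j; rewrite ?mxE. Qed.

(* Compactness of balls, as an induction principle. *)
Lemma ball_ind (Q : set (MX F n) -> Prop) :
  Q set0 -> (forall U V, Q U -> Q V -> Q (U `|` V)) ->
  (forall U V, U `<=` V -> Q V -> Q U) ->
  (forall x, exists k, Q (mball v x k)) -> forall a k, Q (mball v a k).
Proof.
move=> Q0 QU QS Qloc a0 k; apply/not_notP => nQ.
(* If Q fails on a ball, it fails on one of the finitely many balls of the next smaller radius
   covering it. Iteration gives a Cauchy sequence of centres; Q holds on a ball around the limit,
   and that ball contains one of the chosen balls. *)
have step : forall p : nat * 'M[F]_n, exists b, ~ Q (mball v p.2 (k + p.1%:Z)) ->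
    mge (k + p.1%:Z) (b - p.2) /\ ~ Q (mball v b (k + p.1.+1%:Z)).
  move=> [j a] /=; have [q|nq] := pselect (Q (mball v a (k + j%:Z))).
    by exists 0.
  suff [b [h1 h2]] : exists b, mge (k + j%:Z) (b - a) /\ ~ Q (mball v b (k + j.+1%:Z)).
    by exists b.
  apply/not_existsP => hall; apply: nq.
  have [S hS] := cover_mx (k + j%:Z) 1.
  have QB : forall B : 'M[F]_n, mge (k + j%:Z) B -> Q (mball v (a + B) (k + j.+1%:Z)).
    move=> B hB; apply/not_notP => nQB; apply: (hall (a + B)).
    by split=> //; rewrite addrAC subrr add0r.
  have {QB} : Q [set y | exists B, [/\ B \in S, mge (k + j%:Z) B &
                     mball v (a + B) (k + j.+1%:Z) y]].
    elim: S {hS} => [|C S IH].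
      by apply: QS Q0 => y [B [//]].
    have [hC|hC] := pselect (mge (k + j%:Z) C).
      apply: (QS _ _ _ (QU _ _ (QB C hC) IH)) => y [B [+ hB hy]].
      by rewrite in_cons => /orP[/eqP e|BS]; [left; rewrite -e|right; exists B].
    apply: QS IH => y [B [+ hB hy]]; rewrite in_cons => /orP[/eqP e|BS]; last by exists B.
    by case: hC; rewrite -e.
  apply: QS => y /mballE /[dup] hy /hS [B BS hB]; exists B; split=> //.
    by rewrite -[B](subKr (y - a)); apply: (mgeB HF) => //; apply: mgeW hB; lia.
  by apply/mballE; rewrite opprD addrA; apply: mgeW hB; lia.
have [f hf] := choice step.
pose u := fix u j : 'M[F]_n := if j is j'.+1 then f (j', u j') else a0.
have nQu : forall j, ~ Q (mball v (u j) (k + j%:Z)).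
  elim=> [|j IH] /=; first by have -> : k + 0%N%:Z = k by lia.
  by have [] := hf (j, u j) IH.
have hu : forall j, mge (k + j%:Z) (u j.+1 - u j).
  by move=> j; have [] := hf (j, u j) (nQu j).
have [L hL] := mx_complete hu.
have [l Ql] := Qloc L.
apply: (nQu `|l - k|%N); apply: QS Ql => y /mballE hy; apply/mballE.
rewrite -[y : 'M[F]_n](subrK (u `|l - k|%N)) -addrA; apply: (mgeD HF).
  by apply: mgeW hy; lia.
by apply: mgeW (hL _); lia.
Qed.

End Compactness.

(** * Characteristic polynomials and power-bounded elements *)

Section CharPoly.
Variables (F : fieldType) (n' : nat).
Local Notation n := n'.+1.
Implicit Types (x A B : 'M[F]_n) (f p q : {poly F}).
Local Notation "A ^P" := (map_mx polyC A) (at level 2).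

(** Division by the linear polynomial X - x over matrices, one coefficient of f at a time. It serves
    both for annihilating polynomials and for the trace identity [horner_adjtr]. *)
Lemma matrix_factor x f :
  exists Q : 'M[{poly F}]_n, f%:M - (horner_mx x f)^P = Q *m char_poly_mx x.
Proof.
elim/poly_ind: f => [|p c [Q hQ]].
  by exists 0; rewrite mul0mx [in X in _ - X]rmorph0 raddf0 map_mx0 subr0.
exists ('X *: Q + (horner_mx x p)^P); rewrite mulmxDl -scalemxAl -hQ.
rewrite [horner_mx x (_ + _)]rmorphD /= [horner_mx x (_ * _)]rmorphM /=.
rewrite horner_mx_X horner_mx_C map_mxD [(_ * x) ^P]map_mxM map_scalar_mx /=.
rewrite /char_poly_mx mulmxBr mul_mx_scalar scalerBr.
rewrite scale_scalar_mx mulrC raddfD /=; set u := 'X *: _; set w := _ *m _.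
by rewrite addrA subrK opprD addrACA subrr addr0.
Qed.

(** With f(x) = 0 the factorization says that the scalar matrix f equals Q (X - x); take
    determinants. *)
Lemma char_poly_dvd_exp x f : horner_mx x f = 0 -> char_poly x %| f ^+ n.
Proof.
move=> fx; have [Q] := matrix_factor x f; rewrite fx.
rewrite map_mx0 subr0 => e.
by apply/dvdpP; exists (\det Q); rewrite -det_mulmx -e det_scalar.
Qed.

(** Split p as h g with g = gcd(p, f). Separability makes h prime to g, hence to f and its powers;
    as h divides f^k, it is a unit. *)
Lemma separable_dvd_exp p f k : separable_poly p -> p %| f ^+ k -> p %| f.
Proof.
move=> sp dv.
have e : p = (p %/ gcdp p f) * gcdp p f by rewrite divpK // dvdp_gcdl.
set g := gcdp p f in e *; set h := p %/ g in e *.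
have : separable_poly (h * g) by rewrite -e.
rewrite separable_mul => /and3P[_ _ chg].
have hp : h %| p by rewrite e dvdp_mulr.
have chf : coprimep h f.
  rewrite coprimep_def -dvdp1; apply: (@dvdp_trans _ (gcdp h g)).
    rewrite dvdp_gcd dvdp_gcdl /g dvdp_gcd dvdp_gcdr andbT.
    exact: dvdp_trans (dvdp_gcdl _ _) hp.
  by rewrite dvdp1 -coprimep_def.
have h1 : h %= 1.
  have cf : coprimep h (f ^+ k) by apply: coprimep_expr.
  rewrite /eqp dvd1p andbT -(Gauss_dvdpr 1 cf) mulr1; exact: dvdp_trans hp dv.
apply: (@dvdp_trans _ g); last exact: dvdp_gcdr.
by rewrite [p in p %| _]e (eqp_dvdl _ (eqp_mulr g h1)) mul1r.
Qed.

Lemma separable_char_dvd x f : separable_poly (char_poly x) ->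
  horner_mx x f = 0 -> char_poly x %| f.
Proof. by move=> sx /char_poly_dvd_exp; apply: separable_dvd_exp. Qed.

Lemma deriv_prod m (p : 'I_m -> {poly F}) :
  deriv (\prod_i p i) = \sum_i deriv (p i) * \prod_(k | i != k) p k.
Proof.
elim: m p => [|m IH] p; first by rewrite !big_ord0 derivC.
rewrite big_ord_recl derivM IH [RHS]big_ord_recl; congr (_ * _ + _).
  rewrite [RHS]big_mkcond big_ord_recl /= mul1r; exact: eq_bigr.
rewrite big_distrr /=; apply: eq_bigr => i _.
rewrite mulrCA; congr (_ * _); rewrite [RHS]big_mkcond big_ord_recl /=.
congr (_ * _); rewrite big_mkcond; apply: eq_bigr => j _.
by rewrite (inj_eq (@lift_inj _ _)).
Qed.

(** Jacobi's formula for X - x: after expansion of the diagonal cofactors both sides agree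
    permutation by permutation. *)
Lemma deriv_char_poly x : deriv (char_poly x) = \tr (\adj (char_poly_mx x)).
Proof.
rewrite /char_poly /determinant raddf_sum /=.
have -> : \tr (\adj (char_poly_mx x)) = \sum_i cofactor (char_poly_mx x) i i.
  by apply: eq_bigr => i _; rewrite mxE.
rewrite (eq_bigr _ (fun i _ => expand_cofactor _ i i)).
rewrite (exchange_big_dep predT) //=; apply: eq_bigr => s _.
have -> : ((-1) ^+ (s : {perm 'I_n}) : {poly F}) = ((-1) ^+ s)%:P.
  by rewrite rmorphXn /= polyCN.
rewrite mul_polyC derivZ deriv_prod scaler_sumr [RHS]big_mkcond /=.
apply: eq_bigr => i _.
rewrite !mxE derivB derivC subr0 eq_sym; case: eqP => _.
  by rewrite mulr1n derivX mul1r mul_polyC.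
by rewrite mulr0n deriv0 mul0r scaler0.
Qed.

(** If adj(X - x) = sum_k A_k X^k, this is the polynomial with coefficients tr(A A_k). *)
Definition adjtr x A : {poly F} := \tr (A^P *m \adj (char_poly_mx x)).

(** Euler's trace identity. Multiplying [matrix_factor] by adj(X - x) and taking traces gives f chi'
    - [adjtr] = tr(Q) chi, and chi vanishes at x. *)
Lemma horner_adjtr x f :
  horner_mx x (adjtr x (horner_mx x f)) = horner_mx x f * horner_mx x (deriv (char_poly x)).
Proof.
have [Q hQ] := matrix_factor x f.
have e : f * (deriv (char_poly x)) - adjtr x (horner_mx x f) = \tr Q * char_poly x.
  rewrite deriv_char_poly -mxtraceZ -mul_scalar_mx /adjtr -raddfB /= -mulmxBl hQ.
  by rewrite -mulmxA mul_mx_adj mul_mx_scalar mxtraceZ mulrC.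
apply/eqP; rewrite eq_sym -subr_eq0 -rmorphM -rmorphB /= e rmorphM /= Cayley_Hamilton.
by rewrite mulr0.
Qed.

End CharPoly.

Section WeightedGauss.
Variables (F : fieldType) (v : F -> int).
Hypothesis HF : nonarch_local_field v.
Local Notation vge := (vge v).
Local Notation mge := (mge v).
Implicit Types (p q : {poly F}).

(* Gauss valuation of p >= k when X has valuation -o *)
Definition wge (o k : int) p : Prop := forall i : nat, vge (k + o * i%:Z) p`_i.

Section Weight.
Variable o : int.
Local Notation wge := (wge o).

Lemma wge0 k : wge k 0. Proof. by move=> i; rewrite coef0 vge0. Qed.

Lemma wgeD k p q : wge k p -> wge k q -> wge k (p + q).
Proof. by move=> hp hq i; rewrite coefD; apply: (vgeD HF). Qed.

Lemma wgeN k p : wge k p -> wge k (- p).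
Proof. by move=> hp i; rewrite coefN (vgeN HF). Qed.

Lemma wgeC k c : vge k c -> wge k c%:P.
Proof. by move=> h [|i]; rewrite coefC /= ?vge0 // mulr0 addr0. Qed.

Lemma wgeX : wge (- o) 'X.
Proof.
move=> i; rewrite coefX; case: eqP => [->|_]; last exact: vge0.
by rewrite mulr1 addNr; apply: (vge01 HF).
Qed.

Lemma wgeM k l p q : wge k p -> wge l q -> wge (k + l) (p * q).
Proof.
move=> hp hq i; rewrite coefM; apply: (vge_sum HF) => j _.
have -> : k + l + o * i%:Z = (k + o * (j : nat)%:Z) + (l + o * (i - j)%N%:Z).
  have -> : i%:Z = (j : nat)%:Z + (i - j)%N%:Z by have := ltn_ord j; lia.
  by ring.
exact: (vgeM HF).
Qed.

Lemma wge_sum I (r : seq I) (P : pred I) (E : I -> {poly F}) k :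
  (forall i, P i -> wge k (E i)) -> wge k (\sum_(i <- r | P i) E i).
Proof.
move=> h; apply: (big_ind (fun x => wge k x)); first exact: wge0.
  by move=> a b; exact: wgeD.
by [].
Qed.

Lemma wge_sign (j : nat) k p : wge k p -> wge k ((-1) ^+ j * p).
Proof.
by move=> hp; rewrite -signr_odd; case: (odd j); rewrite ?mul1r ?mulN1r //; apply: wgeN.
Qed.

Lemma wge_prod m (E : 'I_m -> {poly F}) k :
  (forall i, wge k (E i)) -> wge (k *+ m) (\prod_i E i).
Proof.
elim: m E => [|m IH] E h.
  by rewrite big_ord0 mulr0n; apply: wgeC; apply: (vge01 HF).
by rewrite big_ord_recl mulrS; apply: wgeM => //; apply: IH.
Qed.

Lemma wge_det m k (A : 'M[{poly F}]_m) : (forall i j, wge k (A i j)) ->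
  wge (k *+ m) (\det A).
Proof.
by move=> hA; apply: wge_sum => s _; apply: wge_sign; apply: wge_prod => i; apply: hA.
Qed.

Lemma wge_adj m k (A : 'M[{poly F}]_m) : (forall i j, wge k (A i j)) ->
  forall i j, wge (k *+ m.-1) (\adj A i j).
Proof.
move=> hA i j; rewrite mxE /cofactor; apply: wge_sign; apply: wge_det => a b.
by rewrite !mxE; apply: hA.
Qed.

Lemma wge_char_poly_mx m (x : 'M[F]_m) : mge (- o) x ->
  forall i j, wge (- o) (char_poly_mx x i j).
Proof.
move=> hx i j; rewrite !mxE; apply: wgeD; last by apply: wgeN; apply: wgeC.
by case: (i == j); rewrite ?mulr1n ?mulr0n; [exact: wgeX|exact: wge0].
Qed.

Lemma wge_char_poly m (x : 'M[F]_m) : mge (- o) x -> wge (- o *+ m) (char_poly x).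
Proof. by move=> hx; apply: wge_det; apply: wge_char_poly_mx. Qed.

Lemma mgeX m k (x : 'M[F]_m) i : mge k x -> mge (k * i%:Z) (x ^+ i).
Proof.
move=> hx; elim: i => [|i IH]; first by rewrite mulr0; apply: (mge1 HF).
have -> : k * i.+1%:Z = k + k * i%:Z by rewrite -addn1 PoszD; ring.
by rewrite exprS; apply: (mgeM HF).
Qed.

Lemma horner_mx_sum m (x : 'M[F]_m.+1) p :
  horner_mx x p = \sum_(i < size p) p`_i *: x ^+ i.
Proof.
rewrite -[p in LHS]coefK poly_def rmorph_sum /=; apply: eq_bigr => i _.
by rewrite linearZ /= rmorphXn /= horner_mx_X.
Qed.

Lemma wge_horner m (x : 'M[F]_m.+1) k p :
  mge (- o) x -> wge k p -> mge k (horner_mx x p).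
Proof.
move=> hx hp; rewrite horner_mx_sum; apply: (mge_sum HF) => i _.
have -> : k = (k + o * (i : nat)%:Z) + - o * (i : nat)%:Z by ring.
by apply: (mgeZ HF); [exact: hp|exact: mgeX].
Qed.

End Weight.

(* [k] is the minimal valuation of the coefficients, attained first at index [i] *)
Definition gval p (k : int) (i : nat) : Prop :=
  [/\ p`_i != 0, v p`_i = k, wge 0 k p & forall j, (j < i)%N -> vge (k + 1) p`_j].

Lemma wgeE k p : wge 0 k p <-> forall i, vge k p`_i.
Proof. by split=> h i; have := h i; rewrite mul0r addr0. Qed.

(** Gauss's lemma. Since i and j are the first indices where the minima are attained, exactly one
    term of the coefficient of index i + j reaches valuation k + l, and it cannot cancel. *)
Lemma gvalM p q k l i j : gval p k i -> gval q l j -> gval (p * q) (k + l) (i + j)%N.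
Proof.
move=> [pi vp hp mp] [qj vq hq mq].
have hp' := (wgeE k p).1 hp; have hq' := (wgeE l q).1 hq.
have small : forall s t, ((s < i) || (t < j))%N -> vge (k + l + 1) (p`_s * q`_t).
  move=> s t /orP[h|h].
    have -> : k + l + 1 = (k + 1) + l by ring.
    by apply: (vgeM HF) => //; apply: mp.
  by rewrite -addrA; apply: (vgeM HF) => //; apply: mq.
have lt : (i < (i + j).+1)%N by lia.
have [nz val] : p`_i * q`_j + (\sum_(s < (i + j).+1 | s != Ordinal lt) p`_s * q`_(i + j - s))
   != 0 /\ v (p`_i * q`_j + (\sum_(s < (i + j).+1 | s != Ordinal lt) p`_s * q`_(i + j - s)))
   = v (p`_i * q`_j).
  apply: (@val_eqD _ _ HF _ _ (k + l + 1)); first exact: mulf_neq0.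
    by rewrite (valM HF) // vp vq; lia.
  apply: (vge_sum HF) => s; rewrite -val_eqE /= => si; apply: small.
  have := ltn_ord s; lia.
have e : (p * q)`_(i + j) = p`_i * q`_j +
    (\sum_(s < (i + j).+1 | s != Ordinal lt) p`_s * q`_(i + j - s)).
  by rewrite coefM (bigD1 (Ordinal lt)) //= addKn.
split; first by rewrite e.
- by rewrite e val (valM HF) // vp vq.
- exact: wgeM.
move=> s hs; rewrite coefM; apply: (vge_sum HF) => t _; apply: small.
by have := ltn_ord t; lia.
Qed.

Lemma gvalX p k i m : gval p k i -> gval (p ^+ m) (k *+ m) (i * m)%N.
Proof.
move=> h; elim: m => [|m IH].
  rewrite muln0 mulr0n expr0; split.
  - by rewrite coef1 oner_neq0.
  - by rewrite coef1 (val1 HF).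
  - by apply: wgeC; apply: (vge01 HF).
  - by [].
by rewrite exprS mulrS mulnS; apply: gvalM.
Qed.

Lemma gval_ex p : p != 0 -> exists k i, gval p k i.
Proof.
move=> p0; pose A := \row_(j < size p) p`_j.
have A0 : A != 0.
  apply: contraNneq p0 => /rowP e; apply/eqP/polyP => j; rewrite coef0.
  have [lt|ge] := ltnP j (size p); last by rewrite nth_default.
  by have := e (Ordinal lt); rewrite !mxE.
have [k hk] := mge_nz v A0.
have hp : forall j, vge k p`_j.
  move=> j; have [lt|ge] := ltnP j (size p); last by rewrite nth_default ?vge0.
  by have := (hk k).2 (lexx k) 0 (Ordinal lt); rewrite mxE.
have : exists j, ~~ vge (k + 1) p`_j.
  apply/not_existsP => h; have : k + 1 <= k; last lia.
  by apply/hk => i j; rewrite mxE; apply/negPn/negP/h.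
move=> /ex_minnP [i hi mini]; exists k, i.
have [pi lt] := vge_nz hi.
split=> //.
- by have := hp i; rewrite vgeP //; lia.
- exact/wgeE.
- by move=> j ji; apply/negPn/negP => /mini; lia.
Qed.

(** The minimal valuation k of p becomes k m for p^m; a negative k would fall below c already for m
    = |c| + 1. *)
Lemma gauss_pow p c : (forall m, wge 0 c (p ^+ m)) -> wge 0 0 p.
Proof.
move=> h; have [->|/gval_ex [k [i g]]] := eqVneq p 0; first exact: wge0.
have [k0|k0] := leP 0 k.
  by case: g => _ _ /wgeE hp _; apply/wgeE => j; apply: vgeW (hp j).
have [nz val _ _] := gvalX `|c|.+1 g.
have := (wgeE _ _).1 (h `|c|.+1) (i * `|c|.+1)%N.
rewrite vgeP // val -mulr_natr natz; nia.
Qed.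

End WeightedGauss.

(** * A bound for power-bounded elements of F[x] in terms of x *)

Section PowerBounded.
Variables (F : fieldType) (v : F -> int).
Hypothesis HF : nonarch_local_field v.
Variable n' : nat.
Local Notation n := n'.+1.
Local Notation vge := (vge v).
Local Notation mge := (mge v).
Local Notation wge := (wge v).
Local Notation pw := (pw HF).
Implicit Types (x s A B : 'M[F]_n) (f p q : {poly F}).
Local Notation "A ^P" := (map_mx polyC A) (at level 2).

(** For elements of F[x] this is integrality over O_F, in a form that needs no integral closure and
    is stable under conjugation. *)
Definition pb s : Prop := exists c, forall k : nat, mge c (s ^+ k).

Lemma pb_idem e : e * e = e -> pb e.
Proof.
move=> ee; have [c hc] := mge_ex v e; exists (Num.min c 0) => -[|k].
  have h1 : mge 0 (1 : 'M[F]_n) by exact: mge1.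
  by rewrite expr0; apply: mgeW h1; rewrite ge_min lexx orbT.
have -> : e ^+ k.+1 = e by elim: k => [|k IH] //; rewrite exprS IH.
by apply: mgeW hc; rewrite ge_min lexx.
Qed.

Lemma pb_mul_integral s B : pb s -> mge 0 B -> GRing.comm s B -> pb (s * B).
Proof.
move=> [c hc] hB cB; exists c => k; rewrite exprMn_comm // -[c]addr0.
apply: (mgeM HF) => //; have := mgeX HF k hB; by rewrite mul0r.
Qed.

Lemma exp_conj (g A : 'M[F]_n) k : \det g != 0 ->
  (g *m A *m invmx g) ^+ k = g *m A ^+ k *m invmx g.
Proof.
move=> dg; have u : g \in unitmx by rewrite det_unit.
elim: k => [|k IH]; first by rewrite !expr0 mulmx1 mulmxV.
by rewrite !exprS IH; do !rewrite -mulmxE; rewrite !mulmxA mulmxKV.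
Qed.

Lemma pb_conj (g s : 'M[F]_n) : \det g != 0 -> pb s -> pb (g *m s *m invmx g).
Proof.
move=> dg [c hc]; have [k hk] := mge_ex v g; have [l hl] := mge_ex v (invmx g).
exists (k + c + l) => j; rewrite exp_conj //.
by do 2!apply: (mgeM HF) => //.
Qed.

(** By the binomial formula the coefficients of (X - A)^m are bounded independently of m. So are
    those of its determinant, the m-th power of the characteristic polynomial, and [gauss_pow]
    concludes. *)
Lemma pb_char_poly A : pb A -> wge 0 0 (char_poly A).
Proof.
move=> [c hc]; apply: (@gauss_pow _ _ HF _ (c *+ n)) => m.
have -> : char_poly A ^+ m = \det (char_poly_mx A ^+ m).
  elim: m => [|m IH]; first by rewrite !expr0 det1.
  by rewrite !exprS IH -det_mulmx.
apply: (wge_det HF) => i j.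
have cXA : GRing.comm ('X%:M : 'M[{poly F}]_n) A^P by rewrite /GRing.comm -!mulmxE scalar_mxC.
rewrite /char_poly_mx (exprBn_comm _ cXA) summxE; apply: (wge_sum HF) => k _.
have -> : ('X%:M : 'M[{poly F}]_n) ^+ (m - k) = ('X ^+ (m - k))%:M by rewrite -rmorphXn.
have -> : A^P ^+ k = (A ^+ k)^P by rewrite -rmorphXn.
have h : wge 0 c ((('X ^+ (m - k))%:M * (A ^+ k)^P : 'M[{poly F}]_n) i j).
  rewrite -mulmxE mul_scalar_mx !mxE -[c]add0r; apply: (wgeM HF).
    apply/wgeE => t; rewrite coefXn; case: eqP => _; [exact: (vge01 HF)|exact: vge0].
  by apply: wgeC; apply: hc.
rewrite -mulrA -signr_odd; elim: 'C(m, k) => [|t IH].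
  by rewrite mulr0n mxE; apply: wge0.
rewrite mulrS mxE; apply: (wgeD HF) => //.
by case: (odd k); rewrite ?mul1r // mulN1r mxE; apply: (wgeN HF).
Qed.

Lemma pb_trace A : pb A -> vge 0 (\tr A).
Proof.
move=> /pb_char_poly /wgeE h; have := char_poly_trace A (ltn0Sn n').
by move=> /(congr1 (vge 0)); rewrite h (vgeN HF) => <-.
Qed.

(** Commutation with X - x passes to the adjugate up to the factor chi, which is nonzero and can be
    cancelled. *)
Lemma comm_char_poly_adj x s : GRing.comm s x ->
  s^P *m \adj (char_poly_mx x) = \adj (char_poly_mx x) *m s^P.
Proof.
move=> csx; set M := char_poly_mx x; set N := \adj M.
have cM : s^P *m M = M *m s^P.
  by rewrite /M /char_poly_mx mulmxBr mulmxBl scalar_mxC -!map_mxM; congr (_ - _^P).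
have ND : forall B : 'M[{poly F}]_n, N *m (M *m B) = char_poly x *: B.
  by move=> B; rewrite mulmxA mul_adj_mx mul_scalar_mx.
have e : char_poly x *: (s^P *m N) = char_poly x *: (N *m s^P).
  rewrite -ND (mulmxA M) -cM -(mulmxA s^P) (mul_mx_adj M).
  by rewrite mul_mx_scalar -scalemxAr.
have p0 : char_poly x != 0 by rewrite monic_neq0 // char_poly_monic.
apply/matrixP => i j; move/matrixP/(_ i j): e; rewrite !mxE.
exact: (mulfI p0).
Qed.

(** Each coefficient is tr(s B) with B a coefficient matrix of adj(X - x), and B commutes with s.
    Once B is rescaled to be integral, s B is power-bounded and its trace is integral. *)
Lemma wge_adjtr o x s : mge (- o) x -> GRing.comm s x -> pb s ->
  wge o (- o *+ n') (adjtr x s).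
Proof.
move=> hx csx ps i.
set k := - o *+ n' + _.
pose B := map_mx (coefp i) (\adj (char_poly_mx x)).
have hB : mge k B.
  by move=> a b; rewrite mxE /=; apply: (wge_adj HF (wge_char_poly_mx HF hx)).
have cB : s *m B = B *m s.
  apply/matrixP => a b; have /matrixP/(_ a b)/(congr1 (coefp i)) := comm_char_poly_adj csx.
  rewrite !mxE /= !coef_sum => e; transitivity
    (\sum_(c < n) (s^P a c * \adj (char_poly_mx x) c b)`_i).
    by apply: eq_bigr => c _; rewrite [B c b]mxE [s^P a c]mxE coefCM.
  by rewrite e; apply: eq_bigr => c _; rewrite [B a c]mxE [s^P c b]mxE coefMC.
have -> : (adjtr x s)`_i = \tr (s *m B).
  rewrite /adjtr /mxtrace coef_sum; apply: eq_bigr => a _.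
  rewrite !mxE coef_sum; apply: eq_bigr => c _.
  by rewrite [B c a]mxE [s^P a c]mxE coefCM.
have -> : B = pw k *: (pw (- k) *: B) by rewrite scalerA pwKV scale1r.
rewrite -scalemxAr mxtraceZ -[k]addr0 (vgeMl HF) ?pw_neq0 ?val_pw ?addr0 //.
apply: pb_trace; apply: (pb_mul_integral ps).
  by rewrite -(addNr k); apply/(mgeZ_pw HF).
by rewrite /GRing.comm -!mulmxE -scalemxAl -scalemxAr cB.
Qed.

Lemma size_deriv_le p : (size (deriv p) <= (size p).-1)%N.
Proof.
have [->|p0] := eqVneq p 0; first by rewrite deriv0 size_poly0.
by have := lt_size_deriv p0; lia.
Qed.

Lemma size_mul_le p q i j : (size p <= i)%N -> (size q <= j.+1)%N ->
  (size (p * q)%R <= i + j)%N.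
Proof.
move=> hp hq; apply: leq_trans (size_polyMleq _ _) _.
by rewrite -subn1 leq_subLR add1n -addnS; apply: leq_add.
Qed.

(** The first row of the adjugate of the Sylvester matrix contains the Bezout coefficients: its
    product with that matrix is the resultant times the first basis vector. Its entries are minors
    of order deg p + deg q - 1, whence the bound on w. *)
Lemma resultant_bezout p q : (1 < size p)%N -> q != 0 ->
  exists u w : {poly F}, [/\ (resultant p q)%:P = u * p + w * q,
   (size w < size p)%N &
   forall k : int, 0 <= k -> wge 0 (- k) p -> wge 0 (- k) q ->
     wge 0 (- k *+ ((size q).-1 + (size p).-1).-1) w].
Proof.
move=> sp q0.
have dS_gt0 : (0 < (size q).-1 + (size p).-1)%N by lia.
pose j0 := Ordinal dS_gt0.
pose c := row j0 (\adj (Sylvester_mx p q)).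
exists (rVpoly (lsubmx c)), (rVpoly (rsubmx c)); split.
- have : c *m Sylvester_mx p q = row j0 ((resultant p q)%:M).
    by rewrite -row_mul mul_adj_mx.
  rewrite -{1}(hsubmxK c) /Sylvester_mx mul_row_col !mul_rV_lin1 /= -linearD /=.
  move=> /(congr1 rVpoly); rewrite poly_rV_K.
    move=> ->; apply/polyP => i; rewrite coefC coef_rVpoly.
    case: insubP => [j _ <-|]; last by case: i => //=; rewrite dS_gt0.
    by rewrite !mxE eq_sym -val_eqE /=; case: eqP; rewrite ?mulr1n ?mulr0n.
  have su : (size (rVpoly (lsubmx c)) <= (size q).-1)%N by exact: size_poly.
  have sw : (size (rVpoly (rsubmx c)) <= (size p).-1)%N by exact: size_poly.
  have q1 : (0 < size q)%N by rewrite size_poly_gt0.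
  apply: leq_trans (size_polyD _ _) _; rewrite geq_max.
  rewrite (size_mul_le su) ?prednK ?(ltnW sp) //=.
  by rewrite addnC (size_mul_le sw) ?prednK.
- apply: (@leq_ltn_trans (size p).-1); first exact: size_poly.
  by rewrite prednK // ltnW.
move=> k k0 /wgeE hp /wgeE hq; apply/wgeE => i.
rewrite coef_rVpoly; case: insubP => [j _ _|_]; last exact: vge0.
rewrite !mxE; have /(_ _ j0 (rshift _ j)) := @mge_adj _ _ HF _ (- k) (Sylvester_mx p q).
rewrite mxE; apply => a b; rewrite Sylvester_mxE.
by case: (fintype.split a) => t; case: leqP; rewrite ?mulr1n ?mulr0n ?vge0.
Qed.

Lemma horner_bound_arith (N i m o : int) : 0 <= o -> 0 <= m -> N <= 2 * m -> i <= m ->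
  - (2 * m * m * o) - m * o <= - (m * o) * N + - o * i.
Proof.
move=> o0 m0 hN hi; have h1 := ler_wpM2l (mulr_ge0 m0 o0) hN.
have h2 := ler_wpM2l o0 hi.
have -> : - (2 * m * m * o) - m * o = - (m * o * (2 * m)) - o * m by ring.
have -> : - (m * o) * N + - o * i = - (m * o * N) - o * i by ring.
by apply: lerD; rewrite lerN2.
Qed.

Lemma pb_bound_arith (m o d : int) : 0 <= o -> 1 <= m ->
  - (4 * (m * m) * o + d) <= - d + (- (2 * m * m * o) - m * o + - o * (m - 1)).
Proof.
move=> o0 m1; have h1 := ler_wpM2l o0 m1.
have m0 : 0 <= m by apply: le_trans m1.
have h2 := ler_wpM2l (mulr_ge0 m0 o0) m1.
have -> : - (4 * (m * m) * o + d) = - (2 * m * m * o) - d - m * o * m - m * o * m by ring.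
have -> : - d + (- (2 * m * m * o) - m * o + - o * (m - 1)) =
  - (2 * m * m * o) - d - m * o * 1 - (o * m - o * 1) by ring.
apply: lerD; first by apply: lerD; rewrite ?lerN2.
rewrite lerN2; apply: le_trans (_ : o * m <= _).
  by rewrite gerBl mulr1.
by move: h2; rewrite mulr1 [m * o]mulrC.
Qed.

(** Bezout at x gives res s = w(x) (s chi'(x)). The factor s chi'(x) is [adjtr] at x and loses (n -
    1) o. The coefficients of w are minors of order below 2n in entries of valuation at least - n o,
    and its degree is below n, so w(x) loses at most 2 n^2 o + n o. Dividing by the resultant costs
    d. *)
Lemma pb_horner_bound (o d : int) x f : 0 <= o -> mge (- o) x -> discr x != 0 -> v (discr x) <= d ->
  pb (horner_mx x f) -> mge (- (4 * (n * n)%N%:Z * o + d)) (horner_mx x f).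
Proof.
move=> o0 hx dx vd ps; set s := horner_mx x f in ps *.
have r0 : resultant (char_poly x) (deriv (char_poly x)) != 0.
  by apply: contraNneq dx => e; rewrite /discr e mulr0.
have sp : (1 < size (char_poly x))%N by rewrite size_char_poly.
have q0 : deriv (char_poly x) != 0.
  apply: contraNneq r0 => ->; rewrite resultant_eq0 gcdp0.
  by rewrite size_char_poly.
have csx : GRing.comm s x by apply: comm_horner_mx.
have hP : mge (- o *+ n') (s * horner_mx x (deriv (char_poly x))).
  by rewrite -horner_adjtr; apply: (wge_horner HF hx); apply: wge_adjtr.
have [u [w [bez sw hw]]] := resultant_bezout sp q0.
have hchi : wge 0 (- (o *+ n)) (char_poly x).
  have := wge_char_poly HF hx; rewrite mulNrn => h; apply/wgeE => i.
  by apply: vgeW (h i); rewrite -[X in X <= _]addr0 lerD2l mulr_ge0.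
have hchi' : wge 0 (- (o *+ n)) (deriv (char_poly x)).
  apply/wgeE => i; rewrite coef_deriv.
  have := (wgeE _ _ _).1 hchi i.+1; move: (_`_i.+1) => a ha.
  by elim: i.+1 => [|t IH]; rewrite ?mulr0n ?vge0 // [a *+ t.+1]mulrS; apply: (vgeD HF).
have on0 : 0 <= o *+ n by rewrite mulrn_wge0.
have {hw} hw := hw _ on0 hchi hchi'.
have sq := size_deriv_le (char_poly x).
have hwx : mge (- (2 * n%:Z * n%:Z * o) - n%:Z * o) (horner_mx x w).
  rewrite horner_mx_sum; apply: (mge_sum HF) => i _.
  have hwi := (wgeE _ _ _).1 hw i.
  apply: mgeW (mgeZ HF hwi (mgeX HF i hx)).
  rewrite -(mulr_natr (- (o *+ n))) -(mulr_natl o n) !natz; apply: horner_bound_arith => //.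
    rewrite -PoszM lez_nat; move: sq; rewrite size_char_poly /= => sq.
    apply: leq_trans (leq_pred _) _.
    by rewrite mul2n -addnn leq_add2r; apply: leq_trans (leq_pred _) _.
  rewrite lez_nat -ltnS; apply: leq_trans (ltn_ord i) _.
  by move: sw; rewrite size_char_poly => /ltnW.
have e : resultant (char_poly x) (deriv (char_poly x)) *: s =
   horner_mx x w * (s * horner_mx x (deriv (char_poly x))).
  have /(congr1 (horner_mx x)) := bez; rewrite horner_mx_C rmorphD !rmorphM /=.
  rewrite Cayley_Hamilton mulr0 add0r -mul_scalar_mx => ->.
  rewrite mulmxE -mulrA; congr (_ * _).
  by rewrite /s -!rmorphM mulrC.
have e2 : s = (resultant (char_poly x) (deriv (char_poly x)))^-1 *:
   (horner_mx x w * (s * horner_mx x (deriv (char_poly x)))).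
  by rewrite -e scalerA mulVf // scale1r.
have hr : vge (- d) (resultant (char_poly x) (deriv (char_poly x)))^-1.
  have : v (discr x) = v (resultant (char_poly x) (deriv (char_poly x))).
    rewrite /discr -signr_odd; case: odd; rewrite ?mul1r //.
    by rewrite mulN1r (valN HF).
  by move=> vr; apply: vge_val; rewrite (valV HF) // -vr lerN2.
rewrite e2; apply: mgeW (mgeZ HF hr (mgeM HF hwx hP)).
rewrite PoszM -(mulr_natr (- o)) (natz n'); have -> : n'%:Z = n%:Z - 1 by rewrite -addn1 PoszD addrK.
exact: pb_bound_arith.
Qed.

End PowerBounded.

(** * The algebra F[x] as a product of fields *)

Section Structure.
Variables (F : fieldType) (n' : nat).
Local Notation n := n'.+1.
Implicit Types (f p q : {poly F}) (s t : 'M[F]_n).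

Lemma irreducible_factors p : p != 0 ->
  exists r (P : 'I_r -> {poly F}),
    (forall a, irreducible_poly (P a)) /\ p %= \prod_a P a.
Proof.
have [m] := ubnP (size p); elim: m p => // m IH p sm p0.
have [s1|s1] := leqP (size p) 1.
  exists 0%N, (fun=> 1); split=> [[]//|].
  by rewrite big_ord0 -size_poly_eq1 eqn_leq s1 size_poly_gt0.
have [irr|nirr] := pselect (irreducible_poly p).
  by exists 1%N, (fun=> p); split=> //; rewrite big_ord1 eqpxx.
have [q [qp q1 qnp]] : exists q, [/\ q %| p, size q != 1%N & ~~ (q %= p)].
  apply/not_existsP => h; apply: nirr; split=> // q q1 qp.
  by apply/negPn/negP => qnp; apply: (h q).
have q0 : q != 0 by apply: contraTneq qp => ->; rewrite dvd0p.
have e : p = (p %/ q) * q by rewrite divpK.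
have d0 : p %/ q != 0 by apply: contraNneq p0 => h; rewrite e h mul0r.
have sq : (size q < size p)%N.
  rewrite ltn_neqAle (dvdp_leq p0 qp) andbT.
  by apply: contra qnp => /eqP sz; rewrite -dvdp_size_eqp // sz.
have sd : (size (p %/ q)%R < size p)%N.
  have q2 : (1 < size q)%N by rewrite ltn_neqAle eq_sym q1 size_poly_gt0.
  by rewrite size_divp // ltn_subrL size_poly_gt0 p0 andbT -subn1 subn_gt0.
have [r1 [P1 [i1 e1]]] := IH _ (leq_trans sd sm) d0.
have [r2 [P2 [i2 e2]]] := IH _ (leq_trans sq sm) q0.
exists (r1 + r2)%N, (fun a => match fintype.split a with inl b => P1 b | inr c => P2 c end).
split=> [a|]; first by case: (fintype.split a).
rewrite e big_split_ord /=; apply: eqp_trans (eqp_mulr _ e1) _.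
apply: eqp_trans (eqp_mull _ e2) _; apply/eqpW; congr (_ * _); apply: eq_bigr => a _.
  by rewrite -[lshift _ _]/(unsplit (inl a)) unsplitK.
by rewrite -[rshift _ _]/(unsplit (inr a)) unsplitK.
Qed.

(* The algebra F[x] of a matrix with separable characteristic polynomial: primitive
   idempotents [e a], the fields F[x] e_a, and a cyclic vector [v0]. *)
Record split_data (x : 'M[F]_n) (r : nat) (e : 'I_r -> 'M[F]_n) (v0 : 'cV[F]_n) : Prop := {
  sd_comm : forall s t, GRing.comm s x -> GRing.comm t x -> GRing.comm s t;
  sd_horner : forall s, GRing.comm s x -> exists f, s = horner_mx x f;
  sd_cyc : forall w : 'cV[F]_n, exists2 s, GRing.comm s x & w = s *m v0;
  sd_idx : forall a, GRing.comm (e a) x;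
  sd_idem : forall a, e a * e a = e a;
  sd_orth : forall a b, a != b -> e a * e b = 0;
  sd_sum : \sum_a e a = 1;
  sd_nz : forall a, e a != 0;
  sd_field : forall a s, GRing.comm s x -> s * e a != 0 ->
     exists2 t, GRing.comm t x & t * s * e a = e a;
  sd_card : (r <= n)%N }.

Lemma comm_horner (x : 'M[F]_n) f : GRing.comm (horner_mx x f) x.
Proof. exact: comm_horner_mx. Qed.

(** The Chinese remainder theorem: separability makes the irreducible factors P a of chi pairwise
    coprime, and identities in F[x] are divisibilities by chi. *)
Lemma split_data_ex x : separable_poly (char_poly x) ->
  exists r e v0, @split_data x r e v0.
Proof.
move=> sx; set chi := char_poly x in sx.
have chi0 : chi != 0 by rewrite monic_neq0 // char_poly_monic.
have [r [P [irr eP]]] := irreducible_factors chi0.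
have P0 a : P a != 0 by apply: irredp_neq0.
pose q a := \prod_(k | k != a) P k.
have Pq a : P a * q a %= chi by rewrite eqp_sym (eqp_trans eP) // (bigD1 a) //= eqpxx.
have chiPq a : chi %| P a * q a by rewrite (eqp_dvdr _ (Pq a)).
have /choice[uw huw] : forall a, exists uw : {poly F} * {poly F},
    uw.1 * P a + uw.2 * q a = 1.
  move=> a; apply/Bezout_eq1_coprimepP.
  have : separable_poly (P a * q a).
    by apply: dvdp_separable sx; rewrite (eqp_dvdl _ (Pq a)).
  by rewrite separable_mul => /and3P[].
(* E a is 1 modulo P a and 0 modulo the other factors. *)
pose E a := (uw a).2 * q a; pose e a := horner_mx x (E a).
have EP a : E a = 1 - (uw a).1 * P a by rewrite -(huw a) addrAC subrr add0r.
have kill f : chi %| f -> horner_mx x f = 0.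
  by move=> /dvdpP[g ->]; rewrite rmorphM /= Cayley_Hamilton mulr0.
have kill' f : horner_mx x f = 0 -> chi %| f by exact: separable_char_dvd.
have hM f g : horner_mx x (f * g) = horner_mx x f * horner_mx x g by exact: rmorphM.
have hB f g : horner_mx x (f - g) = horner_mx x f - horner_mx x g by exact: rmorphB.
have h1 : horner_mx x 1 = 1 by exact: rmorph1.
have PE a : horner_mx x (P a) * e a = 0.
  by rewrite -hM; apply: kill; rewrite /E mulrCA dvdp_mull.
(* The product of the P a divides f^r, and separability removes the exponent. *)
have all_dvd f : (forall a, P a %| f) -> chi %| f.
  move=> h; apply: (separable_dvd_exp (k := r) sx).
  rewrite (eqp_dvdl _ eP); have -> : f ^+ r = \prod_(a < r) f by rewrite prodr_const card_ord.
  apply: (big_ind2 (fun a b : {poly F} => a %| b)) => //.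
  by move=> *; exact: dvdp_mul.
have Pq' a b : a != b -> P a %| q b.
  by move=> ab; rewrite /q (bigD1 a) //= dvdp_mulr.
have nz a : e a != 0.
  apply/eqP => /kill' h; have Pchi : P a %| chi.
    by apply: dvdp_trans (_ : P a * q a %| _); rewrite ?dvdp_mulr // (eqp_dvdl _ (Pq a)).
  have := dvdp_trans Pchi h; rewrite EP dvdp_subl ?dvdp_mull // => /(dvdp_trans).
  move=> /(_ 1); rewrite dvdpp => /(_ isT); rewrite dvdp1.
  by case: (irr a) => + _; case: (size _) => [|[]].
have fld a f : horner_mx x f * e a != 0 -> exists g, horner_mx x (g * f) * e a = e a.
  move=> h; have cop : coprimep (P a) f.
    rewrite irreducible_poly_coprime //; apply: contraNN h => /dvdpP[g ->].
    by rewrite hM -mulrA PE mulr0.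
  have /Bezout_eq1_coprimepP [[u w] /= euw] := cop.
  exists w; have -> : w * f = 1 - u * P a by rewrite -euw addrAC subrr add0r.
  by rewrite hB h1 hM mulrBl mul1r -mulrA PE mulr0 subr0.
have /choice[w hw] : forall a, exists w : 'cV[F]_n, e a *m w != 0.
  move=> a; apply/not_existsP => h; move/eqP: (nz a); apply.
  apply/matrixP => i j; have /negP/negPn/eqP/matrixP/(_ i 0) := h (delta_mx j 0).
  by rewrite -colE !mxE.
have orth a b : a != b -> e a * e b = 0.
  move=> ab; rewrite -hM; apply: kill; rewrite /E mulrACA; apply: dvdp_mull.
  apply: dvdp_trans (chiPq b) _; apply: dvdp_mul; rewrite ?dvdpp //.
  by apply: Pq'; rewrite eq_sym.
have idem a : e a * e a = e a.
  by rewrite {1}/e EP hB h1 hM mulrBl mul1r -mulrA PE mulr0 subr0.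
have sum1 : \sum_a e a = 1.
  have -> : \sum_a e a = horner_mx x (\sum_a E a) by rewrite rmorph_sum.
  apply/eqP; rewrite -h1 eq_sym -subr_eq0 -hB; apply/eqP/kill/all_dvd => a.
  rewrite (bigD1 a) //= EP opprD addrA opprB addrCA subrr addr0 dvdp_sub ?dvdp_mull //.
  apply: (big_ind (fun p : {poly F} => P a %| p)) => [|f g|b ba].
  - exact: dvdp0.
  - exact: dvdp_add.
  - by apply: dvdp_mull; apply: Pq'; rewrite eq_sym.
(* A vector with nonzero component in every block is cyclic: if f(x) v0 = 0 but f(x) e_a is nonzero,
   inverting it in the field F[x] e_a would give e_a v0 = 0. *)
pose v0 := \sum_a e a *m w a.
have ev0 a : e a *m v0 = e a *m w a.
  rewrite /v0 mulmx_sumr (bigD1 a) //= mulmxA mulmxE idem big1 ?addr0 // => b ba.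
  by rewrite mulmxA mulmxE orth ?mul0mx // eq_sym.
have ann f : horner_mx x f *m v0 = 0 -> chi %| f.
  move=> h; apply: kill'; rewrite -[horner_mx x f]mulr1 -sum1 mulr_sumr big1 // => a _.
  apply/eqP/negPn/negP => /fld [g hg]; move/eqP: (hw a); apply.
  have -> : e a *m w a = horner_mx x (E a * g) *m (horner_mx x f *m v0).
    rewrite -ev0 mulmxA; congr (_ *m _); rewrite mulmxE -hM -hg -hM.
    by congr (horner_mx x _); ring.
  by rewrite h mulmx0.
(* The Krylov matrix with columns x^j v0. Its kernel consists of polynomials of degree below n
   divisible by chi, so it is zero. *)
pose K : 'M[F]_n := \matrix_(i, j) (x ^+ j *m v0) i 0.
have Kc (c : 'cV[F]_n) : K *m c = horner_mx x (\poly_(j < n) c (inord j) 0) *m v0.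
  rewrite poly_def rmorph_sum mulmx_suml /=; apply/matrixP => i k; rewrite ord1 mxE summxE.
  apply: eq_bigr => j _; rewrite linearZ /= rmorphXn /= horner_mx_X -scalemxAl.
  by rewrite /K mxE [RHS]mxE inord_val mulrC.
have cyc_ann (c : 'cV[F]_n) : K *m c = 0 -> c = 0.
  rewrite Kc => /ann h; apply/matrixP => i k; rewrite ord1 mxE.
  have := congr1 (fun p : {poly F} => p`_i) (_ : \poly_(j < n) c (inord j) 0 = 0).
  rewrite coef_poly ltn_ord inord_val coef0; apply.
  apply/eqP; apply: contraTT h => nz0; rewrite gtNdvdp //.
  by rewrite size_char_poly ltnS size_poly.
have Ku : K \in unitmx.
  rewrite -unitmx_tr -row_free_unit; apply: inj_row_free => u hu.
  apply: trmx_inj; rewrite trmx0; apply: cyc_ann.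
  by apply: trmx_inj; rewrite trmx_mul trmxK hu trmx0.
have cyc (w0 : 'cV[F]_n) : exists f, w0 = horner_mx x f *m v0.
  by have := Kc (invmx K *m w0); rewrite mulKVmx // => e0; eexists; exact: e0.
have ext (A B : 'M[F]_n) : (forall w0 : 'cV[F]_n, A *m w0 = B *m w0) -> A = B.
  move=> h; apply/matrixP => i j; have := h (delta_mx j 0).
  by rewrite -!colE => /matrixP/(_ i 0); rewrite !mxE.
(* A commuting s and the f(x) that agrees with it at v0 agree on F[x] v0, which is the whole
   space. *)
have hor s : GRing.comm s x -> exists f, s = horner_mx x f.
  move=> csx; have [f hf] := cyc (s *m v0); exists f; apply: ext => w0.
  have [g ->] := cyc w0; have c1 : comm_mx s (horner_mx x g) by apply: comm_mx_horner.
  by rewrite mulmxA c1 -mulmxA hf !mulmxA mulmxE -!hM mulrC.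
exists r, e, v0; split=> //.
- by move=> s t /hor[f ->] /hor[g ->]; rewrite /GRing.comm -!hM mulrC.
- by move=> w0; have [f hf] := cyc w0; exists (horner_mx x f) => //; apply: comm_horner.
- by move=> a; apply: comm_horner.
- move=> a s /hor[f ->] /fld[g hg]; exists (horner_mx x g); first exact: comm_horner.
  by rewrite -hM.
have := eqp_size eP; rewrite size_char_poly size_prod // cardT size_enum_ord => h.
have : (\sum_(a < r) 2 <= \sum_a size (P a))%N.
  by apply: leq_sum => a _; case: (irr a).
rewrite sum_nat_const card_ord; move: h; set S := (\sum_a _)%N; lia.
Qed.

End Structure.

(** * Norms on the field factors F[x] e_a *)

Section FieldFactors.
Variables (F : fieldType) (v : F -> int).
Hypothesis HF : nonarch_local_field v.
Variable n' : nat.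
Local Notation n := n'.+1.
Local Notation mge := (mge v).
Local Notation pw := (pw HF).
Local Notation pb := (pb v).
Variables (x : 'M[F]_n) (r : nat) (e : 'I_r -> 'M[F]_n) (v0 : 'cV[F]_n).
Hypothesis sd : split_data x e v0.
Implicit Types (s t g : 'M[F]_n).
Local Notation cx s := (GRing.comm s x).

Lemma closed_neq0 (f : 'M[F]_n -> 'M[F]_n) c (X : 'M[F]_n) :
  (forall k Y, mge k (Y - X) -> mge (k - c) (f Y - f X)) -> f X != 0 ->
  exists k, forall Y, mge k (Y - X) -> f Y != 0.
Proof.
move=> hf fX; have [k0 hk0] := mge_nz v fX.
exists (k0 + 1 + c) => Y /hf; rewrite addrK => h; apply: contraTneq isT => fY.
have : k0 + 1 <= k0; last by lia.
by apply/hk0; apply/mgeN => //; rewrite -sub0r -fY.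
Qed.

Lemma cx_mul s t : cx s -> cx t -> cx (s * t).
Proof. by move=> h1 h2; apply/commr_sym; apply: commrM; apply/commr_sym. Qed.

Lemma cx_add s t : cx s -> cx t -> cx (s + t).
Proof. by move=> h1 h2; apply/commr_sym; apply: commrD; apply/commr_sym. Qed.

Lemma cx_opp s : cx s -> cx (- s).
Proof. by move=> h1; apply/commr_sym; apply: commrN; apply/commr_sym. Qed.

Lemma cx1 : cx 1. Proof. exact/commr_sym/commr1. Qed.

Lemma cx_scale c s : cx s -> cx (c *: s).
Proof. by rewrite /GRing.comm -scalerAl -scalerAr => ->. Qed.

Lemma cx_exp s k : cx s -> cx (s ^+ k).
Proof. by move=> h; apply/commr_sym; apply: commrX; apply/commr_sym. Qed.

Variable a : 'I_r.
Local Notation ea := (e a).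
Local Notation compl s := (s + (1 - ea)).
Let cea : cx ea := sd_idx sd a.
Let eaea : ea * ea = ea := sd_idem sd a.

(** Completing s by the identity on the other blocks turns multiplication in F[x] e_a into a product
    of matrices. Thus [\det (compl s)] is the norm from the field F[x] e_a to F, and its valuation
    replaces an extension of v to this field. *)
Lemma factor_compl s t : cx s -> cx t -> s * ea = s -> t * ea = t ->
  compl s * compl t = compl (s * t).
Proof.
move=> cs ct hs ht.
have e1 : s * (1 - ea) = 0 by rewrite mulrBr mulr1 hs subrr.
have e2 : (1 - ea) * t = 0.
  by rewrite mulrBl mul1r -(sd_comm sd ct cea) ht subrr.
have e3 : (1 - ea) * (1 - ea) = 1 - ea.
  by rewrite mulrBr mulr1 mulrBl mul1r eaea subrr subr0.
by rewrite mulrDl (mulrDr s) (mulrDr (1 - ea)) e1 e2 e3 add0r addr0.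
Qed.

Lemma factor_inv s : cx s -> s * ea = s -> s != 0 ->
  exists t, [/\ cx t, t * ea = t, s * t = ea & t * s = ea].
Proof.
move=> cs hs s0; have [|t ct ht] := sd_field sd (a := a) cs; first by rewrite hs.
exists (t * ea); split; first exact: cx_mul.
- by rewrite -mulrA eaea.
- by rewrite (sd_comm sd cs (cx_mul ct cea)) -mulrA (sd_comm sd cea cs) mulrA.
- by rewrite -mulrA (sd_comm sd cea cs) mulrA.
Qed.

Lemma factor_det s : cx s -> s * ea = s -> s != 0 -> \det (compl s) != 0.
Proof.
move=> cs hs s0; have [t [ct ht st ts]] := factor_inv cs hs s0.
have : compl s * compl t = 1 by rewrite factor_compl // st addrC subrK.
move=> /(congr1 determinant); rewrite -mulmxE det_mulmx det1 => h.
by apply: contraTneq isT => h0; move: h; rewrite h0 mul0r => /eqP; rewrite eq_sym oner_eq0.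
Qed.

(** Compactness of the unit sphere of F[x] e_a: the sphere is closed, and near each of its points
    the norm is nonzero with constant valuation. *)
Lemma factor_sphere : exists c : int, forall s, cx s -> s * ea = s ->
  mge 0 s -> ~ mge 1 s -> v (\det (compl s)) <= c.
Proof.
pose C s := [/\ cx s, s * ea = s, mge 0 s & ~ mge 1 s].
pose Q (B : set (MX F n)) := exists c : int, forall s, B s -> C s -> v (\det (compl s)) <= c.
suff [c hc] : Q (mball v 0 0).
  by exists c => s h1 h2 h3 h4; apply: hc => //; apply/mballE; rewrite subr0.
apply: (ball_ind HF).
- by exists 0.
- move=> A B [c hc] [d hd]; exists (Num.max c d) => s [As|Bs] Cs; rewrite le_max.
    by rewrite hc.
  by rewrite hd ?orbT.
- by move=> A B AB [c hc]; exists c => s /AB; apply: hc.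
move=> X; have [k hk] : exists k, (forall Y, mge k (Y - X) -> ~ C Y) \/
     (forall Y, mge k (Y - X) -> v (\det (compl Y)) = v (\det (compl X))).
  have [hc|hc] := pselect (cx X); last first.
    have [c hx] := mge_ex v x.
    have [||k hk] := @closed_neq0 (fun s => s * x - x * s) (- c) X.
    - move=> k Y h; rewrite opprK; have -> : Y * x - x * Y - (X * x - x * X) = (Y - X) * x - x * (Y - X).
        by rewrite mulrBl mulrBr !opprB addrACA [RHS]addrACA; congr (_ + _); rewrite addrC.
      by apply: (mgeB HF); [exact: mgeM|rewrite addrC; apply: mgeM].
    - by rewrite subr_eq0; apply/eqP.
    by exists k; left => Y /hk /[swap] -[h _ _ _]; rewrite h subrr eqxx.
  have [he|he] := eqVneq (X * ea) X; last first.
    have [c hx] := mge_ex v (ea - 1).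
    have [||k hk] := @closed_neq0 (fun s => s * (ea - 1)) (- c) X.
    - by move=> k Y h; rewrite opprK -mulrBl; apply: (mgeM HF).
    - by rewrite mulrBr mulr1 subr_eq0.
    by exists k; left => Y /hk /[swap] -[_ h _ _]; rewrite mulrBr mulr1 h subrr eqxx.
  have [h0|h0] := pselect (mge 0 X); last first.
    exists 0; left => Y hY [_ _ hY0 _]; apply: h0.
    by rewrite -[X](subKr Y); apply: (mgeB HF).
  have [h1|h1] := pselect (mge 1 X).
    exists 1; left => Y hY [_ _ _]; apply.
    by rewrite -[Y](subrK X); apply: (mgeD HF).
  have X0 : X != 0 by apply: contra_notN h1 => /eqP ->; apply: mge0.
  have d0 := factor_det hc he X0.
  have [c hinv] := mge_ex v (invmx (compl X)).
  exists (1 - c); right => Y hY.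
  have -> : compl Y = compl X *m (1%:M + invmx (compl X) *m (Y - X)).
    rewrite mulmxDr mulmx1 mulKVmx ?det_unit //.
    by rewrite [RHS]addrC [RHS]addrA subrK.
  have [|d1 v1] := @cong_det _ _ HF _ (invmx (compl X) *m (Y - X)).
    by apply: (mgeW _ (mgeM HF hinv hY)); rewrite addrCA subrr addr0.
  by rewrite val_detM // v1 addr0.
exists k; case: hk => hk.
  by exists 0 => s /mballE /hk.
by exists (v (\det (compl X))) => s /mballE /hk ->.
Qed.

Lemma det_compl0 : \det (1 - ea) = 0.
Proof.
apply/eqP/negPn/negP; rewrite -det_unit => u.
have : (1 - ea) * ea = 0 by rewrite mulrBl mul1r eaea subrr.
move=> /(congr1 (mulmx (invmx (1 - ea)))); rewrite -mulmxE mulKmx // mulmx0.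
by apply/eqP; apply: (sd_nz sd).
Qed.

Lemma factor_scal (k : int) : cx (pw k *: ea) /\ pw k *: ea * ea = pw k *: ea.
Proof. by split; [apply: cx_scale|rewrite -scalerAl eaea]. Qed.

Lemma scal_neq0 k s : s != 0 -> pw k *: s != 0.
Proof. by move=> s0; rewrite scaler_eq0 negb_or pw_neq0. Qed.

Lemma val_factorM s t : cx s -> cx t -> s * ea = s -> t * ea = t -> s != 0 -> t != 0 ->
  v (\det (compl (s * t))) = v (\det (compl s)) + v (\det (compl t)).
Proof.
by move=> *; rewrite -factor_compl // -mulmxE val_detM //; apply: factor_det.
Qed.

(** The order of the norm of the uniformizer, that is, the degree of F[x] e_a over F. Only its
    positivity matters. *)
Let w : int := v (\det (compl (pw 1 *: ea))).

Lemma val_factor_nat (k : nat) : v (\det (compl (pw k%:Z *: ea))) = w * k%:Z.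
Proof.
elim: k => [|k IH].
  by rewrite pw0 scale1r addrC subrK det1 (val1 HF) mulr0.
have -> : pw k.+1%:Z *: ea = (pw 1 *: ea) * (pw k%:Z *: ea).
  by rewrite -scalerAl -scalerAr eaea scalerA -pwD; congr (pw _ *: _); lia.
have [c1 e1] := factor_scal 1; have [c2 e2] := factor_scal k.
rewrite val_factorM ?scal_neq0 ?(sd_nz sd) // IH -/w.
by have -> : k.+1%:Z = 1 + k%:Z by []; rewrite mulrDr mulr1.
Qed.

Lemma val_factor_pw (k : int) : v (\det (compl (pw k *: ea))) = w * k.
Proof.
have [k0|k0] := leP 0 k.
  by rewrite -(gez0_abs k0) val_factor_nat.
have ek : - k = `|k|%N%:Z by lia.
have [c1 e1] := factor_scal k; have [c2 e2] := factor_scal (- k).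
have := val_factorM c1 c2 e1 e2; rewrite !scal_neq0 ?(sd_nz sd) // => /(_ isT isT).
rewrite -scalerAl -scalerAr eaea scalerA pwKV scale1r addrC subrK det1 (val1 HF).
by rewrite ek val_factor_nat -ek mulrN => /esym/eqP; rewrite subr_eq0 => /eqP.
Qed.

(** Were w <= 0, the determinants of the completions of pw k e_a would keep valuation w k <= 0,
    although these matrices converge to the singular matrix 1 - e_a as k grows. *)
Lemma val_factor_gt0 : 0 < w.
Proof.
rewrite ltNge; apply/negP => w0.
have [c hc] := mge_exN v (1 - ea); have [d hd] := mge_exN v ea.
(* With this k the determinant differs from that of 1 - e_a, which is 0, by valuation at least - (c
   + d) n + (k - d) = 1. *)
pose k := ((c + d) * n + d + 1)%N.
have hA : mge (- (c + d)%N%:Z) (compl (pw k%:Z *: ea)).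
  apply: (mgeD HF); last by apply: mgeW hc; lia.
  have : mge (k%:Z + - d%:Z) (pw k%:Z *: ea) by apply/(mgeZ_pw HF).
  by apply: mgeW; lia.
have hB : mge (- (c + d)%N%:Z) (1 - ea) by apply: mgeW hc; lia.
have hAB : mge (- (c + d)%N%:Z + (k - d)%N%:Z) (compl (pw k%:Z *: ea) - (1 - ea)).
  rewrite addrK; have : mge (k%:Z + - d%:Z) (pw k%:Z *: ea) by apply/(mgeZ_pw HF).
  by apply: mgeW; lia.
have := det_congr HF (_ : 0 <= (k - d)%N%:Z) hA hB hAB; rewrite det_compl0 subr0 => /(_ isT).
have [c2 e2] := factor_scal k%:Z.
rewrite vgeP; last by rewrite factor_det ?scal_neq0 ?(sd_nz sd).
rewrite val_factor_nat -mulr_natr natz; move: w0; rewrite /k; nia.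
Qed.

Lemma compl_exp s j : cx s -> s * ea = s -> compl s ^+ j.+1 = compl (s ^+ j.+1).
Proof.
move=> cs hs; have hj k : s ^+ k.+1 * ea = s ^+ k.+1 by rewrite exprSr -mulrA hs.
elim: j => [|j IH]; first by rewrite !expr1.
by rewrite exprS IH factor_compl -?exprS //; apply: cx_exp.
Qed.

(* Elements of norm at most 1 are integral: the norm is bounded below on the unit sphere. *)
Lemma factor_pb s : cx s -> s * ea = s -> s != 0 -> 0 <= v (\det (compl s)) -> pb s.
Proof.
move=> cs hs s0 ds; have [c hc] := factor_sphere.
exists (- `|c|) => -[|j].
  have h1 : mge 0 (1 : 'M[F]_n) by exact: mge1.
  by rewrite expr0; apply: mgeW h1; lia.
have hj : s ^+ j.+1 * ea = s ^+ j.+1 by rewrite exprSr -mulrA hs.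
have cj := cx_exp j.+1 cs.
have [dj vj] := val_detX HF j.+1 (factor_det cs hs s0).
rewrite compl_exp // in dj vj.
have sj : s ^+ j.+1 != 0.
  by apply: contraNneq dj => ->; rewrite add0r det_compl0.
have [m hm] := mge_nz v sj.
(* t lies on the unit sphere. For the norm N, w m + v(N t) = (j + 1) v(N s) >= 0, and v(N t) <= c
   with w >= 1 gives m >= - |c|, independently of j. *)
pose t := pw (- m) *: s ^+ j.+1.
have et : s ^+ j.+1 = (pw m *: ea) * t.
  by rewrite /t -scalerAl -scalerAr scalerA pwKV scale1r (sd_comm sd cea cj) hj.
have ct : cx t by apply: cx_scale.
have ht : t * ea = t by rewrite /t -scalerAl hj.
have /hc : mge 0 t by rewrite -(addNr m); apply/(mgeZ_pw HF)/hm.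
move=> /(_ ct ht) h; have {h} dt : v (\det (compl t)) <= c.
  apply: h => h1; have : m + 1 <= m; last lia.
  apply/hm; have := (mgeZ_pw HF (m + 1) (- m) (s ^+ j.+1)).1.
  by rewrite addKr; apply.
have t0 : t != 0 by apply: scal_neq0.
have [cm em] := factor_scal m.
move: vj; rewrite et val_factorM ?scal_neq0 ?(sd_nz sd) // val_factor_pw => vj.
rewrite -et; apply/hm; have w0 := val_factor_gt0.
have : 0 <= v (\det (compl s)) *+ j.+1 by rewrite mulrn_wge0.
rewrite -vj; move: w0 dt; move: w (v (\det (compl t))) (m : int) => W D M W0 dt h.
nia.
Qed.

(** Euclidean division by w brings the order of the norm of pw k s into [0, w). Then pw k s and the
    uniformizer divided by it both have integral norm, hence are power-bounded; this replaces a
    uniformizer of F[x] e_a. *)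
Lemma factor_scaling s : cx s -> s * ea = s -> s != 0 ->
  exists k t, [/\ pb (pw k *: s), cx t, pb t & t * (pw k *: s) = pw 1 *: ea].
Proof.
move=> cs hs s0; pose d := v (\det (compl s)).
have w0 := val_factor_gt0.
pose k := - (d %/ w)%Z.
have dk (j : int) : v (\det (compl (pw j *: s))) = w * j + d.
  have -> : pw j *: s = (pw j *: ea) * s by rewrite -scalerAl (sd_comm sd cea cs) hs.
  have [cj ej] := factor_scal j.
  by rewrite val_factorM ?scal_neq0 ?(sd_nz sd) // val_factor_pw.
have edk : w * k + d = (d %% w)%Z by rewrite /k {2}(divz_eq d w); ring.
have mod0 : 0 <= (d %% w)%Z by apply: modz_ge0; lia.
have modw : (d %% w)%Z < w by apply: ltz_pmod.
have cj j : cx (pw j *: s) by apply: cx_scale.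
have hj j : pw j *: s * ea = pw j *: s by rewrite -scalerAl hs.
have [t [ct ht st ts]] := factor_inv (cj (k - 1)) (hj (k - 1)) (scal_neq0 (k - 1) s0).
have t0 : t != 0.
  by apply: contraNneq (sd_nz sd a) => t0; rewrite -ts t0 mul0r.
exists k, t; split=> //.
- by apply: factor_pb; rewrite ?scal_neq0 // dk edk.
- apply: factor_pb => //.
  have := val_factorM (cj (k - 1)) ct (hj (k - 1)) ht (scal_neq0 _ s0) t0.
  rewrite st addrC subrK det1 (val1 HF) dk mulrBr mulr1.
  move: edk modw; set D := v _; lia.
have -> : pw k *: s = pw 1 *: (pw (k - 1) *: s).
  by rewrite scalerA -pwD; congr (pw _ *: _); lia.
by rewrite -scalerAr ts.
Qed.

End FieldFactors.

(** * Tame elements and dominating blocks *)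

Section Tame.
Variables (F : fieldType) (v : F -> int).
Hypothesis HF : nonarch_local_field v.
Variable n' : nat.
Local Notation n := n'.+1.
Local Notation mge := (mge v).
Local Notation pw := (pw HF).
Local Notation pb := (pb v).

Lemma ovGP (c : int) (g : 'M[F]_n) : ovG v g <= c <-> v (\det g) <= c /\ mge (- c) g.
Proof.
rewrite /ovG; split=> [h|[hd hg]].
  split; first by apply: le_trans h; apply: bigmax_ge_id.
  move=> i j; have [->|nz] := eqVneq (g i j) 0; first exact: vge0.
  apply: vge_val; rewrite lerNl; apply: le_trans h.
  by rewrite (bigD1 (i, j)) //= le_max lexx.
apply: bigmax_le => // -[i j] /= nz; have := hg i j.
by rewrite vgeP // lerNl.
Qed.

Variables (x : 'M[F]_n) (r : nat) (e : 'I_r -> 'M[F]_n) (v0 : 'cV[F]_n).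
Hypothesis sd : split_data x e v0.
Implicit Types (s t g : 'M[F]_n).
Local Notation cx s := (GRing.comm s x).
Local Notation compl a s := (s + (1 - e a)).

(* Conjugation by g distorts the integral elements of F[x] by at most H. *)
Definition tame (H : nat) g : Prop :=
  \det g != 0 /\ forall s, cx s -> pb s -> mge (- H%:Z) (g *m s *m invmx g).

Lemma tame1P H : tame H 1%:M <-> forall s, cx s -> pb s -> mge (- H%:Z) s.
Proof.
split=> [[_ h] s cs ps|h]; first by have := h s cs ps; rewrite mul1mx invmx1 mulmx1.
split=> [|s cs ps]; first by rewrite det1 oner_neq0.
by rewrite mul1mx invmx1 mulmx1; apply: h.
Qed.

Lemma col_mulmx (A B : 'M[F]_n) j : col j (A *m B) = A *m col j B.
Proof. by rewrite !colE mulmxA. Qed.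

(** Two nonzero vectors of a block differ by a multiplication in the field F[x] e_a, and tameness
    controls the conjugate of this multiplication by g. So one column of e_a on which g is large
    controls all of e_a g^-1. The loss 4H is 2H for comparing g w with g w' and 2H for bounding (pw
    l si) w. *)
Lemma tame_conformal H g a (k : int) : tame H 1%:M -> tame H g ->
  ~ mge (k + 1) (g *m e a) -> mge (- k - 1 - (4 * H)%N%:Z) (e a *m invmx g).
Proof.
move=> /tame1P h1 [dg hg] hk.
have ug : g \in unitmx by rewrite det_unit.
have cea := sd_idx sd a; have eaea := sd_idem sd a.
have [j hj] : exists j, ~ mge (k + 1) (g *m col j (e a)).
  apply/not_existsP => h; apply: hk => i j; have /contrapT/(_ i 0) := h j.
  by rewrite -col_mulmx mxE.
pose w := col j (e a).
have hw : mge (- H%:Z) w.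
  by move=> i l; rewrite mxE; apply: (h1 (e a) cea (pb_idem HF eaea)).
have w0 : w != 0 by apply: contra_notN hj => /eqP h; rewrite -/w h mulmx0; apply: mge0.
have ew : e a *m w = w by rewrite /w -col_mulmx mulmxE eaea.
move=> i0 i; pose w' := col i (e a *m invmx g).
suff : mge (- k - 1 - (4 * H)%N%:Z) w' by move=> /(_ i0 0); rewrite mxE.
have [->|w'0] := eqVneq w' 0; first exact: mge0.
have ew' : e a *m w' = w' by rewrite /w' -col_mulmx mulmxA mulmxE eaea.
have [s cs es] := sd_cyc sd w; have [s' cs' es'] := sd_cyc sd w'.
have sea : s * e a != 0.
  apply: contraNneq w0 => h; rewrite -ew es mulmxA mulmxE.
  by rewrite -(sd_comm sd cs cea) h mul0mx.
have [t ct tse] := sd_field sd cs sea.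
pose si := s' * t * e a.
have csi : cx si by do 2!apply: cx_mul => //.
have hsi : si * e a = si by rewrite /si -mulrA eaea.
have siw : si *m w = w'.
  rewrite es mulmxA mulmxE /si -[_ * _ * s]mulrA -[_ * _ * (_ * _)]mulrA.
  rewrite -(sd_comm sd cs cea) [t * _]mulrA tse.
  by rewrite (sd_comm sd cs' cea) -mulmxE -mulmxA -es'.
have si0 : si != 0 by apply: contraNneq w'0 => h; rewrite -siw h mul0mx.
have [l [u [pl cu pu eu]]] := factor_scaling HF sd csi hsi si0.
have hgw' : mge (- H%:Z) (g *m w').
  by move=> p q; rewrite -col_mulmx mxE mulmxA; apply: (hg (e a) cea (pb_idem HF eaea)).
have usi : u * si = pw (1 - l) *: e a.
  have -> : u * si = pw (- l) *: (u * (pw l *: si)).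
    by rewrite -scalerAr scalerA pwVK scale1r.
  by rewrite eu scalerA -pwD addrC.
have uw' : u *m w' = pw (1 - l) *: w.
  by rewrite -siw mulmxA mulmxE usi -scalemxAl ew.
have hgw : mge (l - 1 + (- H%:Z + - H%:Z)) (g *m w).
  have -> : g *m w = pw (l - 1) *: ((g *m u *m invmx g) *m (g *m w')).
    rewrite -!mulmxA (mulmxA (invmx g)) mulVmx // mul1mx uw' -scalemxAr scalerA -pwD.
    by rewrite -opprB addNr pw0 scale1r.
  by apply/(mgeZ_pw HF); apply: (mgeM HF) => //; apply: hg.
have lk : l - 1 - (2 * H)%N%:Z <= k.
  by rewrite leNgt; apply/negP => lt; apply: hj; apply: mgeW hgw; lia.
have -> : w' = pw (- l) *: (pw l *: si *m w).
  by rewrite -scalemxAl scalerA pwVK scale1r siw.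
have hs0 : mge (- H%:Z + - H%:Z) (pw l *: si *m w).
  by apply: (mgeM HF) => //; apply: h1 => //; apply: cx_scale.
have : mge (- l + (- H%:Z + - H%:Z)) (pw (- l) *: (pw l *: si *m w)) by apply/(mgeZ_pw HF).
by apply: mgeW; lia.
Qed.

Let eidem a := sd_idem sd a.
Let ecx a := sd_idx sd a.

Lemma cx_inv t : \det t != 0 -> cx t -> cx (invmx t).
Proof.
move=> dt ct; have u : t \in unitmx by rewrite det_unit.
by apply/commr_sym; apply: (commrV (y := t)); apply/commr_sym.
Qed.

Lemma factor_part t a : cx t -> cx (t * e a) /\ t * e a * e a = t * e a.
Proof. by move=> ct; split; [exact: cx_mul|rewrite -mulrA eidem]. Qed.

Lemma factor_part_exp t a k : cx t -> (t * e a) ^+ k.+1 = t ^+ k.+1 * e a.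
Proof.
move=> ct; elim: k => [|k IH] //; rewrite exprS IH [t ^+ k.+2]exprS.
by rewrite -mulrA (mulrA (e a)) -(sd_comm sd (cx_exp k.+1 ct) (ecx a)) -!mulrA eidem.
Qed.

(** t is the product over a of the matrices acting as t on one block and as the identity on the
    others. *)
Lemma det_parts t : cx t -> \det t != 0 ->
  (forall a, \det (compl a (t * e a)) != 0) /\
  v (\det t) = \sum_a v (\det (compl a (t * e a))).
Proof.
move=> ct dt; have u : t \in unitmx by rewrite det_unit.
have nz a : \det (compl a (t * e a)) != 0.
  have [h1 h2] := factor_part a ct; apply: (factor_det sd h1 h2).
  apply: contraNneq (sd_nz sd a) => h.
  by rewrite -[e a]mul1r -[1](mulVr u) -mulrA h mulr0.
split=> //.
have main : forall s : seq 'I_r, uniq s ->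
   \prod_(a <- s) compl a (t * e a) = t * \sum_(a <- s) e a + (1 - \sum_(a <- s) e a).
  elim=> [|a s IH] /=; first by rewrite !big_nil mulr0 add0r subr0.
  case/andP => as_ us; rewrite !big_cons IH //; set E := \sum_(_ <- _) _.
  have aE : e a * E = 0.
    rewrite /E mulr_sumr big_seq big1 // => b bs; apply: (sd_orth sd).
    by apply: contraNneq as_ => ->.
  have cE : cx E.
    rewrite /E; apply: (big_ind (fun s => cx s)) => [|s1 s2|b _].
    - by rewrite /GRing.comm mul0r mulr0.
    - exact: cx_add.
    - exact: ecx.
  have tE : t * e a * (t * E) = 0.
    by rewrite mulrA -(mulrA t) -(sd_comm sd ct (ecx a)) -!mulrA aE !mulr0.
  have tE2 : t * e a * (1 - E) = t * e a by rewrite mulrBr mulr1 -mulrA aE mulr0 subr0.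
  have tE3 : (1 - e a) * (t * E) = t * E.
    rewrite mulrBl mul1r (mulrA (e a)) -(sd_comm sd ct (ecx a)) -mulrA aE mulr0.
    by rewrite subr0.
  have tE4 : (1 - e a) * (1 - E) = 1 - (e a + E).
    by rewrite mulrBl mul1r mulrBr mulr1 aE subr0 opprD addrA addrAC.
  rewrite mulrDl (mulrDr (t * e a)) (mulrDr (1 - e a)) tE tE2 tE3 tE4 add0r.
  by rewrite mulrDr addrA.
have et : t = \prod_(a <- index_enum 'I_r) compl a (t * e a).
  by rewrite main ?index_enum_uniq // (sd_sum sd) mulr1 subrr addr0.
have mval : forall s : seq 'I_r, \det (\prod_(a <- s) compl a (t * e a)) != 0 /\
   v (\det (\prod_(a <- s) compl a (t * e a))) = \sum_(a <- s) v (\det (compl a (t * e a))).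
  elim=> [|a s [IH1 IH2]]; first by rewrite !big_nil det1 oner_neq0 (val1 HF).
  by rewrite !big_cons det_mulmx mulf_neq0 // (valM HF) ?IH2.
by rewrite [in LHS]et; have [_ ->] := mval (index_enum 'I_r).
Qed.

Lemma factor_part_nz t a : \det t != 0 -> t * e a != 0.
Proof.
rewrite -det_unit => u; apply: contraNneq (sd_nz sd a) => h.
by rewrite -[e a]mul1r -[1](mulVr u) -mulrA h mulr0.
Qed.

(** All powers of the completed block have determinants bounded below by one constant, which forbids
    a negative valuation. *)
Lemma pb_parts_ge0 t a : cx t -> \det t != 0 -> pb t ->
  0 <= v (\det (compl a (t * e a))).
Proof.
move=> ct dt [c hc]; have [h1 h2] := factor_part a ct.
have nz := factor_det sd h1 h2 (factor_part_nz a dt).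
have [d1 hd1] := mge_ex v (e a); have [d2 hd2] := mge_ex v (1 - e a).
pose L := Num.min (c + d1) d2.
have hL j : L *+ n <= v (\det (compl a (t * e a))) *+ j.+1.
  have [d3 <-] := val_detX HF j.+1 nz; rewrite -vgeP //; apply: (vge_det HF).
  rewrite (compl_exp sd) // factor_part_exp //; apply: (mgeD HF).
    by apply: mgeW (mgeM HF (hc j.+1) hd1); rewrite ge_min lexx.
  by apply: mgeW hd2; rewrite ge_min lexx orbT.
rewrite leNgt; apply/negP => lt; have := hL `|L *+ n|%N.
move: lt; move: (v _) (L *+ n) => D M lt; rewrite -mulr_natr natz; nia.
Qed.

Lemma parts_pb t : cx t -> \det t != 0 ->
  (forall a, 0 <= v (\det (compl a (t * e a)))) -> pb t.
Proof.
move=> ct dt h.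
have /choice[c hc] a : exists c : int, forall k : nat, mge c ((t * e a) ^+ k).
  have [h1 h2] := factor_part a ct.
  exact: (factor_pb HF sd h1 h2 (factor_part_nz a dt) (h a)).
pose L := \big[Num.min/0]_a c a.
exists L => -[|j].
  have h1 : mge 0 (1 : 'M[F]_n) by exact: mge1.
  by rewrite expr0; apply: mgeW h1; apply: bigmin_le_id.
rewrite -[t ^+ j.+1]mulr1 -(sd_sum sd) mulr_sumr; apply: (mge_sum HF) => a _.
rewrite -factor_part_exp //; apply: mgeW (hc a j.+1).
by rewrite /L (bigD1 a) //= ge_min lexx.
Qed.

Lemma val_part_inv t a : cx t -> \det t != 0 ->
  v (\det (compl a (invmx t * e a))) = - v (\det (compl a (t * e a))).
Proof.
move=> ct dt; have ci := cx_inv dt ct; have di := det_invmx_neq0 dt.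
have [h1 h2] := factor_part a ct; have [h3 h4] := factor_part a ci.
have := val_factorM HF sd h1 h3 h2 h4 (factor_part_nz a dt) (factor_part_nz a di).
rewrite -mulrA (mulrA (e a)) -(sd_comm sd ci (ecx a)) -mulrA eidem mulrA.
have -> : t * invmx t = 1 by apply: mulmxV; rewrite det_unit.
rewrite mul1r addrC subrK det1 (val1 HF).
by move=> /esym/eqP; rewrite addrC addr_eq0 => /eqP.
Qed.

(** [pb_parts_ge0] and [parts_pb], applied to t and its inverse. So the torus modulo its maximal
    compact subgroup embeds into Z^r. *)
Lemma maxcptP t : maxcpt v x t <->
  centralizer x t /\ forall a, v (\det (compl a (t * e a))) = 0.
Proof.
split=> [[ctx [c hc]]|[ctx h]]; have [dt ct] := ctx; split=> //.
  move=> a; have p1 : pb t by exists (- c) => k; have [/ovGP[]] := hc k.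
  have p2 : pb (invmx t) by exists (- c) => k; have [_ /ovGP[]] := hc k.
  have := pb_parts_ge0 a ct dt p1.
  have := pb_parts_ge0 a (cx_inv dt ct) (det_invmx_neq0 dt) p2.
  rewrite val_part_inv //; move: (v _) => D h1 h2; lia.
have [|c1 h1] := parts_pb ct dt; first by move=> a; rewrite h.
have [|c2 h2] := parts_pb (cx_inv dt ct) (det_invmx_neq0 dt).
  by move=> a; rewrite val_part_inv // h.
have [_ vt] := det_parts ct dt.
have vt0 : v (\det t) = 0 by rewrite vt big1.
exists (`|c1| + `|c2|) => k; split; apply/ovGP; split.
- by have [_ ->] := val_detX HF k dt; rewrite vt0 mul0rn.
- by apply: mgeW (h1 k); lia.
- by have [_ ->] := val_detX HF k (det_invmx_neq0 dt); rewrite (val_detV HF) // vt0 oppr0 mul0rn.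
- by apply: mgeW (h2 k); lia.
Qed.

End Tame.

(** * Unipotent groups attached to idempotents, and dominating sets of blocks *)

Section Dominance.
Variables (F : fieldType) (v : F -> int).
Hypothesis HF : nonarch_local_field v.
Variable n' : nat.
Local Notation n := n'.+1.
Local Notation mge := (mge v).

(** N lies in E M_n(F) (1 - E), the Lie algebra of U_J when E = e_J. Products of two such N vanish,
    so N -> 1 + N turns addition into multiplication. *)
Definition nilp (E N : 'M[F]_n) : Prop := E * N * (1 - E) = N.

Section Nilp.
Variable E : 'M[F]_n.
Hypothesis EE : E * E = E.
Implicit Types (N M g : 'M[F]_n).

Lemma nilp_l N : nilp E N -> E * N = N.
Proof. by move=> <-; rewrite !mulrA EE. Qed.

Lemma nilp_r N : nilp E N -> N * E = 0.
Proof. by move=> <-; rewrite -mulrA mulrBl mul1r EE subrr mulr0. Qed.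

Lemma nilpP N : E * N = N -> N * E = 0 -> nilp E N.
Proof. by move=> h1 h2; rewrite /nilp h1 mulrBr mulr1 h2 subr0. Qed.

Lemma nilp_mul N M : nilp E N -> nilp E M -> N * M = 0.
Proof. by move=> hN hM; rewrite -(nilp_l hM) mulrA (nilp_r hN) mul0r. Qed.

Lemma nilp0 : nilp E 0. Proof. by rewrite /nilp mulr0 mul0r. Qed.

Lemma nilpD N M : nilp E N -> nilp E M -> nilp E (N + M).
Proof. by rewrite /nilp => hN hM; rewrite (mulrDr E) mulrDl hN hM. Qed.

Lemma nilpN N : nilp E N -> nilp E (- N).
Proof. by rewrite /nilp mulrN mulNr => ->. Qed.

Lemma unipM N M : nilp E N -> nilp E M -> (1 + N) * (1 + M) = 1 + (N + M).
Proof.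
move=> hN hM; rewrite mulrDl mul1r mulrDr mulr1 (nilp_mul hN hM) addr0.
by rewrite -addrA [M + N]addrC.
Qed.

Lemma unip_det N : nilp E N -> \det (1 + N) != 0.
Proof.
move=> hN; have := congr1 determinant (unipM hN (nilpN hN)).
rewrite subrr addr0 -mulmxE det_mulmx det1 => h.
by apply: contraTneq isT => h0; move: h; rewrite h0 mul0r => /eqP; rewrite eq_sym oner_eq0.
Qed.

Lemma unip_exp N k : nilp E N -> (1 + N) ^+ k = 1 + N *+ k.
Proof.
move=> hN; have hk j : nilp E (N *+ j).
  by elim: j => [|j IH]; rewrite ?mulr0n ?mulrS; [exact: nilp0|exact: nilpD].
elim: k => [|k IH]; first by rewrite expr0 mulr0n addr0.
by rewrite exprS IH unipM // mulrS.
Qed.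

(** The powers (1 + N)^k = 1 + k N stay bounded, so the determinant cannot have negative valuation;
    the same holds for - N, and the two determinants multiply to 1. *)
Lemma unip_val_det N : nilp E N -> v (\det (1 + N)) = 0.
Proof.
have ge0 M : nilp E M -> 0 <= v (\det (1 + M)).
  move=> hM; have [c hc] := mge_ex v M.
  have hk k : Num.min c 0 *+ n <= v (\det (1 + M)) *+ k.
    have [d3 <-] := val_detX HF k (unip_det hM); rewrite -vgeP //; apply: (vge_det HF).
    rewrite unip_exp //; apply: (mgeD HF).
      have h1 : mge 0 (1 : 'M[F]_n) by exact: mge1.
      by apply: mgeW h1; rewrite ge_min lexx orbT.
    elim: k {d3} => [|k IH]; first by rewrite mulr0n; apply: mge0.
    by rewrite mulrS; apply: (mgeD HF) => //; apply: mgeW hc; rewrite ge_min lexx.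
  rewrite leNgt; apply/negP => lt; have := hk `|Num.min c 0 *+ n|.+1%N.
  move: lt; move: (v _) (_ *+ n) => D L lt; rewrite -mulr_natr natz; nia.
move=> hN; have := ge0 _ hN; have := ge0 _ (nilpN hN).
have : v (\det (1 + N)) + v (\det (1 - N)) = 0.
  rewrite -val_detM //; last by apply: unip_det; apply: nilpN.
    by rewrite mulmxE unipM //; [rewrite subrr addr0 det1 (val1 HF)|exact: nilpN].
  exact: unip_det.
move: (v _) (v _) => a b; lia.
Qed.

Lemma unip_inv N : nilp E N -> invmx (1 + N) = 1 - N.
Proof.
move=> hN; have u : 1 + N \in unitmx by rewrite det_unit unip_det.
apply: (can_inj (mulKmx u)); rewrite mulmxV // mulmxE unipM //; last exact: nilpN.
by rewrite subrr addr0.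
Qed.

Lemma inv_mul_unip g N : \det g != 0 -> nilp E N ->
  invmx (g * (1 + N)) = (1 - N) * invmx g.
Proof.
move=> dg hN; have u : g \in unitmx by rewrite det_unit.
have w : 1 + N \in unitmx by rewrite det_unit unip_det.
by rewrite -unip_inv // -[invmx (g * _)]/((g * (1 + N))^-1) invrM.
Qed.

(** For u = 1 + N one has u E u^-1 = E - N. Hence tameness of g and of g u bounds g N g^-1. *)
Lemma nilp_conj g N : \det g != 0 -> nilp E N ->
  g * N * invmx g = g * E * invmx g - (g * (1 + N)) * E * invmx (g * (1 + N)).
Proof.
move=> dg hN; rewrite inv_mul_unip // -!mulrA -mulrBr; congr (_ * _).
rewrite !mulrA -mulrBl; congr (_ * _).
rewrite mulrDl mul1r (nilp_r hN) addr0 mulrBr mulr1 (nilp_l hN).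
by rewrite opprB addrC subrK.
Qed.

End Nilp.

Variables (x : 'M[F]_n) (r : nat) (e : 'I_r -> 'M[F]_n) (v0 : 'cV[F]_n).
Hypothesis sd : split_data x e v0.
Variable H : nat.
Local Notation tame := (tame v x H).
Hypothesis tame1 : tame 1%:M.
Local Notation cx s := (GRing.comm s x).
Implicit Types (N M g : 'M[F]_n) (J : {set 'I_r}) (a b : 'I_r).

Definition eJ J : 'M[F]_n := \sum_(a in J) e a.

Lemma eJ_in J a : a \in J -> eJ J * e a = e a /\ e a * eJ J = e a.
Proof.
move=> aJ; rewrite /eJ mulr_suml mulr_sumr !(bigD1 a aJ) /= (sd_idem sd) !big1 ?addr0 //.
  by move=> b /andP[_ ba]; rewrite (sd_orth sd) // eq_sym.
by move=> b /andP[_ ba]; rewrite (sd_orth sd).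
Qed.

Lemma eJ_notin J b : b \notin J -> eJ J * e b = 0 /\ e b * eJ J = 0.
Proof.
move=> bJ; rewrite /eJ mulr_suml mulr_sumr !big1 //.
  by move=> a aJ; apply: (sd_orth sd); apply: contraNneq bJ => ->.
by move=> a aJ; apply: (sd_orth sd); apply: contraNneq bJ => <-.
Qed.

Lemma eJ_idem J : eJ J * eJ J = eJ J.
Proof.
by rewrite {2 3}/eJ mulr_sumr; apply: eq_bigr => a aJ; case: (eJ_in aJ).
Qed.

Lemma eJ_comm J : cx (eJ J).
Proof.
rewrite /eJ; apply: (big_ind (fun s => cx s)) => [|s1 s2|a _].
- by rewrite /GRing.comm mul0r mulr0.
- exact: cx_add.
- exact: (sd_idx sd).
Qed.

Lemma eJC J : 1 - eJ J = \sum_(b in ~: J) e b.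
Proof.
rewrite -(sd_sum sd) (bigID (mem J)) /= addrAC subrr add0r.
by apply: eq_bigl => b; rewrite inE.
Qed.

Lemma sub_eJ J J' : J \subset J' -> eJ J' * eJ J = eJ J.
Proof.
move=> sJ; rewrite {2 3}/eJ mulr_sumr; apply: eq_bigr => a aJ.
by case: (@eJ_in J' a) => //; apply: (fintype.subsetP sJ).
Qed.

Lemma eJ_tame J g : tame g -> mge (- H%:Z) (g * eJ J * invmx g).
Proof. by case=> _ h; apply: h; [exact: eJ_comm|apply: (pb_idem HF); exact: eJ_idem]. Qed.

Lemma eJC_tame J g : tame g -> mge (- H%:Z) (g * (1 - eJ J) * invmx g).
Proof.
case=> _ h; apply: h; first by apply: cx_add; [exact: cx1|exact/cx_opp/eJ_comm].
apply: (pb_idem HF); rewrite mulrBr mulr1 mulrBl mul1r eJ_idem subrr subr0 //.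
Qed.

Lemma e_tame a : mge (- H%:Z) (e a).
Proof.
have [_ h] := tame1; have := h (e a) (sd_idx sd a) (pb_idem HF (sd_idem sd a)).
by rewrite mul1mx invmx1 mulmx1.
Qed.

Lemma mul_e_neq0 g a : tame g -> g * e a != 0.
Proof.
case; rewrite -det_unit => u _; apply: contraNneq (sd_nz sd a) => h.
by rewrite -[e a]mul1r -[1](mulVr u) -mulrA h mulr0.
Qed.

Lemma unip_fix J N a : nilp (eJ J) N -> a \in J -> (1 + N) * e a = e a.
Proof.
move=> hN aJ; have [h _] := eJ_in aJ.
by rewrite mulrDl mul1r -{2}h mulrA (nilp_r (eJ_idem J) hN) mul0r addr0.
Qed.

(** 1 - e_J annihilates N from the left, so multiplication by g (1 - e_J) g^-1 removes the unipotent
    factor at a cost of H. *)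
Lemma unip_quot J N b k g : tame g -> nilp (eJ J) N -> b \notin J ->
  mge k (g * (1 + N) * e b) -> mge (k - H%:Z) (g * e b).
Proof.
move=> tg hN bJ h; have u : g \in unitmx by rewrite det_unit; case: tg.
have -> : g * e b = g * (1 - eJ J) * invmx g * (g * (1 + N) * e b).
  rewrite -[RHS]mulrA; have -> : invmx g * (g * (1 + N) * e b) = (1 + N) * e b.
    by rewrite !mulrA (mulVr u) mul1r.
  rewrite -mulrA; congr (_ * _); rewrite mulrA mulrDr mulr1.
  have -> : (1 - eJ J) * N = 0 by rewrite mulrBl mul1r (nilp_l (eJ_idem J) hN) subrr.
  by rewrite addr0 mulrBl mul1r (eJ_notin bJ).1 subr0.
by rewrite addrC; apply: (mgeM HF) => //; apply: eJC_tame.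
Qed.

Lemma unip_conj_bound J N g : tame g -> tame (g * (1 + N)) -> nilp (eJ J) N ->
  mge (- H%:Z) (g * N * invmx g).
Proof.
move=> tg tgu hN; rewrite (nilp_conj (eJ_idem J)) //; last by case: tg.
by apply: (mgeB HF); apply: eJ_tame.
Qed.

(** 3H pays for the three distortions in [mingood_mge]; the additional 1 keeps the contradiction in
    [good_chain] strict when H = 0. *)
Let th : int := (3 * H + 1)%N%:Z.

(* [good J g]: g is larger on the factors in J than on the remaining ones, where the
   latter are taken modulo the unipotent group attached to J. *)
Definition good J g : Prop := forall a b, a \in J -> b \notin J ->
  exists2 N, nilp (eJ J) N &
    forall k, mge k (g * e a) -> mge (k + th) (g * (1 + N) * e b).

(** By [good_chain] the good sets of a tame g are nested, so a minimal one is canonical. *)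
Definition mingood J g : Prop :=
  [/\ J != finset.set0, J != [set: 'I_r]%SET, good J g &
    forall J', J' \proper J -> J' != finset.set0 -> ~ good J' g].

Lemma good_gap J g a b : tame g -> good J g -> a \in J -> b \notin J ->
  forall k, mge k (g * e a) -> mge (k + th - H%:Z) (g * e b).
Proof.
move=> tg gJ aJ bJ k hk; have [N hN h] := gJ a b aJ bJ.
exact: (unip_quot tg hN bJ (h k hk)).
Qed.

(** Otherwise some a in J outside J' and some b in J' outside J would each dominate the other by th
    - H > 0. *)
Lemma good_chain J J' g : tame g -> good J g -> good J' g -> J \subset J' \/ J' \subset J.
Proof.
move=> tg gJ gJ'; have [h|/fintype.subsetPn[a aJ aJ']] := boolP (J \subset J'); first by left.
have [h|/fintype.subsetPn[b bJ' bJ]] := boolP (J' \subset J); first by right.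
have [k hk] := mge_nz v (mul_e_neq0 a tg).
have h1 := good_gap tg gJ aJ bJ ((hk k).2 (lexx k)).
have /hk := good_gap tg gJ' bJ' aJ' h1; rewrite /th; lia.
Qed.

Lemma mingood_uniq J J' g : tame g -> mingood J g -> mingood J' g -> J = J'.
Proof.
move=> tg [J0 _ gJ mJ] [J'0 _ gJ' mJ']; apply/eqP/negPn/negP => ne.
have [s|s] := good_chain tg gJ gJ'.
  by apply: (mJ' J) => //; rewrite finset.properEneq ne.
by apply: (mJ J') => //; rewrite finset.properEneq eq_sym ne.
Qed.

(** The comparison is modulo U_J, so N is absorbed into the witness; blocks in J are unchanged
    because N e_a = 0 there. *)
Lemma good_unip J N g : nilp (eJ J) N -> good J g -> good J (g * (1 + N)).
Proof.
move=> hN gJ a b aJ bJ; have [M hM h] := gJ a b aJ bJ.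
exists (M - N); first by apply: nilpD => //; apply: nilpN.
move=> k; rewrite -mulrA (unip_fix hN aJ) => /h.
have hMN : nilp (eJ J) (M - N) by apply: nilpD => //; apply: nilpN.
by rewrite -[g * _ * (1 + (M - N))]mulrA (unipM (eJ_idem J) hN hMN) (addrC N) subrK.
Qed.

(** For b in J nothing changes, since N annihilates e_b and the witness M. For b outside J the
    comparison passes through a block c of J outside J': two gaps less 2H are still at least th. *)
Lemma good_sub_unip J J' N g : tame g -> nilp (eJ J) N -> good J g ->
  J' \proper J -> J' != finset.set0 -> good J' (g * (1 + N)) -> good J' g.
Proof.
move=> tg hN gJ /fintype.properP[sJ [c cJ cJ']] J'0 gJ' a b aJ' bJ'.
have aJ := fintype.subsetP sJ _ aJ'.
have red d : d \in J -> d \notin J' -> exists2 M, nilp (eJ J') M &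
    forall k, mge k (g * e a) -> mge (k + th) (g * (1 + M) * e d).
  move=> dJ dJ'; have [M hM h] := gJ' a d aJ' dJ'; exists M => // k hk.
  have -> : g * (1 + M) * e d = g * (1 + N) * (1 + M) * e d.
    rewrite -!mulrA; congr (_ * _).
    have eM : M = eJ J * M.
      by rewrite -(nilp_l (eJ_idem J') hM) mulrA sub_eJ.
    have NJ := nilp_r (eJ_idem J) hN.
    have NM : N * M = 0 by rewrite eM mulrA NJ mul0r.
    have Nd : N * e d = 0 by rewrite -(eJ_in dJ).1 mulrA NJ mul0r.
    rewrite (mulrDl 1 N) mul1r (mulrDl 1 M) mul1r (mulrDr N) Nd.
    by rewrite (mulrA N) NM mul0r !addr0.
  by apply: h; rewrite -mulrA (unip_fix hN aJ).
have [bJ|bJ] := boolP (b \in J); first exact: red.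
exists 0; first exact: nilp0.
move=> k hk; rewrite addr0 mulr1.
have [M hM h] := red c cJ cJ'.
have h1 := unip_quot tg hM cJ' (h k hk).
have h2 := good_gap tg gJ cJ bJ h1.
by apply: mgeW h2; rewrite /th; lia.
Qed.

Lemma mingood_unip J N g : tame g -> nilp (eJ J) N ->
  mingood J g -> mingood J (g * (1 + N)).
Proof.
move=> tg hN [J0 JT gJ mJ]; split=> //; first exact: good_unip.
by move=> J' pJ J'0 gJ'; apply: (mJ J' pJ J'0); apply: (good_sub_unip tg hN gJ).
Qed.

(** In g u = g + g N the last term is the sum of (g N g^-1) (g e_b) over b outside J. The first
    factor costs H, and g e_b lies th - H above a block of J, which is at most H below k. *)
Lemma mingood_mge J N g k : tame g -> tame (g * (1 + N)) -> nilp (eJ J) N ->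
  mingood J g -> mge k g -> mge k (g * (1 + N)).
Proof.
move=> tg tgu hN [J0 _ gJ _] hk; rewrite mulrDr mulr1; apply: (mgeD HF) => //.
have u : g \in unitmx by rewrite det_unit; case: tg.
have -> : g * N = \sum_(b in ~: J) g * N * invmx g * (g * e b).
  rewrite -mulr_sumr -mulr_sumr -eJC.
  rewrite -!mulrA (mulrA (invmx g)) (mulVr u) mul1r mulrBr mulr1.
  by rewrite (nilp_r (eJ_idem J) hN) subr0.
apply: (mge_sum HF) => b; rewrite inE => bJ.
have [a aJ] := finset.set0Pn J J0.
have h1 : mge (k - H%:Z) (g * e a) by apply: (mgeM HF hk (e_tame a)).
have h2 := good_gap tg gJ aJ bJ h1.
by apply: mgeW (mgeM HF (unip_conj_bound tg tgu hN) h2); rewrite /th; lia.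
Qed.

End Dominance.

Section Existence.
Variables (F : fieldType) (v : F -> int).
Hypothesis HF : nonarch_local_field v.
Variable n' : nat.
Local Notation n := n'.+1.
Local Notation mge := (mge v).
Variables (x : 'M[F]_n) (r : nat) (e : 'I_r -> 'M[F]_n) (v0 : 'cV[F]_n).
Hypothesis sd : split_data x e v0.
Variable H : nat.
Local Notation tame := (tame v x H).
Hypothesis tame1 : tame 1%:M.
Local Notation good := (good v e H).
Local Notation mingood := (mingood v e H).

Lemma good_mingood g J : J != finset.set0 -> J != [set: 'I_r]%SET -> good J g ->
  exists J, mingood J g.
Proof.
have [m] := ubnP #|J|; elim: m J => // m IH J sm J0 JT gJ.
have [[J' [p J'0 gJ']]|h] := pselect (exists J' : {set 'I_r}, [/\ J' \proper J, J' != finset.set0 & good J' g]).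
  apply: (IH J') => //; first exact: leq_trans (proper_card p) sm.
  by apply: contraTneq p => ->; apply/negP => /fintype.properP[_ [y _]]; rewrite inE.
by exists J; split=> // J' p J'0 gJ'; apply: h; exists J'.
Qed.

(** Without a good set the valuations of the blocks show no gap of length th, so they lie within th
    n of the smallest. Then [tame_conformal] bounds g^-1 through the smallest one, and a determinant
    of nonnegative valuation forces it to be at least - (th n + 4H + 1). *)
Lemma mingood_ex g : tame g -> 0 <= v (\det g) ->
  ~ mge (- (n * (3 * H + 1) + 4 * H + 1)%N%:Z) g -> exists J, mingood J g.
Proof.
move=> tg dg0 hM; apply/not_existsP => nomin.
have [dg _] := tg; have u : g \in unitmx by rewrite det_unit.
have nogood J : J != finset.set0 -> J != [set: 'I_r]%SET -> ~ good J g.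
  by move=> J0 JT /(good_mingood J0 JT)[J' /nomin].
have /choice[ka hka] a : exists k, forall l, mge l (g * e a) <-> l <= k.
  exact: mge_nz (mul_e_neq0 sd a tg).
have r0 : (0 < r)%N.
  rewrite lt0n; apply/eqP => r0; have := sd_sum sd; rewrite big1; last first.
    by move=> a _; have := ltn_ord a; rewrite {2}r0.
  by move/eqP; rewrite eq_sym oner_eq0.
pose a0 := [arg min_(a < Ordinal r0) ka a]%O.
have min0 a : ka a0 <= ka a.
  by rewrite /a0; case: arg_minP => // i _ h; apply: h.
pose th : int := (3 * H + 1)%N%:Z.
(* The blocks within j gaps of the smallest valuation. Each step adds a block until all are reached,
   so r <= n steps suffice. *)
pose S (j : nat) := [set a : 'I_r | ka a <= ka a0 + th * j%:Z]%SET.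
have hS j : S j = [set: 'I_r]%SET \/ (j < #|S j|)%N.
  elim: j => [|j [IH|IH]].
  - right; apply/card_gt0P; exists a0; rewrite inE mulr0 addr0 //.
  - left; apply/eqP; rewrite -finset.subTset -IH; apply/fintype.subsetP => a; rewrite !inE /th.
    by lia.
  have [|ne] := eqVneq (S j) [set: 'I_r]%SET.
    move=> E; left; apply/eqP; rewrite -finset.subTset -E; apply/fintype.subsetP => a; rewrite !inE /th.
    by lia.
  right; have S0 : S j != finset.set0.
    by rewrite -finset.card_gt0; apply: leq_ltn_trans IH.
  have [a [b [aS bS ba]]] : exists a b, [/\ a \in S j, b \notin S j & ka b < ka a + th].
    apply/not_existsP => h; apply: (nogood (S j) S0 ne) => a b aS bS.
    exists 0; first exact: nilp0.
    move=> k /hka hk; rewrite addr0 mulr1; apply/hka; rewrite leNgt; apply/negP => lt.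
    by apply: (h a); exists b; split=> //; rewrite /th; lia.
  apply: leq_ltn_trans IH (proper_card _); apply/fintype.properP; split.
    by apply/fintype.subsetP => c; rewrite !inE /th; lia.
  exists b => //; move: aS; rewrite !inE /th in ba *; lia.
have top a : ka a <= ka a0 + th * r%:Z.
  have [E|] := hS r.
    have : a \in S r by rewrite E inE.
    by rewrite inE.
  by move=> /leq_trans/(_ (max_card _)); rewrite card_ord ltnn.
have rn := sd_card sd.
have gs : mge (ka a0) g.
  rewrite -[g]mulr1 -(sd_sum sd) mulr_sumr; apply: (mge_sum HF) => a _.
  exact/hka.
pose L := - (ka a0 + th * n%:Z) - 1 - (4 * H)%N%:Z.
have gi : mge L (invmx g).
  have -> : invmx g = \sum_a e a *m invmx g by rewrite -mulmx_suml (sd_sum sd) mul1mx.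
  apply: (mge_sum HF) => a _.
  have h : ~ mge (ka a + 1) (g *m e a) by move/hka; lia.
  apply: mgeW (tame_conformal HF sd tame1 tg h); have := top a.
  by rewrite /L /th; nia.
have := vge_det HF gi; rewrite vgeP ?det_invmx_neq0 // (val_detV HF) // => hd.
apply: hM; apply: mgeW gs.
have : L <= 0.
  by move: hd dg0; rewrite -mulr_natr natz; move: (v _) (L) => D M; nia.
by rewrite /L /th; nia.
Qed.

End Existence.

(** * Measurability on GL_n(F) *)

Section MeasurableMatrices.
Variables (F : fieldType) (v : F -> int).
Hypothesis HF : nonarch_local_field v.
Variable n : nat.
Local Notation mge := (mge v).
Local Notation M := (MXm v n).
Local Notation mball := (mball v).

Lemma dense_seq : exists D : nat -> 'M[F]_n, forall A (k : nat), exists j, mge k%:Z (A - D j).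
Proof.
have /choice[S hS] : forall Nl : nat * nat, exists S : seq 'M[F]_n,
    forall A, mge (- Nl.1%:Z) A -> exists2 B, B \in S & mge (- Nl.1%:Z + Nl.2%:Z) (A - B).
  by move=> Nl; apply: cover_mx.
exists (fun j => if @unpickle (nat * nat * nat)%type j is Some (Nl, i) then nth 0 (S Nl) i else 0).
move=> A k; have [N hN] := mge_exN v A.
have [B BS hB] := hS (N, (N + k)%N) A hN.
exists (pickle (N, (N + k)%N, index B (S (N, (N + k)%N)))).
by rewrite pickleK nth_index //; apply: mgeW hB => /=; lia.
Qed.

Lemma ball_center (a b : 'M[F]_n) k : mge k (a - b) -> mball a k = mball b k.
Proof.
move=> h; apply/seteqP; split=> y /mballE hy; apply/mballE.
  by rewrite -[y : 'M[F]_n](subrK a) -addrA; apply: (mgeD HF).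
by rewrite -[y : 'M[F]_n](subrK b) -addrA; apply: (mgeD HF) => //; apply: (mgeBC HF).
Qed.

Lemma ballW (a : 'M[F]_n) k l : k <= l -> mball a l `<=` mball a k.
Proof. by move=> kl y /mballE hy; apply/mballE; apply: mgeW hy. Qed.

Lemma ball_refl (a : 'M[F]_n) k : mball a k a.
Proof. by apply/mballE; rewrite subrr; apply: mge0. Qed.

Lemma ball_measurable (a : 'M[F]_n) k : measurable (mball a k : set M).
Proof. by apply: sub_sigma_algebra; exists a, k. Qed.

Definition mopen (U : set M) : Prop :=
  forall x : 'M[F]_n, U x -> exists k, mball x k `<=` U.

Definition mopen2 (W : set (M * M)) : Prop :=
  forall x y : 'M[F]_n, W (x, y) -> exists k, mball x k `*` mball y k `<=` W.

(** Balls of equal radius with a common point coincide, so an open set is the union of its balls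
    centred at a countable dense sequence. *)
Lemma open_measurable U : mopen U -> measurable U.
Proof.
move=> oU; have [D hD] := dense_seq.
pose A (i k : nat) : set M := [set y | mball (D i) k%:Z `<=` U /\ mball (D i) k%:Z y].
have -> : U = \bigcup_i \bigcup_k A i k.
  apply/seteqP; split=> [x Ux|x [i _ [k _ [h hx]]]]; last exact: h.
  have [k hk] := oU x Ux; have [j hj] := hD x `|k|%N.
  have e := ball_center hj.
  exists j => //; exists `|k|%N => //; split; rewrite -e; last exact: ball_refl.
  by apply: subset_trans hk; apply: ballW; lia.
apply: bigcupT_measurable => i; apply: bigcupT_measurable => k.
have [h|h] := pselect (mball (D i) k%:Z `<=` U).
  have -> : A i k = mball (D i) k%:Z by apply/seteqP; split=> [y []|].
  exact: ball_measurable.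
have -> : A i k = set0 by apply/seteqP; split=> [y []|].
exact: measurable0.
Qed.

Lemma open2_measurable W : mopen2 W -> measurable W.
Proof.
move=> oW; have [D hD] := dense_seq.
pose B (i j k : nat) : set (M * M) := mball (D i) k%:Z `*` mball (D j) k%:Z.
pose A (i j k : nat) : set (M * M) := [set y | B i j k `<=` W /\ B i j k y].
have -> : W = \bigcup_i \bigcup_j \bigcup_k A i j k.
  apply/seteqP; split=> [[x y] Wxy|x [i _ [j _ [k _ [h hx]]]]]; last exact: h.
  have [k hk] := oW x y Wxy.
  have [i hi] := hD x `|k|%N; have [j hj] := hD y `|k|%N.
  have ei := ball_center hi; have ej := ball_center hj.
  exists i => //; exists j => //; exists `|k|%N => //; rewrite /A /B /= -ei -ej.
  split; last by split; apply: ball_refl.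
  by apply: subset_trans hk; apply: setSX; apply: ballW; lia.
have mB i j k : measurable (B i j k) by apply: measurableX; apply: ball_measurable.
apply: bigcupT_measurable => i; apply: bigcupT_measurable => j.
apply: bigcupT_measurable => k.
have [h|h] := pselect (B i j k `<=` W).
  have -> : A i j k = B i j k by apply/seteqP; split=> [y []|y].
  exact: mB.
have -> : A i j k = set0 by apply/seteqP; split=> [y []|].
exact: measurable0.
Qed.

Lemma measurable_to_mx d (T : measurableType d) (f : T -> M) :
  (forall a k, measurable (f @^-1` mball a k)) -> measurable_fun setT f.
Proof.
move=> h; apply: (@measurability _ _ _ _ setT f (@mballs F v n)) => //.
by move=> _ [_ [a [k ->]] <-]; rewrite setTI.
Qed.

Lemma mul_ball_near (x y a : 'M[F]_n) k : mball a k (x *m y) ->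
  exists l, forall x' y' : 'M[F]_n, mball x l x' -> mball y l y' -> mball a k (x' *m y').
Proof.
move=> /mballE h; have [c hx] := mge_exN v x; have [d hy] := mge_exN v y.
exists (`|k| + c%:Z + d%:Z) => x' y' /mballE hx' /mballE hy'; apply/mballE.
have -> : x' *m y' - a = (x' - x) *m (y' - y) + (x' - x) *m y + x *m (y' - y) + (x *m y - a).
  rewrite -mulmxDr subrK mulmxBl mulmxBr !addrA.
  by rewrite [_ - _ + _ *m _]addrAC subrK -addrA subrr addr0.
apply: (mgeD HF) => //; apply: (mgeD HF); first apply: (mgeD HF).
- by apply: mgeW (mgeM HF hx' hy'); lia.
- by apply: mgeW (mgeM HF hx' hy); lia.
- by apply: mgeW (mgeM HF hx hy'); lia.
Qed.

Lemma measurable_mulmx :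
  measurable_fun setT (fun p : M * M => (p.1 : 'M[F]_n) *m (p.2 : 'M[F]_n) : M).
Proof.
apply: measurable_to_mx => a k; apply: open2_measurable => x y /= h.
have [l hl] := mul_ball_near h.
by exists l => -[x' y'] /= [hx hy]; apply: hl.
Qed.

Lemma measurable_mulmx_fun d (T : measurableType d) (f g : T -> M) :
  measurable_fun setT f -> measurable_fun setT g ->
  measurable_fun setT (fun t => (f t : 'M[F]_n) *m (g t : 'M[F]_n) : M).
Proof.
move=> mf mg.
exact: (measurableT_comp measurable_mulmx (measurable_fun_pair mf mg)).
Qed.

Lemma unit_near (g : 'M[F]_n) l : \det g != 0 -> exists k, forall h : 'M[F]_n, mball g k h ->
  exists2 X, mge l X & h = g *m (1%:M + X).
Proof.
move=> dg; have [c hc] := mge_ex v (invmx g).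
exists (l - c) => h /mballE hh; exists (invmx g *m (h - g)).
  by apply: mgeW (mgeM HF hc hh); rewrite addrC subrK.
by rewrite mulmxDr mulmx1 mulKVmx ?det_unit // addrC subrK.
Qed.

Lemma val_det_near (g : 'M[F]_n) : \det g != 0 -> exists k, forall h : 'M[F]_n, mball g k h ->
  \det h != 0 /\ v (\det h) = v (\det g).
Proof.
move=> dg; have [k hk] := unit_near 1 dg; exists k => h /hk [X hX ->].
have [d1 v1] := cong_det HF hX.
by rewrite val_detM // v1 addr0 det_mulmx mulf_neq0.
Qed.

Lemma inv_near (g : 'M[F]_n) l : \det g != 0 -> exists k, forall h : 'M[F]_n, mball g k h ->
  mball (invmx g) l (invmx h).
Proof.
move=> dg; have [c hc] := mge_ex v (invmx g).
have [k hk] := unit_near (`|l - c| + 1) dg.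
exists k => h /hk [X hX ->].
have l1 : 1 <= `|l - c| + 1 by lia.
have [Y hY eY] := cong_inv HF l1 hX.
have [d1 _] : \det (1%:M + X) != 0 /\ v (\det (1%:M + X)) = 0.
  by apply: (cong_det HF); apply: mgeW hX.
apply/mballE; have -> : invmx (g *m (1%:M + X)) = invmx (1%:M + X) *m invmx g.
  have u1 : g \in unitmx by rewrite det_unit.
  have u2 : 1%:M + X \in unitmx by rewrite det_unit.
  have u3 : g *m (1%:M + X) \in unitmx by rewrite unitmx_mul u1.
  apply: (can_inj (mulKmx u3)); rewrite mulmxV // -mulmxA (mulmxA (1%:M + X)) mulmxV //.
  by rewrite mul1mx mulmxV.
rewrite eY mulmxDl mul1mx addrAC subrr add0r.
by apply: mgeW (mgeM HF hY hc); lia.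
Qed.

Lemma open_Gset : mopen (@Gset F n).
Proof. by move=> g /val_det_near[k hk]; exists k => h /hk[]. Qed.

Lemma open_val_det (P : int -> Prop) : mopen [set g : 'M[F]_n | \det g != 0 /\ P (v (\det g))].
Proof.
by move=> g [/val_det_near[k hk] Pg]; exists k => h /hk[h1 h2]; split=> //; rewrite h2.
Qed.

Lemma measurable_Gset : measurable (@Gset F n : set M).
Proof. exact: open_measurable open_Gset. Qed.

Lemma measurable_invmx : measurable_fun setT (fun g : M => invmx (g : 'M[F]_n) : M).
Proof.
apply: measurable_to_mx => a k.
(* [invmx] is the identity on singular matrices: the preimage is an open part inside GL_n(F)
   together with the singular part of the ball itself. *)
rewrite (_ : _ @^-1` _ = [set g : M | \det (g : 'M[F]_n) != 0 /\ mball a k (invmx (g : 'M[F]_n))]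
  `|` (~` @Gset F n `&` mball a k)).
  apply: measurableU; last first.
    by apply: measurableI; [exact: measurableC measurable_Gset|apply: ball_measurable].
  apply: open_measurable => g [dg hg].
  have [j1 h1] := val_det_near dg; have [j2 h2] := inv_near k dg.
  exists (Num.max j1 j2) => h hh; split.
    by have [] := h1 h; first by apply: ballW hh; rewrite le_max lexx.
  have := h2 h; rewrite (ball_center (a := invmx g) (b := a)); last exact/mballE.
  by apply; apply: ballW hh; rewrite le_max lexx orbT.
apply/seteqP; split=> [g|g [[]//|[]]] /=.
  have [dg|dg] := eqVneq (\det (g : 'M[F]_n)) 0.
    by rewrite /invmx det_unit dg eqxx /= => h; right; split=> //; rewrite /Gset /= dg eqxx.
  by left.
move=> dg h; have := dg; rewrite /Gset /= => /negP/negPn/eqP e.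
by rewrite /invmx det_unit e eqxx.
Qed.

Lemma measurable_local d (T : measurableType d) (f : M -> T) :
  (forall x : 'M[F]_n, \det x != 0 -> exists k, forall y, mball x k y -> f y = f x) ->
  (forall x y : 'M[F]_n, \det x = 0 -> \det y = 0 -> f x = f y) ->
  measurable_fun setT f.
Proof.
move=> hloc h0 _ Y mY; rewrite setTI.
have -> : f @^-1` Y = (@Gset F n `&` f @^-1` Y) `|` (~` @Gset F n `&` f @^-1` Y).
  by rewrite -setIUl setUv setTI.
apply: measurableU.
  apply: open_measurable => x [dx hx]; have [k hk] := hloc x dx.
  have [j hj] := open_Gset dx; exists (Num.max j k) => y hy; split.
    by apply: hj; apply: ballW hy; rewrite le_max lexx.
  by rewrite /= (hk y) //; apply: ballW hy; rewrite le_max lexx orbT.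
have [[x [/negP/negPn/eqP dx hx]]|h] := pselect (exists x, (~` @Gset F n `&` f @^-1` Y) x).
  rewrite (_ : _ `&` _ = ~` @Gset F n); first exact: measurableC measurable_Gset.
  apply/seteqP; split=> [y []//|y dy]; split=> //=.
  by rewrite (h0 y x) //; apply/eqP/negPn/negP.
rewrite (_ : _ `&` _ = set0); first exact: measurable0.
by apply/seteqP; split=> // y hy; apply: h; exists y.
Qed.

End MeasurableMatrices.

Section SigmaFinitePack.
Context d (T : measurableType d) (R : realType).
Variables (mu : {measure set T -> \bar R}) (smu : sigma_finite setT mu).

(** The proof of sigma-finiteness is kept as an argument, so that a measure for which it is only
    proved later can enter Tonelli's theorem. *)
Definition sigma_finite_pack of sigma_finite setT mu : set T -> \bar R := mu.

HB.instance Definition _ := Measure.on (sigma_finite_pack smu).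
HB.instance Definition _ := Measure_isSigmaFinite.Build d T R (sigma_finite_pack smu) smu.

End SigmaFinitePack.

Section TranslationInvariance.
Variables (R : realType) (F : fieldType) (v : F -> int).
Hypothesis HF : nonarch_local_field v.
Variable n : nat.
Local Notation mge := (mge v).
Local Notation M := (MXm v n).
Local Notation mball := (mball v).
Implicit Types (mu nu : {measure set M -> \bar R}).
Local Open Scope ereal_scope.

Lemma tonelli mu nu (f : M * M -> \bar R) :
  sigma_finite setT mu -> sigma_finite setT nu ->
  measurable_fun setT f -> (forall z, 0 <= f z) ->
  \int[mu]_x \int[nu]_y f (x, y) = \int[nu]_y \int[mu]_x f (x, y).
Proof.
move=> smu snu mf f0.
exact: (@fubini_tonelli _ _ _ _ _ (sigma_finite_pack smu) (sigma_finite_pack snu) f mf f0).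
Qed.

Lemma integral_preserving mu (phi : M -> M) (f : M -> \bar R) :
  measurable_fun setT phi -> (forall A, measurable A -> mu (phi @^-1` A) = mu A) ->
  measurable_fun setT f -> (forall z, 0 <= f z) ->
  \int[mu]_x f (phi x) = \int[mu]_x f x.
Proof.
move=> mphi hphi mf f0.
have := ge0_integral_pushforward mphi mu measurableT mf (fun y _ => f0 y).
rewrite preimage_setT => <-; apply: eq_measure_integral => A mA _.
exact: hphi.
Qed.

(** Preimages rather than images: they are measurable at once and combine with pushforwards. *)
Definition linv mu (h : 'M[F]_n) : Prop := forall A : set M, measurable A ->
  mu [set g : M | A (h *m (g : 'M[F]_n))] = mu A.

Definition rinv mu (h : 'M[F]_n) : Prop := forall A : set M, measurable A ->
  mu [set g : M | A ((g : 'M[F]_n) *m h)] = mu A.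

Lemma measurable_lmul (h : 'M[F]_n) : measurable_fun setT (fun g : M => h *m (g : 'M[F]_n) : M).
Proof. by apply: (measurable_mulmx_fun HF); [exact: measurable_cst|exact: measurable_id]. Qed.

Lemma measurable_rmul (h : 'M[F]_n) : measurable_fun setT (fun g : M => (g : 'M[F]_n) *m h : M).
Proof. by apply: (measurable_mulmx_fun HF); [exact: measurable_id|exact: measurable_cst]. Qed.

Lemma measurable_lpre (h : 'M[F]_n) (A : set M) : measurable A ->
  measurable [set g : M | A (h *m (g : 'M[F]_n))].
Proof. by move=> mA; rewrite -[X in measurable X]setTI; apply: (measurable_lmul h). Qed.

Lemma measurable_rpre (h : 'M[F]_n) (A : set M) : measurable A ->
  measurable [set g : M | A ((g : 'M[F]_n) *m h)].
Proof. by move=> mA; rewrite -[X in measurable X]setTI; apply: (measurable_rmul h). Qed.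

Lemma haar_linv (H K : set M) mu (h : 'M[F]_n) : haar_for H K mu -> \det h != 0%R -> H h -> linv mu h.
Proof.
move=> [_ hl _] dh Hh A mA; rewrite -(hl h _ Hh (measurable_lpre h mA)).
congr (mu _); apply/seteqP; split=> [_ [g Ag <-]//|g Ag].
by exists (invmx h *m (g : 'M[F]_n)); rewrite /= mulKVmx ?det_unit.
Qed.

Lemma rinv_integral mu h (f : M -> \bar R) : rinv mu h ->
  measurable_fun setT f -> (forall z, 0 <= f z) ->
  \int[mu]_x f ((x : 'M[F]_n) *m h) = \int[mu]_x f x.
Proof. by move=> hl; apply: (integral_preserving (measurable_rmul h)). Qed.

(* The compact subsets of GL_n(F) are the closed subsets of these sets. *)
Definition Cpt (k l : int) : set M :=
  [set g : M | [/\ \det (g : 'M[F]_n) != 0%R, mge k (g : 'M[F]_n) & (v (\det (g : 'M[F]_n)) <= l)%R]].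

Lemma det_near (g : 'M[F]_n) (l : int) : exists k, forall h : 'M[F]_n, mball g k h ->
  vge v l (\det h - \det g).
Proof.
have [c hc] := mge_exN v g.
exists (`|l| + c%:Z *+ n + c%:Z)%R => h /mballE hh.
have hh' : mge (- c%:Z) h.
  rewrite -[h](subrK g); apply: (mgeD HF) => //; apply: mgeW hh.
  by have := mulrn_wge0 n (_ : 0 <= c%:Z)%R; lia.
have l0 : (0 <= `|l| + c%:Z *+ n)%R by apply: addr_ge0 => //; apply: mulrn_wge0.
have := det_congr HF l0 hh' hc.
have -> : (- c%:Z + (`|l| + c%:Z *+ n) = `|l| + c%:Z *+ n - c%:Z)%R by rewrite addrC.
move=> hd; have /hd : mge (`|l| + c%:Z *+ n - c%:Z) (h - g) by apply: mgeW hh; lia.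
by apply: vgeW; rewrite mulNrn addrCA addNr addr0; lia.
Qed.

(** [ball_ind] around 0. A point whose determinant has valuation above l, in particular a singular
    one, has a neighbourhood avoiding [Cpt k l]; every other point is invertible. *)
Lemma compact_ind (Q : set M -> Prop) k l :
  Q set0 -> (forall U V, Q U -> Q V -> Q (U `|` V)) ->
  (forall U V, U `<=` V -> Q V -> Q U) ->
  (forall x : 'M[F]_n, \det x != 0%R -> exists j, Q (mball x j)) -> Q (Cpt k l).
Proof.
move=> Q0 QU QS Qloc.
have : Q (Cpt k l `&` mball 0%R k).
  apply: (@ball_ind _ _ HF n (fun B => Q (Cpt k l `&` (B : set M)))).
  - by rewrite setI0.
  - by move=> U V hU hV; rewrite setIUr; apply: QU.
  - by move=> U V UV; apply: QS; apply: setIS.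
  move=> x; have [hx|hx] := pselect (vge v (l + 1) (\det x)).
    have [j hj] := det_near x (l + 1); exists j; apply: QS Q0 => g [[dg _ vg] /hj hg].
    have : vge v (l + 1) (\det (g : 'M[F]_n)).
      by rewrite -[\det _](subrK (\det x)); apply: (vgeD HF).
    by rewrite vgeP // => h; move: vg; rewrite leNgt => /negP; apply; lia.
  have dx : \det x != 0%R by apply: contra_notN hx => /eqP ->; exact: vge0.
  by have [j hj] := Qloc x dx; exists j; apply: QS hj; apply: subIsetr.
by apply: QS => g hg; split=> //; case: hg => _ h _; apply/mballE; rewrite subr0.
Qed.

Lemma measurable_Cpt k l : measurable (Cpt k l).
Proof.
rewrite (_ : Cpt k l = [set g : 'M[F]_n | \det g != 0%R /\ (v (\det g) <= l)%R] `&` mball 0%R k).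
  apply: measurableI; last exact: ball_measurable.
  apply: (open_measurable HF); have h := @open_val_det F v HF n (fun z => z <= l)%R.
  exact: h.
apply/seteqP; split=> [g [h1 h2 h3]|g [[h1 h3] /mballE h2]]; split=> //.
  by apply/mballE; rewrite subr0.
by move: h2; rewrite subr0.
Qed.

End TranslationInvariance.

(** * Unimodularity of GL_n(F) *)

Section Unimodular.
Variables (R : realType) (F : fieldType) (v : F -> int).
Hypothesis HF : nonarch_local_field v.
Variable n' : nat.
Local Notation n := n'.+1.
Local Notation mge := (mge v).
Local Notation pw := (pw HF).
Local Notation M := (MXm v n).
Local Notation mball := (mball v).
Local Notation Cpt := (@Cpt F v n).
Implicit Types (mu nu : {measure set M -> \bar R}) (g h : 'M[F]_n).
Local Open Scope ereal_scope.

Lemma GiE (i : int) : Gi v i = Cpt (- i)%R i.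
Proof.
apply/seteqP; split=> [g [dg /ovGP[h1 h2]]|g [h1 h2 h3]]; split=> //.
by apply/ovGP.
Qed.

Lemma KP (g : 'M[F]_n) : Gi v 0%R g <-> [/\ \det g != 0, mge 0 g & v (\det g) = 0]%R.
Proof.
rewrite GiE oppr0; split=> [[h1 h2 h3]|[h1 h2 h3]]; split=> //; last by rewrite h3.
by have := vge_det HF h2; rewrite vgeP // mul0rn; move: h3; move: (v _) => D; lia.
Qed.

Lemma K_mul g h : Gi v 0%R g -> Gi v 0%R h -> Gi v 0%R (g *m h).
Proof.
move=> /KP[g1 g2 g3] /KP[h1 h2 h3]; apply/KP; split.
- by rewrite det_mulmx mulf_neq0.
- by rewrite -[0%R]addr0; apply: (mgeM HF).
- by rewrite val_detM // g3 h3.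
Qed.

Lemma K_inv g : Gi v 0%R g -> Gi v 0%R (invmx g).
Proof.
move=> /KP[g1 g2 g3]; apply/KP; split; first exact: det_invmx_neq0.
- by have := mge_inv HF g1 g2; rewrite g3 mul0rn subr0.
- by rewrite (val_detV HF) // g3 oppr0.
Qed.

Lemma CNP (N : int) g : mball 1%:M N g <-> exists2 X : 'M[F]_n, mge N X & g = (1%:M + X)%R.
Proof.
split=> [/mballE h|[X hX ->]]; first by exists (g - 1%:M)%R => //; rewrite addrC subrK.
by apply/mballE; rewrite addrAC subrr add0r.
Qed.

Lemma CN_sub_K (N : int) g : (1 <= N)%R -> mball 1%:M N g -> Gi v 0%R g.
Proof.
move=> N1 /CNP[X hX ->]; have hX1 : mge 1 X by apply: mgeW hX.
have [d vd] := cong_det HF hX1; apply/KP; split=> //.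
by apply: (mgeD HF); [exact: mge1|apply: mgeW hX1].
Qed.

Lemma CN_mul (N : int) g h : (1 <= N)%R -> mball 1%:M N g -> mball 1%:M N h ->
  mball 1%:M N (g *m h).
Proof.
move=> N1 /CNP[X hX ->] /CNP[Y hY ->]; apply/CNP; exists (X + Y + X *m Y)%R.
  apply: (mgeD HF); first exact: (mgeD HF).
  by apply: mgeW (mgeM HF hX hY); lia.
rewrite mulmxDl mul1mx mulmxDr mulmx1 -!addrA; congr (_ + _)%R.
by rewrite addrCA.
Qed.

Lemma CN_inv (N : int) g : (1 <= N)%R -> mball 1%:M N g -> mball 1%:M N (invmx g).
Proof.
by move=> N1 /CNP[X hX ->]; have [Y hY ->] := cong_inv HF N1 hX; apply/CNP; exists Y.
Qed.

(** The left coset of g for the congruence subgroup of level N, when g is invertible and N >= 1.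
    Such cosets are nested or disjoint. *)
Definition coset g (N : int) : set M := [set h : M | mball 1%:M N (invmx g *m (h : 'M[F]_n))].

Lemma measurable_coset g N : measurable (coset g N).
Proof. by apply: (measurable_lpre HF); apply: ball_measurable. Qed.

Lemma coset_refl g N : \det g != 0%R -> coset g N g.
Proof. by move=> dg; rewrite /coset /= mulVmx ?det_unit //; apply: ball_refl. Qed.

Lemma coset_sub g N : (1 <= N)%R -> coset g N `<=` @Gset F n.
Proof.
move=> N1 h /(CN_sub_K N1)/KP[+ _ _]; rewrite /Gset /= det_mulmx.
by apply: contraNneq => ->; rewrite mulr0.
Qed.

Lemma coset_eq g h N : (1 <= N)%R -> \det g != 0%R -> coset g N h -> coset g N = coset h N.
Proof.
move=> N1 dg hh; have dh := coset_sub N1 hh.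
have ug : g \in unitmx by rewrite det_unit.
have uh : h \in unitmx by rewrite det_unit.
have inv : coset h N g.
  have := CN_inv N1 hh; rewrite /coset /=.
  suff -> : invmx (invmx g *m h) = invmx h *m g by [].
  have u : invmx g *m h \in unitmx by rewrite unitmx_mul unitmx_inv ug.
  apply: (can_inj (mulKmx u)); rewrite mulmxV // -mulmxA (mulmxA h) mulmxV // mul1mx.
  by rewrite mulVmx.
apply/seteqP; split=> k /= hk; rewrite /coset /=.
  by have := CN_mul N1 inv hk; rewrite -mulmxA (mulmxA g) mulmxV // mul1mx.
by have := CN_mul N1 hh hk; rewrite -mulmxA (mulmxA h) mulmxV // mul1mx.
Qed.

Lemma coset_near g N : \det g != 0%R -> exists k, mball g k `<=` coset g N.
Proof.
move=> dg; have [k hk] := unit_near HF N dg; exists k => h /hk [X hX e].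
rewrite /coset /=; apply/CNP; exists X => //.
by rewrite e mulmxA mulVmx ?det_unit // mul1mx.
Qed.

(** The mass of GL_n(O_F) is only required to be finite, so that images under right translations
    belong to the same class. *)
Record haarG mu : Prop := {
  hG_null : mu (~` @Gset F n) = 0;
  hG_linv : forall h, \det h != 0%R -> linv mu h;
  hG_fin : mu (Gi v 0%R) < +oo }.

Lemma measurable_K : measurable (Gi v 0%R : set M).
Proof. by rewrite GiE; apply: (measurable_Cpt HF). Qed.

Section OneMeasure.
Variable mu : {measure set M -> \bar R}.
Hypothesis hmu : haarG mu.

Lemma mu_coset g N : \det g != 0%R -> mu (coset g N) = mu (mball 1%:M N).
Proof. by move=> dg; apply: (hG_linv hmu) (ball_measurable _ _); apply: det_invmx_neq0. Qed.

Lemma mu_restrict (A : set M) : measurable A -> mu A = mu (A `&` @Gset F n).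
Proof.
move=> mA; have mG := @measurable_Gset _ _ HF n.
have e : A = (A `&` @Gset F n) `|` (A `&` ~` @Gset F n) by rewrite -setIUr setUv setIT.
rewrite {1}e measureU0 //.
- exact: measurableI.
- by apply: measurableI => //; apply: measurableC.
apply: (@subset_measure0 _ _ _ mu _ (~` @Gset F n)).
- by apply: measurableI => //; apply: measurableC.
- exact: measurableC.
- exact: subIsetr.
- exact: (hG_null hmu).
Qed.

Lemma mu_Cpt k l : mu (Cpt k l) < +oo.
Proof.
pose Q (U : set M) := exists V, [/\ measurable V, U `<=` V & mu V < +oo].
have [V [mV UV fV]] : Q (Cpt k l).
  apply: (compact_ind HF).
  - by exists set0; split; [exact: measurable0|by []|rewrite measure0].
  - move=> U1 U2 [V1 [m1 s1 f1]] [V2 [m2 s2 f2]]; exists (V1 `|` V2); split.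
    + exact: measurableU.
    + exact: setUSS.
    + by apply: le_lt_trans (measureU2 _ m1 m2) _; apply: lte_add_pinfty.
  - by move=> U V UV [W [mW VW fW]]; exists W; split=> //; apply: subset_trans VW.
  move=> x dx; have [j hj] := coset_near 1%R dx; exists j, (coset x 1%R); split=> //.
    exact: measurable_coset.
  rewrite mu_coset //; apply: le_lt_trans (hG_fin hmu).
  apply: le_measure; rewrite ?inE; [exact: ball_measurable|exact: measurable_K|].
  by move=> g; apply: CN_sub_K.
apply: le_lt_trans fV; apply: le_measure => //; rewrite inE //.
exact: (measurable_Cpt HF).
Qed.

(** By compactness finitely many cosets of the congruence subgroup cover GL_n(O_F), which would be
    null with them. *)
Lemma mu_pos N : mu (Gi v 0%R) != 0 -> mu (mball 1%:M N) != 0.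
Proof.
apply: contra_neq => h0.
pose Q (U : set M) := exists V, [/\ measurable V, U `<=` V & mu V = 0].
have [V [mV UV fV]] : Q (Cpt 0%R 0%R).
  apply: (compact_ind HF).
  - by exists set0; split; [exact: measurable0|by []|rewrite measure0].
  - move=> U1 U2 [V1 [m1 s1 f1]] [V2 [m2 s2 f2]]; exists (V1 `|` V2); split.
    + exact: measurableU.
    + exact: setUSS.
    + by rewrite measureU0.
  - by move=> U V UV [W [mW VW fW]]; exists W; split=> //; apply: subset_trans VW.
  move=> x dx; have [j hj] := coset_near N dx; exists j, (coset x N); split=> //.
    exact: measurable_coset.
  by rewrite mu_coset.
rewrite GiE oppr0; apply: (@subset_measure0 _ _ _ mu _ V) => //.
exact: (measurable_Cpt HF).
Qed.

Lemma haarG_sigma_finite : sigma_finite setT mu.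
Proof.
exists (fun k : nat => ~` @Gset F n `|` Cpt (- k%:Z)%R k%:Z).
  apply/seteqP; split=> // g _.
  have [dg|dg] := eqVneq (\det (g : 'M[F]_n)) 0%R.
    by exists 0%N => //; left; rewrite /Gset /= dg eqxx.
  have [c hc] := mge_exN v (g : 'M[F]_n).
  exists (c + `|v (\det (g : 'M[F]_n))|)%N => //; right; split=> //; last by lia.
  by apply: mgeW hc; lia.
have mG := @measurable_Gset _ _ HF n.
move=> k; split; first by apply: measurableU; [exact: measurableC|exact: measurable_Cpt].
apply: le_lt_trans (measureU2 _ (measurableC mG) (measurable_Cpt HF _ _)) _.
apply: lte_add_pinfty; last exact: mu_Cpt.
apply: (@le_lt_trans _ _ 0); last exact: ltry.
have h0 := hG_null hmu; exact: (eq_ind_r (fun z => z <= 0) (lexx 0) h0).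
Qed.

End OneMeasure.

Lemma integral_indicT mu (A : set M) : measurable A -> \int[mu]_x (\1_A x)%:E = mu A.
Proof. by move=> mA; rewrite integral_indic // setIT. Qed.

(** Integrate, in both orders, the indicator of the pairs in GL_n(O_F) that share a coset of the
    congruence subgroup. The relation is symmetric, so Tonelli's theorem compares the two measures
    without any index. *)
Lemma haarG_count mu nu N : haarG mu -> haarG nu -> (1 <= N)%R ->
  mu (mball 1%:M N) * nu (Gi v 0%R) = nu (mball 1%:M N) * mu (Gi v 0%R).
Proof.
move=> hmu hnu N1.
pose W : set (M * M) := [set z | Gi v 0%R z.1 /\ mball 1%:M N (invmx (z.1 : 'M[F]_n) *m (z.2 : 'M[F]_n))].
have mW : measurable W.
  have -> : W = (fst @^-1` Gi v 0%R) `&`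
     ((fun z : M * M => invmx (z.1 : 'M[F]_n) *m (z.2 : 'M[F]_n) : M) @^-1` mball 1%:M N) by [].
  apply: measurableI.
    by rewrite -[X in measurable X]setTI; apply: measurable_fst => //; apply: measurable_K.
  rewrite -[X in measurable X]setTI.
  have mf : measurable_fun setT (fun z : M * M => invmx (z.1 : 'M[F]_n) *m (z.2 : 'M[F]_n) : M).
    apply: (measurable_mulmx_fun HF); last exact: measurable_snd.
    exact: (measurableT_comp (@measurable_invmx _ _ HF n) measurable_fst).
  by apply: mf => //; apply: ball_measurable.
have side nu1 nu2 (P : M -> M -> Prop) : haarG nu1 ->
   (forall t s, P t s <-> Gi v 0%R t /\ mball 1%:M N (invmx (t : 'M[F]_n) *m (s : 'M[F]_n))) ->
   \int[nu2]_t \int[nu1]_s (\1_[set z | P z.1 z.2] (t, s))%:E =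
   nu1 (mball 1%:M N) * nu2 (Gi v 0%R).
  move=> h1 hP; transitivity (\int[nu2]_t (nu1 (mball 1%:M N) * (\1_(Gi v 0%R : set M) t)%:E)).
    apply: eq_integral => t _.
    have [Kt|Kt] := pselect (Gi v 0%R (t : 'M[F]_n)).
      have /KP[dt _ _] := Kt.
      transitivity (\int[nu1]_s (\1_(coset t N) s)%:E).
        apply: eq_integral => s _; congr (_%:E); rewrite !indicE; congr (_%:R).
        congr nat_of_bool; apply/asbool_equiv_eq; rewrite /= hP; split=> [[]//|]; split=> //.
      rewrite integral_indicT ?mu_coset //; last exact: measurable_coset.
      by rewrite indicE mem_set // mule1.
    rewrite indicE memNset // mule0 integral0_eq // => s _.
    by rewrite indicE memNset //= hP => -[].
  rewrite ge0_integralZl ?integral_indicT //; first exact: measurable_K.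
  by apply/measurable_EFinP/measurable_indicP; apply: measurable_K.
have := @tonelli R F v n nu mu (fun z => (\1_W z)%:E) (haarG_sigma_finite hnu) (haarG_sigma_finite hmu).
rewrite (side mu nu (fun t s => W (t, s))) // => ->.
- apply: (side nu mu (fun s t => W (t, s))) => // s t; rewrite /W /=.
  split=> -[Kt hh].
    have /KP[dt _ _] := Kt; have ut : (t : 'M[F]_n) \in unitmx by rewrite det_unit.
    have Ks : Gi v 0%R s.
      by have := K_mul Kt (CN_sub_K N1 hh); rewrite mulKVmx.
    split=> //; have := coset_eq N1 dt hh; have := coset_refl N dt.
    by rewrite /coset => + e; rewrite e.
  have /KP[dt _ _] := Kt; have ut : (s : 'M[F]_n) \in unitmx by rewrite det_unit.
  have Ks : Gi v 0%R t.
    by have := K_mul Kt (CN_sub_K N1 hh); rewrite mulKVmx.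
  split=> //; have := coset_eq N1 dt hh; have := coset_refl N dt.
  by rewrite /coset => + e; rewrite e.
- by apply/measurable_EFinP/measurable_indicP.
- by move=> z; rewrite lee_fin indicE.
Qed.

(** Up to singular matrices, which are null, the empty set and the cosets of congruence subgroups
    are closed under intersection and generate the Borel sets; on cosets [haarG_count] gives
    proportionality. *)
Lemma haarG_uniq mu nu (A : set M) : haarG mu -> haarG nu -> mu (Gi v 0%R) = 1 ->
  measurable A -> nu A = nu (Gi v 0%R) * mu A.
Proof.
move=> hmu hnu mu1 mA.
have nuK : nu (Gi v 0%R) \is a fin_num by rewrite ge0_fin_numE // (hG_fin hnu).
pose c : {nonneg R} := NngNum (fine_ge0 (measure_ge0 nu (Gi v 0%R))).
have ec : c%:num%:E = nu (Gi v 0%R) by rewrite /c /= fineK.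
pose G : set (set M) := [set B : set M | measurable B /\ (B `&` @Gset F n = set0 \/
   exists g N, [/\ \det g != 0%R, (1 <= N)%R & B `&` @Gset F n = coset g N])].
have Gcos g N : \det g != 0%R -> (1 <= N)%R -> G (coset g N).
  move=> dg N1; split; first exact: measurable_coset.
  right; exists g, N; split=> //; apply/seteqP; split=> [h []//|h hh]; split=> //.
  exact: coset_sub hh.
have GcG : G (~` @Gset F n).
  split; first exact: measurableC (@measurable_Gset _ _ HF n).
  by left; rewrite setICl.
have [D hD] := dense_seq HF n.
pose g0 (j : nat) : set M := if \det (D j) != 0%R then coset (D j) 1%R else ~` @Gset F n.
have Gg0 j : G (g0 j) by rewrite /g0; case: ifP => // h; apply: Gcos.
have near g N : \det g != 0%R -> exists j, \det (D j) != 0%R /\ coset g N (D j).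
  move=> dg; have [k hk] := coset_near N dg; have [k2 hk2] := val_det_near HF dg.
  have [j hj] := hD g (`|k| + `|k2|)%N; exists j; split.
    by have [] := hk2 (D j); first by apply/mballE; apply: (mgeBC HF); apply: mgeW hj; lia.
  by apply: hk; apply/mballE; apply: (mgeBC HF); apply: mgeW hj; lia.
have cover : \bigcup_k g0 k `|` ~` @Gset F n = setT.
  apply/seteqP; split=> // g _; have [dg|dg] := pselect (@Gset F n g); last by right.
  left; have [j [dj hj]] := near g 1%R dg; exists j => //; rewrite /g0 dj.
  by rewrite -(coset_eq _ dg hj) //; apply: coset_refl.
pose g1 (j : nat) : set M := if j is j'.+1 then g0 j' else ~` @Gset F n.
have measE : measurable = <<s G >>.
  apply/seteqP; split; last first.
    by apply: smallest_sub; [exact: sigma_algebra_measurable|move=> B []].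
  apply: smallest_sub; first exact: smallest_sigma_algebra.
  move=> _ [a [k ->]].
  (* The ball is cut into its singular part and the cosets around dense points that it contains. *)
  pose S (i : nat) : set M := if i is j.+1 then \bigcup_l
       (if asbool (\det (D j) != 0%R /\ coset (D j) (l.+1)%:Z `<=` mball a k)
        then coset (D j) (l.+1)%:Z else set0) else mball a k `&` ~` @Gset F n.
  have -> : mball a k = \bigcup_i S i.
    apply/seteqP; split=> [g hg|g [[|i] _]]; last first.
    - by case=> l _; case: asboolP => [[_ h]|//]; apply: h.
    - by case.
    have [dg|dg] := pselect (@Gset F n g); last by exists 0%N.
    have [c0 hc0] := mge_exN v (g : 'M[F]_n).
    pose l := (`|k| + c0)%N.
    have [i [di hi]] := near g l.+1%:Z dg.
    exists i.+1 => //; exists l => //; have e := coset_eq (isT : 1 <= l.+1%:Z)%R dg hi.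
    case: asboolP => [_|]; first by rewrite -e; apply: coset_refl.
    case; split=> //; rewrite -e => h /CNP[X hX eX].
    have -> : h = ((g : 'M[F]_n) + (g : 'M[F]_n) *m X)%R :> 'M[F]_n.
      rewrite -{1}[h : 'M[F]_n](mulKVmx (_ : (g : 'M[F]_n) \in unitmx)) ?det_unit //.
      by rewrite eX mulmxDr mulmx1.
    apply/mballE; move/mballE: hg => hg; rewrite addrAC; apply: (mgeD HF) => //.
    by apply: mgeW (mgeM HF hc0 hX); rewrite /l; lia.
  apply: sigma_algebra_bigcup => -[|i].
    apply: sub_sigma_algebra; split; last by left; rewrite -setIA setICl setI0.
    by apply: measurableI; [exact: ball_measurable|exact: measurableC (@measurable_Gset _ _ HF n)].
  apply: sigma_algebra_bigcup => l; case: asboolP => [[di _]|_]; last exact: sigma_algebra0.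
  by apply: sub_sigma_algebra; apply: Gcos.
have coset_nu nu1 g N : haarG nu1 -> \det g != 0%R -> (1 <= N)%R -> nu1 (coset g N) < +oo.
  move=> h1 dg N1; rewrite (mu_coset h1) //; apply: le_lt_trans (hG_fin h1).
  apply: le_measure; rewrite ?inE; [exact: ball_measurable|exact: measurable_K|].
  by move=> h; apply: CN_sub_K.
rewrite -ec; apply: (@measure_unique _ R M G g1 measE _ _ _ nu (mscale c mu)) => //.
- move=> A1 B1 [mA1 cA] [mB1 cB]; split; first exact: measurableI.
  case: cA => [e|[g [N [dg N1 eA]]]]; first by left; rewrite setIAC e set0I.
  case: cB => [e|[h [N' [dh N1' eB]]]]; first by left; rewrite -setIA e setI0.
  have e : A1 `&` B1 `&` @Gset F n = coset g N `&` coset h N'.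
    by rewrite -eA -eB setIACA setIid.
  have [[k [kg kh]]|no] := pselect (exists k, (coset g N `&` coset h N') k); last first.
    by left; rewrite e; apply/seteqP; split=> // k hk; apply: no; exists k.
  right; exists k, (Num.max N N'); split; first exact: coset_sub kg.
    by rewrite le_max N1.
  rewrite e (coset_eq N1 dg kg) (coset_eq N1' dh kh); apply/seteqP; split=> y.
    by move=> [h1 h2]; rewrite /coset /= /Order.max; case: ifP.
  by move=> h1; split; move: h1; apply: ballW; rewrite le_max lexx ?orbT.
- by case.
- apply/seteqP; split=> // g _; have : (\bigcup_k g0 k `|` ~` @Gset F n) g by rewrite cover.
  by case=> [[k _ hk]|hg]; [exists k.+1|exists 0%N].
- move=> B1 [mB1 cB]; transitivity (nu (Gi v 0%R) * mu B1); last by rewrite -ec.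
  rewrite (mu_restrict hnu mB1) (mu_restrict hmu mB1).
  case: cB => [->|[g [N [dg N1 ->]]]]; first by rewrite !measure0 mule0.
  rewrite !mu_coset // muleC (haarG_count hmu hnu N1) mu1 mule1 //.
case=> [|k] /=; first by rewrite (hG_null hnu).
by rewrite /g0; case: ifP => dk; [apply: coset_nu|rewrite (hG_null hnu)].
Qed.

Section Modulus.
Variable mu : {measure set M -> \bar R}.
Hypothesis hmu : haarG mu.
Hypothesis mu1 : mu (Gi v 0%R) = 1.

(** The modular function, measured on the translate of GL_n(O_F) by g^-1 on the right. *)
Definition modulus g : \bar R := mu [set h : M | Gi v 0%R ((h : 'M[F]_n) *m g)].

Lemma modulus_fin g : \det g != 0%R -> modulus g < +oo.
Proof.
move=> dg; have [c hc] := mge_ex v (invmx g).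
apply: le_lt_trans (mu_Cpt hmu c (- v (\det g))%R).
apply: le_measure; rewrite ?inE; first exact: (measurable_rpre HF g measurable_K).
  exact: (measurable_Cpt HF).
move=> h /KP[h1 h2 h3]; have dh : \det (h : 'M[F]_n) != 0%R.
  by move: h1; rewrite det_mulmx; apply: contraNneq => ->; rewrite mul0r.
split=> //; last by move: h3; rewrite val_detM //; move: (v _) (v _) => a b; lia.
rewrite -[h : 'M[F]_n](mulmxK (_ : g \in unitmx)) ?det_unit // -[c]add0r.
exact: (mgeM HF).
Qed.

Lemma modulusE g (A : set M) : \det g != 0%R -> measurable A ->
  mu [set h : M | A ((h : 'M[F]_n) *m g)] = modulus g * mu A.
Proof.
move=> dg mA; have mf := @measurable_rmul F v HF n g.
have hnu : haarG (pushforward mu (fun h : M => (h : 'M[F]_n) *m g : M)).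
  split.
  - rewrite /pushforward -[RHS](hG_null hmu); congr (mu _); apply/seteqP.
    split=> h /= hh; rewrite /Gset /=; apply: contra_not hh => dh.
      by rewrite /Gset /= det_mulmx mulf_neq0.
    by move: dh; rewrite /Gset /= det_mulmx; apply: contraNneq => ->; rewrite mul0r.
  - move=> h dh B mB; rewrite /pushforward.
    rewrite -[RHS](hG_linv hmu dh (measurable_rpre HF g mB)).
    by congr (mu _); apply/seteqP; split=> k /=; rewrite mulmxA.
  - exact: modulus_fin.
have {}hnu := hnu mf; exact: (haarG_uniq hmu hnu mu1 mA).
Qed.

Lemma modulusM g h : \det g != 0%R -> \det h != 0%R ->
  modulus (g *m h) = modulus g * modulus h.
Proof.
move=> dg dh; rewrite -modulusE //; last exact: (measurable_rpre HF h measurable_K).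
by rewrite /modulus; congr (mu _); apply/seteqP; split=> k /=; rewrite mulmxA.
Qed.

Lemma modulus_K g : Gi v 0%R g -> modulus g = 1.
Proof.
move=> Kg; rewrite /modulus -[RHS]mu1; congr (mu _).
have /KP[dg _ _] := Kg; apply/seteqP; split=> h /= hh; last exact: K_mul.
by have := K_mul hh (K_inv Kg); rewrite mulmxK ?det_unit.
Qed.

Lemma modulus_scalar (a : F) : a != 0%R -> modulus a%:M = 1.
Proof.
move=> a0; have da : \det (a%:M : 'M[F]_n) != 0%R by rewrite det_scalar expf_neq0.
rewrite /modulus -[RHS]mu1 -[RHS](hG_linv hmu da measurable_K); congr (mu _).
by apply/seteqP; split=> h /=; rewrite scalar_mxC.
Qed.

Lemma modulusV g : \det g != 0%R -> modulus g * modulus (invmx g) = 1.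
Proof.
move=> dg; rewrite -modulusM ?det_invmx_neq0 // mulmxV ?det_unit //.
exact: (modulus_scalar (oner_neq0 F)).
Qed.

Lemma modulus_conj g h : \det g != 0%R -> \det h != 0%R ->
  modulus (g *m h *m invmx g) = modulus h.
Proof.
move=> dg dh; have di := det_invmx_neq0 dg.
rewrite !modulusM ?det_mulmx ?mulf_neq0 //.
by rewrite muleAC modulusV // mul1e.
Qed.

Lemma modulus_conjK g h : \det g != 0%R -> \det h != 0%R ->
  Gi v 0%R (g *m h *m invmx g) -> modulus h = 1.
Proof. by move=> dg dh hK; rewrite -(modulus_conj dg dh) modulus_K. Qed.

(** Conjugation by this diagonal matrix contracts unipotent triangular matrices of one type, lower
    or upper according to the sign of s. *)
Definition scaling (s : int) : 'M[F]_n := diag_mx (\row_(i < n) pw (s * (i : nat)%:Z)).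

Lemma scaling_inv s : scaling s *m scaling (- s) = 1%:M.
Proof.
rewrite /scaling; apply/matrixP => i j; rewrite mul_diag_mx !mxE.
by case: eqP => [->|_]; rewrite ?mulr0n ?mulr0 // mulr1n mulNr pwKV.
Qed.

(** The modulus is invariant under conjugation and trivial on GL_n(O_F), into which a [scaling]
    conjugates g. The value s = 1 covers lower and s = -1 upper triangular matrices. *)
Lemma modulus_unitri g (s : int) : (s = 1 \/ s = -1)%R ->
  (forall i, g i i = 1%R) ->
  (forall i j : 'I_n, (s * (i : nat)%:Z < s * (j : nat)%:Z)%R -> g i j = 0%R) ->
  \det g = 1%R -> modulus g = 1.
Proof.
move=> hs g1 g0 dg1; have dg : \det g != 0%R by rewrite dg1 oner_eq0.
have [c hc] := mge_exN v g.
have hsi := scaling_inv (s * c%:Z)%R.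
have ds : \det (scaling (s * c%:Z)) != 0%R.
  have := congr1 determinant hsi; rewrite det_mulmx det1 => e.
  by apply: contraTneq isT => e0; move: e; rewrite e0 mul0r => /eqP; rewrite eq_sym oner_eq0.
have ei : invmx (scaling (s * c%:Z)) = scaling (- (s * c%:Z)).
  apply: (can_inj (mulKmx (_ : scaling (s * c%:Z) \in unitmx))); rewrite ?det_unit //.
  by rewrite mulmxV ?det_unit // hsi.
apply: (modulus_conjK ds dg); apply/KP; split.
- by rewrite !det_mulmx !mulf_neq0 ?det_invmx_neq0.
- rewrite ei => i j; rewrite /scaling mul_mx_diag mul_diag_mx !mxE.
  have [eij|nij] := eqVneq i j.
    by rewrite eij g1 mulr1 mulNr pwKV; apply: (vge01 HF).
  have [lt|ge] := ltP (s * (i : nat)%:Z)%R (s * (j : nat)%:Z)%R.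
    by rewrite g0 // mulr0 mul0r vge0.
  rewrite mulrAC -pwD.
  have hp : v (pw (s * c%:Z * (i : nat)%:Z + - (s * c%:Z) * (j : nat)%:Z)) =
     (s * c%:Z * (i : nat)%:Z + - (s * c%:Z) * (j : nat)%:Z)%R by rewrite val_pw.
  apply: vgeW (_ : vge v (s * c%:Z * (i : nat)%:Z + - (s * c%:Z) * (j : nat)%:Z + - c%:Z) _).
    have ne : (i : nat) <> (j : nat) by move=> e; move/eqP: nij; apply; apply: val_inj.
    by case: hs ge => ->; nia.
  by rewrite (vgeMl HF) ?pw_neq0.
- have di := det_invmx_neq0 ds.
  rewrite !val_detM ?det_mulmx ?mulf_neq0 // (val_detV HF) // dg1 (val1 HF).
  by rewrite addr0 subrr.
Qed.

Lemma modulus_real g : \det g != 0%R -> exists2 r : R, (0 <= r)%R & modulus g = r%:E.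
Proof.
move=> dg; exists (fine (modulus g)); first by apply: fine_ge0; apply: measure_ge0.
by rewrite fineK // ge0_fin_numE ?modulus_fin // measure_ge0.
Qed.

Definition pdiag (t : F) (i : 'I_n) : 'M[F]_n := diag_mx (\row_j (if j == i then t else 1)%R).

Lemma det_pdiag t i : t != 0%R -> \det (pdiag t i) != 0%R.
Proof.
move=> t0; rewrite det_diag; apply/prodf_neq0 => j _; rewrite mxE.
by case: ifP => // _; rewrite oner_neq0.
Qed.

Lemma modulus_pdiag_eq t i : t != 0%R -> modulus (pdiag t i) = modulus (pdiag t ord0).
Proof.
move=> t0; pose s : 'M[F]_n := tperm_mx ord0 i.
have sK : Gi v 0%R s.
  apply/KP; rewrite det_perm; split; first by rewrite signr_eq0.
    by move=> a b; rewrite !mxE; case: eqP => _; [apply: (vge01 HF)|apply: vge0].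
  by rewrite -signr_odd; case: odd; rewrite ?(valN HF) ?(val1 HF).
have /KP[ds _ _] := sK.
rewrite -(modulus_conj ds (det_pdiag ord0 t0)); congr modulus.
have -> : invmx s = s.
  have ss : s *m s = 1%:M by rewrite /s -perm_mxM perm.tperm2 perm_mx1.
  by apply: (can_inj (mulKmx (_ : s \in unitmx))); rewrite ?det_unit // mulmxV ?det_unit.
apply/matrixP => a b; rewrite /pdiag /s -xrowE -xcolE !mxE (inj_eq perm.perm_inj).
have -> : (perm.tperm ord0 i a == ord0) = (a == i) by rewrite -{2}(perm.tpermR ord0 i) (inj_eq perm.perm_inj).
by [].
Qed.

Definition sdiag (s : seq 'I_n) (d : 'rV[F]_n) : 'M[F]_n :=
  diag_mx (\row_j (if j \in s then d 0%R j else 1)%R).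

Lemma sdiag_cons i s d : i \notin s -> sdiag (i :: s) d = pdiag (d 0%R i) i *m sdiag s d.
Proof.
move=> is_; rewrite /sdiag /pdiag mulmx_diag; congr diag_mx; apply/rowP => j; rewrite !mxE in_cons.
case: eqP => [->|_] /=; first by rewrite (negbTE is_) mulr1.
by rewrite mul1r.
Qed.

Lemma det_sdiag s (d : 'rV[F]_n) : (forall i, d 0%R i != 0%R) -> \det (sdiag s d) != 0%R.
Proof.
move=> d0; rewrite det_diag; apply/prodf_neq0 => j _; rewrite mxE.
by case: ifP; rewrite ?oner_neq0.
Qed.

(** A scalar matrix is the product of the n matrices [pdiag t i], which have one common modulus r
    because permutation matrices lie in GL_n(O_F). So r^n = 1, and r >= 0 gives r = 1. *)
Lemma modulus_pdiag t i : t != 0%R -> modulus (pdiag t i) = 1.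
Proof.
move=> t0; rewrite modulus_pdiag_eq //.
have [r r0 er] := modulus_real (det_pdiag ord0 t0).
have key (s : seq 'I_n) : uniq s -> modulus (sdiag s (const_mx t)) = (r ^+ size s)%:E.
  elim: s => [|j s IH] /=.
    have -> : sdiag [::] (const_mx t) = 1%:M.
      by rewrite /sdiag -diag_const_mx; congr diag_mx; apply/rowP => j; rewrite !mxE.
    by rewrite (modulus_scalar (oner_neq0 F)).
  case/andP => js us; rewrite sdiag_cons // modulusM ?det_pdiag ?det_sdiag ?mxE //; last first.
    by move=> k; rewrite mxE.
  by rewrite IH // modulus_pdiag_eq // er -EFinM exprS.
have := key (index_enum 'I_n) (index_enum_uniq _).
have -> : sdiag (index_enum 'I_n) (const_mx t) = t%:M.
  by rewrite /sdiag -diag_const_mx; congr diag_mx; apply/rowP => j; rewrite !mxE mem_index_enum.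
rewrite modulus_scalar // => -[] /esym/eqP.
have -> : size (index_enum 'I_n) = n by rewrite -[in RHS](card_ord n) cardT /index_enum -enumT.
by rewrite er pexpr_eq1 // => /eqP ->.
Qed.

Lemma modulus_diag (d : 'rV[F]_n) : (forall i, d 0%R i != 0%R) -> modulus (diag_mx d) = 1.
Proof.
move=> d0; have key (s : seq 'I_n) : uniq s -> modulus (sdiag s d) = 1.
  elim: s => [|j s IH] /=.
    have -> : sdiag [::] d = 1%:M.
      by rewrite /sdiag -diag_const_mx; congr diag_mx; apply/rowP => j; rewrite !mxE.
    by move=> _; apply: (modulus_scalar (oner_neq0 F)).
  case/andP => js us; rewrite sdiag_cons // modulusM ?det_pdiag ?det_sdiag //.
  by rewrite IH // modulus_pdiag // mule1.
have <- : sdiag (index_enum 'I_n) d = diag_mx d.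
  by rewrite /sdiag; congr diag_mx; apply/rowP => j; rewrite !mxE mem_index_enum.
exact: key (index_enum_uniq _).
Qed.

(** LUP decomposition: permutation, unipotent triangular and invertible diagonal matrices have
    modulus 1. *)
Lemma modulus1 g : \det g != 0%R -> modulus g = 1.
Proof.
move=> dg; have := cormen_lup_correct g; have := cormen_lup_perm g.
have := cormen_lup_detL g; have := @cormen_lup_lower _ _ g; have := @cormen_lup_upper _ _ g.
case: (cormen_lup g) => [[P L] U] /= hU hL dL hP e.
have KP' : Gi v 0%R P.
  have [s ->] := is_perm_mxP _ hP; apply/KP; rewrite det_perm; split; first by rewrite signr_eq0.
    by move=> a b; rewrite !mxE; case: eqP => _; [apply: (vge01 HF)|apply: vge0].
  by rewrite -signr_odd; case: odd; rewrite ?(valN HF) ?(val1 HF).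
have /KP[dP _ _] := KP'.
have dL0 : \det L != 0%R by rewrite dL oner_neq0.
have dU : \det U != 0%R.
  have : \det (P *m g) != 0%R by rewrite det_mulmx mulf_neq0.
  by rewrite mulmxE e -mulmxE det_mulmx; apply: contraNneq => ->; rewrite mulr0.
have mL : modulus L = 1.
  apply: (@modulus_unitri L 1%R) => //; first by left.
    by move=> i; rewrite hL // eqxx.
  move=> i j lt; have ij : (i < j)%N by lia.
  by rewrite hL ?(ltnW ij) //; case: eqP => // E; rewrite E ltnn in ij.
have dtri : \det U = (\prod_i U i i)%R.
  rewrite -det_tr; apply: eq_trans (det_trig _) _.
    by apply/is_trig_mxP => i j ij; rewrite mxE hU.
  by apply: eq_bigr => i _; rewrite mxE.
have Uii i : U i i != 0%R by have := dU; rewrite dtri => /prodf_neq0; apply.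
pose d : 'rV[F]_n := (\row_i U i i)%R.
pose d' : 'rV[F]_n := (\row_i (U i i)^-1)%R.
have dd : \det (diag_mx d) != 0%R by rewrite det_diag; apply/prodf_neq0 => i _; rewrite mxE.
have dd' : \det (diag_mx d') != 0%R.
  by rewrite det_diag; apply/prodf_neq0 => i _; rewrite mxE invr_eq0.
have eU : U = diag_mx d *m (diag_mx d' *m U).
  by apply/matrixP => i j; rewrite !mul_diag_mx !mxE mulrA divff ?mul1r.
have mU : modulus (diag_mx d' *m U) = 1.
  apply: (@modulus_unitri _ (-1)%R); first by right.
  - by move=> i; rewrite mul_diag_mx !mxE mulVf.
  - move=> i j; rewrite !mulN1r ltrN2 ltz_nat => lt.
    by rewrite mul_diag_mx !mxE (hU _ _ lt) mulr0.
  rewrite det_mulmx dtri det_diag -big_split /= big1 // => i _.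
  by rewrite mxE mulVf.
have : modulus (P *m g) = 1.
  rewrite mulmxE e -mulmxE modulusM // mL mul1e eU modulusM //; last by rewrite det_mulmx mulf_neq0.
  by rewrite mU mule1 modulus_diag // => i; rewrite mxE.
by rewrite modulusM // modulus_K // mul1e.
Qed.

Lemma haarG_rinv g : \det g != 0%R -> rinv mu g.
Proof. by move=> dg A mA; rewrite modulusE // modulus1 // mul1e. Qed.

End Modulus.
End Unimodular.

(** * Quotient weights *)

Section Weights.
Variables (R : realType) (F : fieldType) (v : F -> int).
Hypothesis HF : nonarch_local_field v.
Variable n' : nat.
Local Notation n := n'.+1.
Local Notation M := (MXm v n).
Local Open Scope ereal_scope.

Lemma integral_null (mu : {measure set M -> \bar R}) (H : set M) (f : M -> \bar R) :
  measurable H -> mu (~` H) = 0 -> measurable_fun setT f -> (forall t, 0 <= f t) ->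
  \int[mu]_(t in H) f t = \int[mu]_t f t.
Proof.
move=> mH h0 mf f0; rewrite [RHS](@ge0_negligible_integral _ _ _ _ _ (~` H)) //.
  by rewrite setDE setCK setTI.
exact: measurableC.
Qed.

Section Swap.
Variables (mu nu : {measure set M -> \bar R}) (H B : set M) (psi G : M -> R).
Hypothesis hmu : haarG mu.
Hypothesis mu1 : mu (Gi v 0%R) = 1.
Hypothesis snu : sigma_finite setT nu.
Hypothesis mH : measurable H.
Hypothesis HG : H `<=` @Gset F n.
Hypothesis nu0 : nu (~` H) = 0.
Hypothesis hpsi : quot_weight nu psi.
Hypothesis mG : measurable_fun setT G.
Hypothesis G0 : forall g, (0 <= G g)%R.
Hypothesis GH : forall (g t : M), H t -> G ((g : 'M[F]_n) *m (t : 'M[F]_n)) = G g.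
Hypothesis mB : measurable B.
Hypothesis BG : B `<=` @Gset F n.

Let W : set (M * M) := [set z | H z.2 /\ B ((z.1 : 'M[F]_n) *m invmx (z.2 : 'M[F]_n))].

Let mW : measurable W.
Proof.
have -> : W = (snd @^-1` H) `&`
   ((fun z : M * M => (z.1 : 'M[F]_n) *m invmx (z.2 : 'M[F]_n) : M) @^-1` B) by [].
apply: measurableI; rewrite -[X in measurable X]setTI; first exact: measurable_snd.
have mf : measurable_fun setT (fun z : M * M => (z.1 : 'M[F]_n) *m invmx (z.2 : 'M[F]_n) : M).
  apply: (measurable_mulmx_fun HF); first exact: measurable_fst.
  exact: (measurableT_comp (@measurable_invmx _ _ HF n) measurable_snd).
exact: mf.
Qed.

Let mind (A : set M) : measurable A -> measurable_fun setT (\1_A : M -> R).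
Proof. by move=> mA; exact: measurable_indic. Qed.

(** Write the left side as a double integral, replace g by g t using right invariance, and integrate
    psi(g t) over t. No section of G/H is chosen: any measurable B is allowed, its fibres being
    weighed by nu. *)
Lemma weight_swap :
  \int[mu]_g ((G g * psi g)%:E * nu [set t : M | W (g, t)]) = \int[mu]_g (G g * \1_B g)%:E.
Proof.
have [psi0 mpsi psi1] := hpsi; have smu := haarG_sigma_finite HF hmu.
have mGpsi : measurable_fun setT (fun g => G g * psi g)%R by exact: measurable_funM.
have mfst : measurable_fun setT (fst : M * M -> M) by exact: measurable_fst.
have msnd : measurable_fun setT (snd : M * M -> M) by exact: measurable_snd.
pose f (z : M * M) : \bar R := (G z.1 * psi z.1 * \1_W z)%:E.
have mf : measurable_fun setT f.
  apply/measurable_EFinP; apply: measurable_funM; last exact: measurable_indic.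
  exact: (measurableT_comp mGpsi mfst).
have f0 z : 0 <= f z by rewrite lee_fin !mulr_ge0 // indicE.
have mWg g : measurable [set t : M | W (g, t)].
  have -> : [set t : M | W (g, t)] = xsection W g.
    by apply/seteqP; split=> t; rewrite /xsection /= inE.
  exact: measurable_xsection.
transitivity (\int[mu]_g \int[nu]_t f (g, t)).
  apply: eq_integral => g _; rewrite -integral_indicT // -ge0_integralZl //.
    by apply/measurable_EFinP; apply: mind.
  by rewrite lee_fin mulr_ge0.
rewrite tonelli //.
pose k (z : M * M) : \bar R := (G z.1 * \1_B z.1 *
   (psi ((z.1 : 'M[F]_n) *m (z.2 : 'M[F]_n) : M) * \1_H z.2))%:E.
have mpsim : measurable_fun setT (fun z : M * M => psi ((z.1 : 'M[F]_n) *m (z.2 : 'M[F]_n) : M)).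
  exact: (measurableT_comp mpsi (@measurable_mulmx _ _ HF n)).
have mk : measurable_fun setT k.
  apply/measurable_EFinP; apply: measurable_funM.
    apply: measurable_funM; first exact: (measurableT_comp mG mfst).
    exact: (measurableT_comp (mind mB) mfst).
  by apply: measurable_funM => //; exact: (measurableT_comp (mind mH) msnd).
have k0 z : 0 <= k z by rewrite lee_fin !mulr_ge0 // indicE.
transitivity (\int[nu]_t \int[mu]_g k (g, t)).
  apply: eq_integral => t _; have [Ht|Ht] := pselect (H t); last first.
    rewrite !integral0_eq // => g _; rewrite /k /f /= !indicE.
      by rewrite [t \in H]memNset // !mulr0.
    by rewrite [_ \in W]memNset ?mulr0 //= => -[].
  have dt : \det (t : 'M[F]_n) != 0%R by exact: HG.
  pose q (g : M) : \bar R := (G g * psi g * \1_B ((g : 'M[F]_n) *m invmx (t : 'M[F]_n) : M))%:E.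
  have e g : f (g, t) = q g.
    rewrite /f /q !indicE /=; congr (_ * _%:R)%:E; congr nat_of_bool.
    by apply/asbool_equiv_eq; split=> [[]|].
  under eq_integral => g _ do rewrite e.
  transitivity (\int[mu]_g q ((g : 'M[F]_n) *m (t : 'M[F]_n))).
    rewrite (rinv_integral HF (haarG_rinv HF hmu mu1 dt)) //.
      apply/measurable_EFinP; apply: measurable_funM => //.
      exact: (measurableT_comp (mind mB) (measurable_rmul HF (invmx (t : 'M[F]_n)))).
    by move=> g; rewrite lee_fin !mulr_ge0 // indicE.
  apply: eq_integral => g _; rewrite /q /k /= GH // mulmxK ?det_unit //.
  by rewrite [\1_H t]indicE mem_set // mulr1 mulrAC.
rewrite -tonelli //; apply: eq_integral => g _.
have mpg : measurable_fun setT (fun t : M => psi ((g : 'M[F]_n) *m (t : 'M[F]_n) : M)).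
  exact: (measurableT_comp mpsi (measurable_lmul HF (g : 'M[F]_n))).
transitivity ((G g * \1_B g)%:E * \int[nu]_t (psi ((g : 'M[F]_n) *m (t : 'M[F]_n) : M) * \1_H t)%:E).
  rewrite -ge0_integralZl //.
  - by apply/measurable_EFinP; apply: measurable_funM => //; apply: mind.
  - by move=> t _; rewrite lee_fin mulr_ge0 // indicE.
  - by rewrite lee_fin mulr_ge0 // indicE.
have [Bg|Bg] := pselect (B g); last by rewrite [\1_B g]indicE memNset // mulr0 mul0e.
rewrite -[RHS]mule1 -(psi1 g); last exact: BG.
congr (_ * _); rewrite -(integral_null mH nu0) //.
- rewrite -[RHS](integral_null mH nu0) //; last by move=> t; rewrite lee_fin.
    by apply: eq_integral => t; rewrite inE => Ht; rewrite indicE mem_set // mulr1.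
  exact/measurable_EFinP.
- by apply/measurable_EFinP; apply: measurable_funM => //; apply: mind.
- by move=> t; rewrite lee_fin mulr_ge0 // indicE.
Qed.

Lemma measurable_weight : measurable_fun setT (fun g : M => nu [set t : M | W (g, t)]).
Proof.
have -> : (fun g : M => nu [set t : M | W (g, t)]) = sigma_finite_pack snu \o xsection W.
  by apply/funext => g; congr (nu _); apply/seteqP; split=> t; rewrite /xsection /= inE.
exact: measurable_fun_xsection.
Qed.

End Swap.
End Weights.

Lemma divz_window (D b : int) (k : nat) :
  0 <= D - b * k.+1%:Z < k.+1%:Z <-> divz D k.+1%:Z = b.
Proof.
have := divz_eq D k.+1%:Z; have := @modz_ge0 D k.+1%:Z isT; have := @ltz_pmod D k.+1%:Z isT.
move: (divz _ _) (modz _ _) => q r h1 h2 h3; split=> [h|<-]; last by lia.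
nia.
Qed.

(** * Cosets of a compact open subgroup, distinguished by countable labels *)

Section CosetLabels.
Variables (R : realType) (F : fieldType) (v : F -> int).
Hypothesis HF : nonarch_local_field v.
Variable n' : nat.
Local Notation n := n'.+1.
Local Notation M := (MXm v n).
Variables (nu : {measure set M -> \bar R}) (H K : set M) (I : countType) (lab : M -> I).
Hypothesis hnu : haar_for H K nu.
Hypothesis HG : H `<=` @Gset F n.
Hypothesis Hinv : forall t : M, H t -> H (invmx (t : 'M[F]_n)).
Hypothesis mH : measurable H.
Hypothesis mK : measurable K.
Hypothesis hlab : forall s t : M, H s -> H t -> lab s = lab t ->
  K (invmx (s : 'M[F]_n) *m (t : 'M[F]_n)).
Local Open Scope ereal_scope.

Lemma coset_measure (s : M) : H s -> nu [set t : M | K (invmx (s : 'M[F]_n) *m (t : 'M[F]_n))] = 1.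
Proof.
move=> Hs; have ds : \det (s : 'M[F]_n) != 0%R by exact: HG.
have [_ _ <-] := hnu.
exact: (haar_linv HF hnu (det_invmx_neq0 ds) (Hinv Hs)).
Qed.

Lemma label_cover (l : I) : exists V, [/\ measurable V, nu V <= 1 &
  [set t | H t /\ lab t = l] `<=` V].
Proof.
have [[s [Hs sl]]|no] := pselect (exists s, H s /\ lab s = l); last first.
  by exists set0; split; rewrite ?measure0 // => t [Ht tl]; apply: no; exists t.
exists [set t : M | K (invmx (s : 'M[F]_n) *m (t : 'M[F]_n))]; split.
- exact: measurable_lpre.
- by rewrite coset_measure.
- by move=> t [Ht tl]; apply: hlab => //; rewrite sl.
Qed.

Lemma label_sigma_finite : sigma_finite setT nu.
Proof.
have /choice[V hV] := label_cover; have [nu0 _ _] := hnu.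
exists (fun i => ~` H `|` (if @unpickle I i is Some l then V l else set0)).
  apply/seteqP; split=> // t _; have [Ht|Ht] := pselect (H t); last by exists 0%N => //; left.
  by exists (pickle (lab t)) => //; right; rewrite pickleK; have [_ _] := hV (lab t); apply.
move=> i; have mV : measurable (if @unpickle I i is Some l then V l else set0).
  by case: unpickle => // l; have [] := hV l.
split; first by apply: measurableU => //; apply: measurableC.
apply: le_lt_trans (measureU2 _ (measurableC mH) mV) _; apply: lte_add_pinfty.
  by apply: (@le_lt_trans _ _ 0); [rewrite le_eqVlt; apply/orP; left; apply/eqP|exact: ltry].
case: unpickle => [l|]; last by rewrite measure0 ltry.
by have [_ h _] := hV l; apply: le_lt_trans h _; rewrite ltry.
Qed.

Lemma label_count (L : seq I) (A : set M) : measurable A -> A `<=` H ->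
  (forall t, A t -> lab t \in L) -> nu A <= (size L)%:R%:E.
Proof.
move=> mA AH AL.
have [V [mV hV sV]] : exists V, [/\ measurable V, nu V <= (size L)%:R%:E &
    [set t | H t /\ lab t \in L] `<=` V].
  elim: (L) => [|l L' [V [mV hV sV]]].
    by exists set0; rewrite measure0; split=> // t [].
  have [V' [mV' hV' sV']] := label_cover l.
  exists (V' `|` V); split; first exact: measurableU.
    by apply: le_trans (measureU2 _ mV' mV) _; rewrite /= -nat1r EFinD leeD.
  move=> t [Ht]; rewrite in_cons => /orP[/eqP tl|tL]; first by left; apply: sV'.
  by right; apply: sV.
apply: le_trans hV; apply: le_measure; rewrite ?inE // => t At.
by apply: sV; split; [exact: AH|exact: AL].
Qed.

End CosetLabels.

Section QuotientIntegrals.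
Variables (R : realType) (F : fieldType) (v : F -> int).
Hypothesis HF : nonarch_local_field v.
Variable n' : nat.
Local Notation n := n'.+1.
Local Notation mge := (mge v).
Local Notation pw := (pw HF).
Local Notation M := (MXm v n).
Local Open Scope ereal_scope.

Lemma measurable_kernel (L : 'M[F]_n -> 'M[F]_n) (c : int) :
  (forall A B, L (A + B)%R = (L A + L B)%R) -> (forall k A, mge k A -> mge (k + c) (L A)) ->
  measurable [set g : M | L g = 0%R].
Proof.
move=> LD Lc; rewrite -[X in measurable X]setCK; apply: measurableC.
apply: (open_measurable HF) => g /eqP /(mge_nz v)[k0 hk0].
exists (k0 + 1 - c)%R => h /mballE hh h0.
have := Lc _ _ hh; rewrite subrK => h1.
have : mge (k0 + 1) (L g).
  have e : L h = (L g + L (h - g))%R by rewrite -LD addrC subrK.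
  have -> : L g = (- L (h - g))%R by apply/eqP; rewrite -addr_eq0 -e h0.
  by apply/(mgeN HF).
by rewrite hk0; lia.
Qed.

Lemma measurable_centralizer (x : 'M[F]_n) : measurable (centralizer x : set M).
Proof.
have [c hc] := mge_ex v x.
rewrite (_ : centralizer x = @Gset F n `&` [set g : M | (g : 'M[F]_n) *m x - x *m (g : 'M[F]_n) = 0]%R).
  apply: measurableI; first exact: (@measurable_Gset _ _ HF n).
  apply: (@measurable_kernel (fun g => g *m x - x *m g)%R c) => [A B|k A hA].
    by rewrite mulmxDl mulmxDr opprD addrACA.
  by apply: (mgeB HF); [exact: (mgeM HF)|rewrite addrC; exact: (mgeM HF)].
apply/seteqP; split=> g [h1 h2]; split=> //; first by rewrite /= h2 subrr.
by apply/eqP; rewrite -subr_eq0; apply/eqP.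
Qed.

Lemma measurable_Zset : measurable (@Zset F n : set M).
Proof.
rewrite (_ : Zset = @Gset F n `&` [set g : M | (g : 'M[F]_n) - ((g : 'M[F]_n) ord0 ord0)%:M = 0]%R).
  apply: measurableI; first exact: (@measurable_Gset _ _ HF n).
  apply: (@measurable_kernel (fun g => g - (g ord0 ord0)%:M)%R 0) => [A B|k A hA].
    by rewrite mxE raddfD opprD addrACA.
  by rewrite addr0; apply: (mgeB HF) => //; apply: mge_scal.
apply/seteqP; split=> g.
  move=> [a [a0 ->]]; split; first by rewrite /Gset /= det_scalar expf_neq0.
  by rewrite /= !mxE mulr1n subrr.
move=> [dg /= /eqP]; rewrite subr_eq0 => /eqP e; exists ((g : 'M[F]_n) ord0 ord0); split=> //.
by apply: contraNneq dg => h; rewrite e h det_scalar expr0n.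
Qed.

Lemma val_scalar (a : F) : a != 0%R -> v (\det (a%:M : 'M[F]_n)) = (v a *+ n)%R.
Proof. by move=> a0; rewrite det_scalar (valX HF n a0). Qed.

Lemma ZcptE : @Zcpt F v n = Zset `&` Gi v 0%R.
Proof.
apply/seteqP; split=> g.
  move=> [a [a0 [va ->]]]; split; first by exists a.
  apply/(KP HF); rewrite val_scalar // va mul0rn det_scalar expf_neq0 //; split=> //.
  by apply: mge_scal; rewrite vgeP // va.
move=> [[a [a0 ->]]] /(KP HF)[_ _]; rewrite val_scalar // => /eqP.
by rewrite mulrn_eq0 => /eqP va; exists a.
Qed.

Lemma measurable_Zcpt : measurable (@Zcpt F v n : set M).
Proof. by rewrite ZcptE; apply: measurableI; [exact: measurable_Zset|exact: measurable_K]. Qed.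

Lemma Zset_inv (t : M) : @Zset F n t -> @Zset F n (invmx (t : 'M[F]_n)).
Proof.
by move=> [a [a0 ->]]; exists a^-1%R; rewrite invr_neq0 // invmx_scalar.
Qed.

Lemma ZsetG : @Zset F n `<=` @Gset F n.
Proof. by move=> g [a [a0 ->]]; rewrite /Gset /= det_scalar expf_neq0. Qed.

Lemma Z_label (s t : M) : @Zset F n s -> @Zset F n t ->
  v (\det (s : 'M[F]_n)) = v (\det (t : 'M[F]_n)) -> @Zcpt F v n (invmx (s : 'M[F]_n) *m (t : 'M[F]_n)).
Proof.
move=> [a [a0 ->]] [b [b0 ->]]; rewrite !val_scalar // => /eqP; rewrite -subr_eq0 -mulrnBl mulrn_eq0 /= subr_eq0 => /eqP e.
exists (a^-1 * b)%R; rewrite mulf_neq0 ?invr_neq0 // (valM HF) ?invr_neq0 // (valV HF) // e addNr.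
by rewrite invmx_scalar -scalar_mxM.
Qed.

(** A scalar of valuation k shifts the valuation of the determinant by n k, so the scalars that
    bring g into this set form one coset of [Zcpt]. *)
Definition fundZ : set M := [set g : M | \det (g : 'M[F]_n) != 0%R /\
  (0 <= v (\det (g : 'M[F]_n)) < n%:Z)%R].

Lemma measurable_fundZ : measurable fundZ.
Proof.
apply: (open_measurable HF).
exact: (@open_val_det F v HF n (fun z => 0 <= z < n%:Z)%R).
Qed.

Variable mu : {measure set M -> \bar R}.
Hypothesis hmu : haarG mu.
Hypothesis mu1 : mu (Gi v 0%R) = 1.

Lemma integral_Gset (f : M -> \bar R) : measurable_fun setT f -> (forall t, 0 <= f t) ->
  \int[mu]_(t in @Gset F n) f t = \int[mu]_t f t.
Proof. exact: (integral_null (@measurable_Gset _ _ HF n) (hG_null hmu)). Qed.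

Lemma Z_unfold (nu : {measure set M -> \bar R}) (psi G : M -> R) :
  haar_for Zset (@Zcpt F v n) nu -> quot_weight nu psi ->
  measurable_fun setT G -> (forall g, 0 <= G g)%R ->
  (forall (g t : M), @Zset F n t -> G ((g : 'M[F]_n) *m (t : 'M[F]_n)) = G g) ->
  \int[mu]_g (G g * psi g)%:E = \int[mu]_g (G g * \1_fundZ g)%:E.
Proof.
move=> hnu hpsi mG G0 GZ; have [nu0 _ _] := hnu; have [psi0 mpsi _] := hpsi.
have fG : fundZ `<=` @Gset F n by move=> g [].
have snu := label_sigma_finite HF hnu ZsetG Zset_inv measurable_Zset measurable_Zcpt Z_label.
rewrite -(weight_swap HF hmu mu1 snu measurable_Zset ZsetG nu0 hpsi mG G0 GZ measurable_fundZ fG).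
have mGpsi : measurable_fun setT (fun g : M => (G g * psi g)%:E).
  by apply/measurable_EFinP; exact: measurable_funM.
have W1 (g : M) : @Gset F n g ->
    nu [set t : M | @Zset F n t /\ fundZ ((g : 'M[F]_n) *m invmx (t : 'M[F]_n))] = 1.
  (* The scalars t with g t^-1 in [fundZ] form the coset of pw q, of mass 1. *)
  move=> dg; pose q := divz (v (\det (g : 'M[F]_n))) n%:Z.
  have Zs : @Zset F n (pw q)%:M by exists (pw q); rewrite pw_neq0.
  rewrite -(coset_measure HF hnu ZsetG Zset_inv measurable_Zcpt Zs); congr (nu _).
  apply/seteqP; split=> t /=.
    move=> [Zt [_ hv]]; apply: Z_label => //; have [b [b0 e]] := Zt.
    have dt : \det (t : 'M[F]_n) != 0%R by exact: ZsetG.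
    move: hv; rewrite val_detM ?det_invmx_neq0 // (val_detV HF) // e !val_scalar // ?pw_neq0 //.
    rewrite val_pw -[(v b *+ n)%R]mulr_natr -[(q *+ n)%R]mulr_natr !natz => hv.
    by congr (_ * _)%R; apply/divz_window.
  move=> [b [b0 [vb]]] /(congr1 (mulmx (pw q)%:M)).
  have uq : ((pw q)%:M : 'M[F]_n) \in unitmx by rewrite det_unit; apply: ZsetG Zs.
  rewrite mulKVmx // -scalar_mxM => et.
  have p0 := pw_neq0 HF q.
  have Zt : @Zset F n t by exists (pw q * b)%R; rewrite mulf_neq0.
  have dt : \det (t : 'M[F]_n) != 0%R by exact: ZsetG.
  split=> //; split; first by rewrite det_mulmx mulf_neq0 // det_invmx_neq0.
  rewrite val_detM ?det_invmx_neq0 // (val_detV HF) // et val_scalar ?mulf_neq0 // (valM HF) // vb addr0 val_pw.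
  by rewrite -[(q *+ n)%R]mulr_natr natz; apply/divz_window.
rewrite -integral_Gset //; last by move=> g; rewrite lee_fin mulr_ge0.
rewrite integral_mkcond; apply: eq_integral => g _; rewrite patchE.
case: ifPn => [|/negP h]; first by rewrite inE => /W1 ->; rewrite mule1.
rewrite (_ : [set t : M | _] = set0) ?measure0 ?mule0 //; apply/seteqP; split=> // t [_ [dt _]].
apply: h; rewrite inE /Gset /=; apply: contraNneq dt; rewrite det_mulmx => ->.
by rewrite mul0r.
Qed.

End QuotientIntegrals.

Section TorusWeight.
Variables (R : realType) (F : fieldType) (v : F -> int).
Hypothesis HF : nonarch_local_field v.
Variable n' : nat.
Local Notation n := n'.+1.
Local Notation mge := (mge v).
Local Notation M := (MXm v n).
Variables (x : 'M[F]_n) (r : nat) (e : 'I_r -> 'M[F]_n) (v0 : 'cV[F]_n).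
Hypothesis sd : split_data x e v0.
Local Notation compl a s := (s + (1 - e a))%R.
Local Open Scope ereal_scope.

(** The orders of the block norms, coordinates on G_x modulo its maximal compact subgroup. *)
Definition torus_label (t : M) : {ffun 'I_r -> int} :=
  [ffun a => v (\det (compl a ((t : 'M[F]_n) * e a)%R))].

Lemma centralizer_inv (t : M) : centralizer x t -> centralizer x (invmx (t : 'M[F]_n)).
Proof. by move=> [dt ct]; split; [exact: det_invmx_neq0|exact: cx_inv]. Qed.

Lemma centralizerG : centralizer x `<=` @Gset F n. Proof. by move=> t []. Qed.

Lemma torus_label_div (s t : M) a : centralizer x s -> centralizer x t ->
  v (\det (compl a ((invmx (s : 'M[F]_n) *m (t : 'M[F]_n)) * e a)%R)) =
  (torus_label t a - torus_label s a)%R.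
Proof.
move=> cs ct; have [di ci] := centralizer_inv cs; have [ds cs'] := cs; have [dt ct'] := ct.
have [h1 h2] := factor_part sd a ci; have [h3 h4] := factor_part sd a ct'.
have := val_factorM HF sd h1 h3 h2 h4 (factor_part_nz sd a di) (factor_part_nz sd a dt).
rewrite -mulrA (mulrA (e a)) -(sd_comm sd ct' (sd_idx sd a)) -mulrA (sd_idem sd) mulrA => ->.
by rewrite (val_part_inv HF sd a cs' ds) !ffunE addrC.
Qed.

Lemma torus_label_eq (s t : M) : centralizer x s -> centralizer x t ->
  torus_label s = torus_label t -> maxcpt v x (invmx (s : 'M[F]_n) *m (t : 'M[F]_n)).
Proof.
move=> cs ct st; apply/(maxcptP HF sd); split.
  have [di ci] := centralizer_inv cs; have [dt ct'] := ct.
  by split; [rewrite det_mulmx mulf_neq0|exact: (cx_mul ci ct')].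
by move=> a; rewrite torus_label_div // st subrr.
Qed.

Lemma measurable_maxcpt : measurable (maxcpt v x : set M).
Proof.
rewrite (_ : maxcpt v x = centralizer x `&` \bigcap_(a in [set: 'I_r])
   [set t : M | \det (compl a ((t : 'M[F]_n) * e a)%R) != 0%R /\
                v (\det (compl a ((t : 'M[F]_n) * e a)%R)) = 0%R]).
  apply: measurableI; first exact: measurable_centralizer.
  apply: fin_bigcap_measurable; first exact: finite_finset.
  move=> a _; apply: (open_measurable HF) => t [dt vt].
  have [k hk] := val_det_near HF dt; have [c hc] := mge_ex v (e a).
  exists (k - c)%R => s /mballE hs.
  have [|d1 d2] := hk (compl a ((s : 'M[F]_n) * e a)%R).
    apply/mballE; rewrite opprD addrACA subrr addr0 -mulrBl.
    by rewrite -[k](subrK c); exact: (mgeM HF).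
  by split; rewrite // d2.
apply/seteqP; split=> t.
  move=> /(maxcptP HF sd)[[dt ct] h]; split=> // a _; split=> //.
  by have [] := det_parts HF sd ct dt.
by move=> [ct h]; apply/(maxcptP HF sd); split=> // a; have [] := h a I.
Qed.

Variables (mu nu : {measure set M -> \bar R}).
Hypothesis hmu : haarG mu.
Hypothesis mu1 : mu (Gi v 0%R) = 1.
Hypothesis hnu : haar_for (centralizer x) (maxcpt v x) nu.

(** For s and t in the fibre, commutativity gives s^-1 t = (g t^-1)^-1 (g s^-1), of valuation at
    least - (n b + n). Completing a block costs H and the determinant multiplies by n. So each of
    the r <= n labels stays within D of that of a fixed t0, leaving 2D + 1 values. *)
Lemma torus_count (g : M) (H b : nat) (B : set M) : @tame _ v _ x H 1%:M -> measurable B ->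
  (forall y : M, B y -> [/\ \det (y : 'M[F]_n) != 0%R, mge (- b%:Z) (y : 'M[F]_n),
     (0 <= v (\det (y : 'M[F]_n)))%R & (v (\det (y : 'M[F]_n)) <= n%:Z)%R]) ->
  nu [set t : M | centralizer x t /\ B ((g : 'M[F]_n) *m invmx (t : 'M[F]_n))] <=
  ((n * (n * b + n + H)).*2.+1 ^ n)%:R%:E.
Proof.
move=> /tame1P h1 mB hB; set D := (n * _)%N; set A := [set t : M | _].
have mA : measurable A.
  apply: measurableI; first exact: measurable_centralizer.
  rewrite -[X in measurable X]setTI.
  exact: (measurableT_comp (measurable_lmul HF (g : 'M[F]_n)) (@measurable_invmx _ _ HF n)).
have [[t0 [ct0 Bt0]]|no] := pselect (exists t, A t); last first.
  by rewrite (_ : A = set0) ?measure0 ?lee_fin //; apply/seteqP; split=> // t At; apply: no; exists t.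
have low (s t : M) a : A s -> A t -> (- D%:Z <= torus_label t a - torus_label s a)%R.
  move=> [cs Bs] [ct Bt]; rewrite -torus_label_div //.
  have [ds _] := cs; have [dt ct'] := ct; have [di ci] := centralizer_inv cs.
  have [d1 m1 l1 u1] := hB _ Bs; have [d2 m2 l2 u2] := hB _ Bt.
  have dg : \det (g : 'M[F]_n) != 0%R.
    by apply: contraNneq d1; rewrite det_mulmx => ->; rewrite mul0r.
  have ug : (g : 'M[F]_n) \in unitmx by rewrite det_unit.
  have ut : (t : 'M[F]_n) \in unitmx by rewrite det_unit.
  have eq : invmx (s : 'M[F]_n) *m (t : 'M[F]_n) =
     invmx ((g : 'M[F]_n) *m invmx (t : 'M[F]_n)) *m ((g : 'M[F]_n) *m invmx (s : 'M[F]_n)).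
    have ugt : (g : 'M[F]_n) *m invmx (t : 'M[F]_n) \in unitmx by rewrite unitmx_mul ug unitmx_inv.
    apply: (can_inj (mulKmx ugt)); rewrite mulKVmx // -mulmxA; congr (_ *m _).
    have cc : (invmx (s : 'M[F]_n) *m (t : 'M[F]_n) = t *m invmx (s : 'M[F]_n))%R := sd_comm sd ci ct'.
    by rewrite cc mulKmx.
  have m3 : mge (- (n * b + n)%N%:Z) (invmx (s : 'M[F]_n) *m (t : 'M[F]_n)).
    rewrite eq; apply: mgeW (mgeM HF (mge_inv HF d2 m2) m1).
    by rewrite -[((- b%:Z) *+ _)%R]mulr_natr natz; move: u2; move: (v _) => V; rewrite /=; nia.
  have hea : mge (- H%:Z) (e a) by apply: h1; [exact: (sd_idx sd)|exact: (pb_idem HF (sd_idem sd a))].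
  have ha0 : mge 0 (1 : 'M[F]_n) by exact: mge1.
  have ha1 : mge (- H%:Z) (1 - e a)%R.
    by apply: (mgeB HF) => //; apply: mgeW ha0; lia.
  set w := (invmx (s : 'M[F]_n) *m (t : 'M[F]_n)) in m3 *.
  have m4 : mge (- (n * b + n + H)%N%:Z) (compl a (w * e a)%R).
    apply: (mgeD HF); last by apply: mgeW ha1; lia.
    by apply: mgeW (mgeM HF m3 hea); lia.
  have cw : GRing.comm w x by exact: cx_mul.
  have dw : \det w != 0%R by rewrite det_mulmx mulf_neq0.
  have [nz _] := det_parts HF sd cw dw.
  have := vge_det HF m4; rewrite vgeP //.
  by rewrite -[((- _) *+ _)%R]mulr_natr natz /D; move: (v _) => V; lia.
pose lab (f : {ffun 'I_r -> 'I_(D.*2.+1)}) : {ffun 'I_r -> int} :=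
  [ffun a => (torus_label t0 a + (f a : nat)%:Z - D%:Z)%R].
pose L := [seq lab f | f <- enum {: {ffun 'I_r -> 'I_(D.*2.+1)}}].
apply: (@le_trans _ _ (size L)%:R%:E).
  apply: (label_count HF hnu centralizerG centralizer_inv measurable_maxcpt torus_label_eq) => //.
    by move=> t [].
  move=> t At; apply/mapP; exists [ffun a => inord (absz (torus_label t a - torus_label t0 a + D%:Z)%R)].
    by rewrite mem_enum.
  have At0 : A t0 by [].
  apply/ffunP => a.
  have := low _ _ a At0 At; have := low _ _ a At At0.
  have -> (f : {ffun 'I_r -> 'I_(D.*2.+1)}) : lab f a = (torus_label t0 a + (f a : nat)%:Z - D%:Z)%R.
    by rewrite /lab ffunE.
  have -> (k : 'I_r -> 'I_(D.*2.+1)) : finfun k a = k a by rewrite ffunE.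
  move: (torus_label t a) (torus_label t0 a) => V1 V2 l1 l2; rewrite inordK; lia.
rewrite lee_fin ler_nat size_map -cardE card_ffun !card_ord leq_pexp2l //.
exact: sd_card sd.
Qed.

(** [weight_swap] for the centralizer, with the fibre masses bounded by [torus_count]. *)
Lemma torus_fold (psi G : M -> R) (H b : nat) (B : set M) : quot_weight nu psi ->
  measurable_fun setT G -> (forall g, 0 <= G g)%R ->
  (forall (g t : M), centralizer x t -> G ((g : 'M[F]_n) *m (t : 'M[F]_n)) = G g) ->
  @tame _ v _ x H 1%:M -> measurable B ->
  (forall y : M, B y -> [/\ \det (y : 'M[F]_n) != 0%R, mge (- b%:Z) (y : 'M[F]_n),
     (0 <= v (\det (y : 'M[F]_n)))%R & (v (\det (y : 'M[F]_n)) <= n%:Z)%R]) ->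
  \int[mu]_g (G g * \1_B g)%:E <=
  ((n * (n * b + n + H)).*2.+1 ^ n)%:R%:E * \int[mu]_(g in @Gset F n) (G g * psi g)%:E.
Proof.
move=> hpsi mG G0 GT h1 mB hB; have [nu0 _ _] := hnu; have [psi0 mpsi _] := hpsi.
have BG : B `<=` @Gset F n by move=> y /hB[].
have mT := measurable_centralizer HF x.
have snu := label_sigma_finite HF hnu centralizerG centralizer_inv mT measurable_maxcpt torus_label_eq.
have mGpsi : measurable_fun setT (fun g : M => (G g * psi g)%:E).
  by apply/measurable_EFinP; exact: measurable_funM.
have Gpsi0 (g : M) : 0 <= (G g * psi g)%:E by rewrite lee_fin mulr_ge0.
rewrite (integral_Gset HF hmu) // -(weight_swap HF hmu mu1 snu mT centralizerG nu0 hpsi mG G0 GT mB BG).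
rewrite muleC -ge0_integralZr //; apply: ge0_le_integral => //.
- by move=> g _; rewrite mule_ge0.
- by apply: emeasurable_funM => //; exact: (measurable_weight HF snu mT mB).
- by apply: emeasurable_funM => //; exact: measurable_cst.
- by move=> g _; apply: lee_wpmul2l => //; exact: torus_count.
Qed.

End TorusWeight.

(** * Vanishing along unipotent orbits *)

Section UnipotentPart.
Variables (F : fieldType) (v : F -> int).
Hypothesis HF : nonarch_local_field v.
Variable n' : nat.
Local Notation n := n'.+1.
Local Notation mge := (mge v).
Local Notation M := (MXm v n).
Local Notation mball := (mball v).
Variable E : 'M[F]_n.
Hypothesis EE : E * E = E.
Implicit Types (k N : 'M[F]_n).

(** The lower right block of k with respect to E and 1 - E, completed by the identity. Left
    multiplication by U does not change it. *)
Definition levi_part k : 'M[F]_n := E + (1 - E) * k * (1 - E).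

(* On the cell where [levi_part k] is invertible, k = unip_part k * k' with
   E k' (1 - E) = 0; this factorization is equivariant under U. *)
Definition unip_part k : 'M[F]_n := 1 + E * k * (1 - E) * invmx (levi_part k).

Lemma idemC : (1 - E) * E = 0 /\ E * (1 - E) = 0.
Proof. by rewrite mulrBl mulrBr mul1r mulr1 EE subrr. Qed.

Lemma levi_inv k : \det (levi_part k) != 0 -> invmx (levi_part k) * E = E.
Proof.
rewrite -det_unit => u; have h : levi_part k * E = E.
  by rewrite mulrDl EE -!mulrA; have [-> _] := idemC; rewrite !mulr0 addr0.
by rewrite -{1}h; exact: mulKmx.
Qed.

Lemma unip_part_nilp k : \det (levi_part k) != 0 ->
  nilp E (E * k * (1 - E) * invmx (levi_part k)).
Proof.
move=> d; apply: nilpP; first by rewrite !mulrA EE.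
by rewrite -!mulrA levi_inv //; have [-> _] := idemC; rewrite !mulr0.
Qed.

Lemma levi_part_unip k N : nilp E N -> levi_part ((1 + N) * k) = levi_part k.
Proof.
move=> hN; have e : (1 - E) * N = 0.
  by rewrite -(nilp_l EE hN) mulrA; have [-> _] := idemC; rewrite mul0r.
by rewrite /levi_part [_ * (_ * k)]mulrA (mulrDr (1 - E)) e addr0 mulr1.
Qed.

Lemma unip_part_mul k N : \det (levi_part k) != 0 -> nilp E N ->
  unip_part ((1 + N) * k) = (1 + N) * unip_part k.
Proof.
move=> d hN; rewrite /unip_part levi_part_unip // (unipM EE) //; last exact: unip_part_nilp.
have u : levi_part k \in unitmx by rewrite det_unit.
have e1 : N * k * (1 - E) = N * levi_part k.
  rewrite /levi_part (mulrDr N) (nilp_r EE hN) add0r !mulrA.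
  by rewrite [N * (1 - E)]mulrBr mulr1 (nilp_r EE hN) subr0.
have -> : E * ((1 + N) * k) = E * k + N * k.
  by rewrite (mulrDl 1) mul1r mulrDr mulrA (nilp_l EE hN).
rewrite mulrDl e1 mulrDl; congr (_ + _); rewrite addrC; congr (_ + _).
exact: mulmxK.
Qed.

Lemma unip_part_near1 (l : int) : exists j, forall k, mball 1 j k ->
  \det (levi_part k) != 0 /\ mge l (unip_part k - 1).
Proof.
have [c hc] := mge_exN v E; have h1 : mge 0 (1 : 'M[F]_n) by exact: mge1.
have hc' : mge (- c%:Z) (1 - E) by apply: (mgeB HF) => //; apply: mgeW h1; lia.
exists (`|l| + 1 + c%:Z + c%:Z) => k /mballE hk.
have eD : levi_part k = 1 + (1 - E) * (k - 1) * (1 - E).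
  have CE : (1 - E) * (1 - E) = 1 - E.
    by rewrite mulrBl mul1r; have [_ ->] := idemC; rewrite subr0.
  rewrite /levi_part (mulrBr (1 - E) k 1) mulr1 (mulrBl (1 - E) _ (1 - E)) CE opprB.
  by rewrite [RHS]addrCA [1 + (E - 1)]addrC subrK addrC.
have hX : mge (`|l| + 1) ((1 - E) * (k - 1) * (1 - E)).
  by apply: mgeW (mgeM HF (mgeM HF hc' hk) hc'); lia.
have [d1 _] : \det (levi_part k) != 0 /\ v (\det (levi_part k)) = 0.
  by rewrite eD; apply: (cong_det HF); apply: mgeW hX; lia.
split=> //; rewrite /unip_part addrAC subrr add0r.
have [|Y hY eY] := cong_inv HF (_ : 1 <= `|l| + 1) hX; first by lia.
have hi : mge 0 (invmx (levi_part k)).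
  by rewrite eD eY; apply: (mgeD HF) => //; apply: mgeW hY; lia.
have -> : E * k * (1 - E) = E * (k - 1) * (1 - E).
  by rewrite (mulrBr E) mulr1 mulrBl; have [_ ->] := idemC; rewrite subr0.
by apply: mgeW (mgeM HF (mgeM HF (mgeM HF hc hk) hc') hi); lia.
Qed.

Lemma measurable_translate (A : 'M[F]_n) : measurable_fun setT (fun k : M => A + (k : 'M[F]_n) : M).
Proof.
apply: measurable_to_mx => a l; rewrite (_ : _ @^-1` _ = mball (a - A) l); first exact: ball_measurable.
apply/seteqP; split=> k /mballE h; apply/mballE; move: h.
  by rewrite opprB addrA [_ + A]addrC.
by rewrite opprB addrA [_ + A]addrC.
Qed.

Lemma measurable_levi_part : measurable_fun setT (fun k : M => levi_part k : M).
Proof.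
apply: (measurableT_comp (measurable_translate E)).
exact: (measurableT_comp (measurable_rmul HF _) (measurable_lmul HF _)).
Qed.

Lemma measurable_unip_part : measurable_fun setT (fun k : M => unip_part k : M).
Proof.
apply: (measurableT_comp (measurable_translate 1)).
apply: (measurable_mulmx_fun HF).
  exact: (measurableT_comp (measurable_rmul HF _) (measurable_lmul HF _)).
exact: (measurableT_comp (@measurable_invmx _ _ HF n) measurable_levi_part).
Qed.

End UnipotentPart.

(** * The commutator map u -> u x u^-1 x^-1 on U, in the coordinate N = u - 1 *)

Section UnipotentConjugation.
Variables (F : fieldType) (v : F -> int).
Hypothesis HF : nonarch_local_field v.
Variable n' : nat.
Local Notation n := n'.+1.
Local Notation mge := (mge v).
Variables (x E : 'M[F]_n).
Hypothesis EE : E * E = E.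
Hypothesis dx : \det x != 0.
Hypothesis Ex : GRing.comm E x.
Hypothesis cE : forall s, GRing.comm s x -> GRing.comm s E.
Implicit Types N : 'M[F]_n.

Definition commx N : 'M[F]_n := N - x * N * invmx x.

Let ux : x \in unitmx. Proof. by rewrite det_unit. Qed.

Let xV : x * invmx x = 1. Proof. exact: mulmxV. Qed.

Let Vx : invmx x * x = 1. Proof. exact: mulVmx. Qed.

Lemma conjx_nilp N : nilp E N -> nilp E (x * N * invmx x).
Proof.
move=> hN; have Ei : E * invmx x = invmx x * E.
  by apply: (commrV (y := x)).
apply: nilpP.
  by rewrite !mulrA Ex -(mulrA x) (nilp_l EE hN).
by rewrite -mulrA -Ei !mulrA -(mulrA x) (nilp_r EE hN) mulr0 mul0r.
Qed.

Lemma commx_nilp N : nilp E N -> nilp E (commx N).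
Proof. by move=> hN; apply: nilpD => //; apply: nilpN; apply: conjx_nilp. Qed.

Lemma commxD N N' : commx (N + N') = commx N + commx N'.
Proof. by rewrite /commx mulrDr mulrDl opprD addrACA. Qed.

Lemma unip_commutator N : nilp E N ->
  (1 + N) * x * invmx (1 + N) * invmx x = 1 + commx N.
Proof.
move=> hN; rewrite (unip_inv EE hN) -!mulrA.
have -> : x * ((1 - N) * invmx x) = 1 - x * N * invmx x.
  by rewrite mulrBl mul1r mulrBr xV mulrA.
by rewrite (unipM EE) //; apply: nilpN; apply: conjx_nilp.
Qed.

(** Such an N commutes with x, hence with E, so N = E N = N E = 0. Regularity of x enters through
    [cE]. *)
Lemma commx_inj N : nilp E N -> commx N = 0 -> N = 0.
Proof.
move=> hN /eqP; rewrite subr_eq0 => /eqP h.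
have cN : GRing.comm N x.
  by rewrite /GRing.comm {1}h -mulrA Vx mulr1.
by rewrite -(nilp_l EE hN) -(cE cN) (nilp_r EE hN).
Qed.

(** An injective endomorphism in finite dimension is bijective. [commx] is extended by the identity
    on the kernel of the projector P, so that the inverse is a matrix, and its valuation supplies
    c. *)
Lemma commx_inv : exists c : int, forall N', nilp E N' ->
  exists N, [/\ nilp E N, commx N = N' & forall k, mge k N' -> mge (k + c) N].
Proof.
pose P N := E * N * (1 - E).
have CE : (1 - E) * (1 - E) = 1 - E.
  by rewrite mulrBr mulr1 mulrBl mul1r EE subrr subr0.
have PP N : P (P N) = P N by rewrite /P !mulrA EE -!mulrA CE.
have nP N : nilp E (P N) by exact: PP.
pose T N := commx (P N) + (N - P N).
have PD a N N' : P (a *: N + N') = a *: P N + P N'.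
  by rewrite /P (mulrDr E) -scalerAr mulrDl -scalerAl.
have TD : linear T.
  move=> a N N'; rewrite /T PD commxD.
  have -> : commx (a *: P N) = a *: commx (P N).
    by rewrite /commx -scalerAr -scalerAl scalerBr.
  by rewrite opprD (addrACA (a *: N)) -scalerBr addrACA -scalerDr.
pose Tl : {linear 'M[F]_n -> 'M[F]_n} := HB.pack T (GRing.isLinear.Build _ _ _ _ T TD).
have PT N : P (T N) = commx (P N).
  have -> : T N = 1 *: commx (P N) + (N - P N) by rewrite scale1r.
  rewrite PD scale1r [P (commx _)](commx_nilp (nP N)).
  have -> : P (N - P N) = 0.
    by rewrite -[N - P N]addrC -scaleN1r PD PP scaleN1r addNr.
  by rewrite addr0.
have Tinj N : T N = 0 -> N = 0.
  move=> h; have := PT N; rewrite h {1}/P mulr0 mul0r => /esym /(commx_inj (nP N)) PN.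
  by move: h; rewrite /T PN /commx mulr0 mul0r subrr add0r subr0.
pose A := lin_mx Tl.
have uA : A \in unitmx.
  rewrite -row_free_unit; apply: inj_row_free => w hw.
  have := mul_vec_lin Tl (vec_mx w); rewrite vec_mxK hw => /(congr1 vec_mx).
  by rewrite mxvecK raddf0 => /esym /Tinj /(congr1 mxvec); rewrite vec_mxK raddf0.
have [c0 h0] := mge_ex v (invmx A).
have [c1 h1] := mge_ex v E; have [c2 h2] := mge_ex v (1 - E).
exists (c0 + (c1 + c2)) => N' hN'; pose N0 := vec_mx (mxvec N' *m invmx A).
have TN0 : T N0 = N'.
  by apply: (can_inj mxvecK); rewrite -[LHS](mul_vec_lin Tl) vec_mxK mulmxKV.
exists (P N0); split=> //; first by rewrite -PT TN0.
move=> k hk; have hk' : mge k (mxvec N').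
  by move=> i j; rewrite ord1; case/mxvec_indexP: j => i' j'; rewrite mxvecE.
have hN0 : mge (k + c0) N0.
  by move=> i j; rewrite mxE; apply: (mgeM HF hk' h0).
by apply: mgeW (mgeM HF (mgeM HF h1 hN0) h2); lia.
Qed.

End UnipotentConjugation.

Section UnipotentRadical.
Variables (F : fieldType) (n' : nat).
Local Notation n := n'.+1.
Variables (g E : 'M[F]_n).
Hypothesis dg : \det g != 0.
Hypothesis EE : E * E = E.

Let ug : g \in unitmx. Proof. by rewrite det_unit. Qed.

Let gK : invmx g *m g = 1%:M. Proof. exact: mulVmx. Qed.

Let E' := g *m E *m invmx g.

Lemma conj_idem : E' *m E' = E'.
Proof. by rewrite /E' !mulmxA -(mulmxA (g *m E)) gK mulmx1 -(mulmxA g E E) -[E *m E]/(E * E) EE. Qed.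

Lemma conj_nilp (u : 'M[F]_n) : (1%:M - E') *m (u - 1%:M) = 0 -> (u - 1%:M) *m E' = 0 ->
  exists2 N, nilp E N & u = g *m (1 + N) *m invmx g.
Proof.
move=> h0 h1; exists (invmx g *m (u - 1%:M) *m g); last first.
  rewrite -[1 + _]/(1%:M + _) mulmxDr mulmx1 mulmxDl mulmxV // !mulmxA mulmxV // mul1mx.
  by rewrite -mulmxA mulmxV // mulmx1 addrC subrK.
have e1 : E *m invmx g = invmx g *m E' by rewrite /E' !mulmxA gK mul1mx.
have e2 : g *m E = E' *m g by rewrite /E' -!mulmxA gK mulmx1.
apply: nilpP.
  rewrite -[LHS]/(E *m _) !mulmxA e1 -(mulmxA (invmx g) E'); congr (_ *m _ *m _).
  by move/eqP: h0; rewrite mulmxBl mul1mx subr_eq0 => /eqP.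
by rewrite -[LHS]/(_ *m E) -!mulmxA e2 (mulmxA (u - _)) h1 mul0mx mulmx0.
Qed.

(** The flag has one step, the row space of 1 - E' with E' = g E g^-1. Its two conditions read (1 -
    E') (u - 1) = 0 and (u - 1) E' = 0. *)
Lemma unip_radP (u : 'M[F]_n) :
  unip_rad [:: 1%:M - E'] u <-> exists2 N, nilp E N & u = g *m (1 + N) *m invmx g.
Proof.
split=> [[_ h]|[N hN ->]].
  have := h 0%N isT; rewrite /= submx0 => /eqP h0.
  have := h 1%N isT; rewrite /= mul1mx => /submxP[D hD].
  by apply: conj_nilp => //; rewrite hD -mulmxA mulmxBl mul1mx conj_idem subrr mulmx0.
have eu : g *m (1 + N) *m invmx g - 1%:M = g *m N *m invmx g.
  by rewrite -[1 + N]/(1%:M + N) mulmxDr mulmx1 mulmxDl mulmxV // addrAC subrr add0r.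
split.
  by rewrite !det_mulmx !mulf_neq0 ?det_invmx_neq0 // (unip_det EE).
have hl : E *m N = N by exact: (nilp_l EE hN).
have hr : N *m E = 0 by exact: (nilp_r EE hN).
case=> [|[|//]] _; rewrite /= eu.
  rewrite submx0 mulmxBl mul1mx /E' subr_eq0 !mulmxA -(mulmxA (g *m E)) gK mulmx1.
  by rewrite -(mulmxA g E) hl.
rewrite mul1mx; apply/submxP; exists (g *m N *m invmx g).
rewrite mulmxBr mulmx1 /E' !mulmxA -(mulmxA (g *m N)) gK mulmx1 -(mulmxA g N E) hr.
by rewrite mulmx0 mul0mx subr0.
Qed.

Lemma idem_flag : E != 0 -> E != 1 -> proper_flag [:: 1%:M - E'].
Proof.
move=> E0 E1; split=> //; rewrite /= lt0mx ltmx1 row_full_unit andbT; apply/andP; split.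
  apply: contraNneq E1 => /eqP; rewrite subr_eq0 => /eqP h; apply/eqP.
  apply: (can_inj (mulKmx ug)); apply: (can_inj (mulmxK (_ : invmx g \in unitmx))).
    by rewrite unitmx_inv.
  by rewrite -[LHS]/E' -h -[_ *m 1]/(g *m 1%:M) mulmx1 mulmxV.
apply: contraNN E0 => u; apply/eqP.
have : (1%:M - E') *m E' = 0 by rewrite mulmxBl mul1mx conj_idem subrr.
move/(congr1 (mulmx (invmx (1%:M - E')))); rewrite mulKmx // mulmx0 => h.
apply: (can_inj (mulKmx ug)); apply: (can_inj (mulmxK (_ : invmx g \in unitmx))).
  by rewrite unitmx_inv.
by rewrite -[LHS]/E' h mulmx0 mul0mx.
Qed.

End UnipotentRadical.

Section OrbitIntegrals.
Variables (R : realType) (F : fieldType) (v : F -> int).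
Hypothesis HF : nonarch_local_field v.
Variable n' : nat.
Local Notation n := n'.+1.
Local Notation mge := (mge v).
Local Notation M := (MXm v n).
Local Notation mball := (mball v).
Variables (x E : 'M[F]_n).
Hypothesis EE : (E * E = E)%R.
Hypothesis dx : \det x != 0%R.
Hypothesis Ex : GRing.comm E x.
Hypothesis cE : forall s, GRing.comm s x -> GRing.comm s E.
Variable mu : {measure set M -> \bar R}.
Hypothesis hmu : haarG mu.
Hypothesis mu1 : mu (Gi v 0%R) = 1%E.
Local Open Scope ereal_scope.
Local Notation U k := (unip_part E k).

(** U times a bounded transversal: k = u k' with u = [unip_part E k] and k' congruent to 1. It is
    stable under left multiplication by U, and its part over a ball of U has finite positive mass,
    so mu can be pushed to a Haar measure of U. *)
Definition cell : set M := [set k : M | [/\ \det (k : 'M[F]_n) != 0%R,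
  \det (levi_part E k) != 0%R & mball 1%:M 1 (invmx (U k) *m (k : 'M[F]_n))]].

Lemma cell_unip k : cell k -> nilp E (U k - 1)%R.
Proof. by move=> [_ d _]; rewrite addrAC subrr add0r; apply: unip_part_nilp. Qed.

Lemma measurable_cell : measurable cell.
Proof.
have mG := @measurable_Gset _ _ HF n.
rewrite (_ : cell = @Gset F n `&` ((fun k : M => levi_part E k : M) @^-1` @Gset F n `&`
   (fun k : M => invmx (U k) *m (k : 'M[F]_n) : M) @^-1` mball 1%:M 1)).
  apply: measurableI => //; apply: measurableI.
    by rewrite -[X in measurable X]setTI; apply: (measurable_levi_part HF).
  rewrite -[X in measurable X]setTI.
  have mf : measurable_fun setT (fun k : M => invmx (U k) *m (k : 'M[F]_n) : M).
    apply: (measurable_mulmx_fun HF); last exact: measurable_id.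
    exact: (measurableT_comp (@measurable_invmx _ _ HF n) (measurable_unip_part HF E)).
  by apply: mf => //; exact: ball_measurable.
by apply/seteqP; split=> k; [case|case=> ? []].
Qed.

Lemma cell_mul N (k : 'M[F]_n) : nilp E N -> cell k -> cell ((1 + N) * k)%R.
Proof.
move=> hN [h1 h2 h3]; split.
- by rewrite det_mulmx mulf_neq0 // (unip_det EE).
- by rewrite (levi_part_unip EE).
rewrite (unip_part_mul EE) //; set u := U k in h3 *.
have uu : u \in unitmx by rewrite det_unit; apply: (unip_det EE); apply: unip_part_nilp.
have uN : (1 + N)%R \in unitmx by rewrite det_unit (unip_det EE).
suff -> : invmx ((1 + N) * u)%R = invmx u *m invmx (1 + N)%R.
  by rewrite -mulmxA -[((1 + N) * k)%R]/((1 + N)%R *m k) mulKmx.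
have uuN : ((1 + N) * u)%R \in unitmx by rewrite unitmx_mul uN.
apply: (can_inj (mulKmx uuN)); rewrite mulmxV // -[((1 + N) * u)%R]/((1 + N)%R *m u).
by rewrite -mulmxA (mulmxA u) mulmxV // mul1mx mulmxV.
Qed.

Definition cellR (c : int) : set M := [set k | cell k /\ mge c (U k - 1)%R].

Lemma measurable_cellR c : measurable (cellR c).
Proof.
rewrite (_ : cellR c = cell `&` ((fun k : M => U k : M) @^-1` mball 1%:M c)).
  apply: measurableI; first exact: measurable_cell.
  rewrite -[X in measurable X]setTI; apply: (measurable_unip_part HF) => //.
  exact: ball_measurable.
by apply/seteqP; split=> k [h1 /mballE h2]; split=> //; apply/mballE.
Qed.

Lemma cellR_fin c : mu (cellR c) < +oo.
Proof.
apply: le_lt_trans (mu_Cpt HF hmu (Num.min c 0)%R 0%R); apply: le_measure; rewrite ?inE.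
- exact: measurable_cellR.
- exact: measurable_Cpt.
move=> k [ck hk]; have [dk dl /(CN_sub_K HF (lexx 1%R))/(KP HF)[h1 h2 h3]] := ck.
have hN := cell_unip ck; have eu : U k = (1 + (U k - 1))%R by rewrite addrC subrK.
have uu : U k \in unitmx by rewrite eu det_unit (unip_det EE).
have ek : (k : 'M[F]_n) = U k *m (invmx (U k) *m (k : 'M[F]_n)) by rewrite mulKVmx.
split=> //.
  rewrite ek -[(Num.min c 0)%R]addr0; apply: (mgeM HF) => //; rewrite eu; apply: (mgeD HF).
    by have h : mge 0 (1 : 'M[F]_n) by [exact: mge1]; apply: mgeW h; rewrite ge_min lexx orbT.
  by apply: mgeW hk; rewrite ge_min lexx.
have dU : \det (U k) != 0%R by rewrite eu (unip_det EE).
have -> : v (\det (k : 'M[F]_n)) = v (\det (U k *m (invmx (U k) *m (k : 'M[F]_n)))) by rewrite -ek.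
by rewrite val_detM // h3 addr0 eu (unip_val_det HF EE).
Qed.

Lemma cell_near c : exists j, mball 1%:M j `<=` cellR c.
Proof.
have [j hj] := unip_part_near1 HF EE (Num.max c 1%R).
exists (Num.max 1%R j) => k hk.
have [dl h1] : \det (levi_part E k) != 0%R /\ mge (Num.max c 1%R) (U k - 1)%R.
  by apply: hj; apply: ballW hk; rewrite le_max lexx orbT.
have hk1 : mball 1%:M 1 (k : 'M[F]_n) by apply: ballW hk; rewrite le_max lexx.
have /(CN_sub_K HF (lexx 1%R))/(KP HF)[dk _ _] := hk1.
split; last by apply: mgeW h1; rewrite le_max lexx.
split=> //; apply: (CN_mul HF) => //; apply: (CN_inv HF) => //.
by apply/mballE; apply: mgeW h1; rewrite le_max lexx orbT.
Qed.

Lemma cellR_pos c : mu (cellR c) != 0.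
Proof.
have [j hj] := cell_near c; apply: contra_neq (mu_pos HF hmu j _); last by rewrite mu1; apply/eqP => -[] /eqP; rewrite oner_eq0.
move=> h; apply: (@subset_measure0 _ _ _ mu _ (cellR c)) => //.
- exact: ball_measurable.
- exact: measurable_cellR.
Qed.

End OrbitIntegrals.

Section ImageMeasure.
Variables (R : realType) (F : fieldType) (v : F -> int) (n' : nat).
Hypothesis HF : nonarch_local_field v.
Local Notation n := n'.+1.
Local Notation M := (MXm v n).
Local Open Scope ereal_scope.

Lemma image_measure (mu : {measure set M -> \bar R}) (Y : set M) (phi : M -> M) (c : {nonneg R}) :
  measurable Y -> measurable_fun setT phi ->
  exists nu : {measure set M -> \bar R},
    (forall A, measurable A -> nu A = c%:num%:E * mu (Y `&` phi @^-1` A)) /\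
    (forall f, measurable_fun setT f -> (forall t, 0 <= f t) ->
       \int[nu]_t f t = c%:num%:E * \int[mu]_(k in Y) f (phi k)).
Proof.
move=> mY mphi.
have [nu1 h1] : exists nu1 : {measure set M -> \bar R}, nu1 = mrestr mu mY :> (set M -> \bar R).
  by exists (mrestr mu mY).
have [nu2 h2] : exists nu2 : {measure set M -> \bar R}, nu2 = pushforward nu1 phi :> (set M -> \bar R).
  by unshelve eexists (pushforward nu1 phi).
exists (mscale c nu2); split=> [A mA|f mf f0].
  congr (_ * _); apply: etrans (congr1 (@^~ A) h2) _.
  by apply: etrans (congr1 (@^~ (phi @^-1` A)) h1) _; rewrite /mrestr setIC.
rewrite ge0_integral_mscale //; congr (_ * _).
transitivity (\int[nu1]_k f (phi k)).
  have := ge0_integral_pushforward mphi nu1 measurableT mf (fun y _ => f0 y).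
  rewrite preimage_setT => <-; apply: eq_measure_integral => A _ _.
  by rewrite h2.
have n0 : nu1 (~` Y) = 0 by rewrite h1 /mrestr setICl measure0.
rewrite -(integral_null mY n0) //; first last.
  exact: (measurableT_comp mf mphi).
apply: eq_measure_integral => A _ AY.
by rewrite h1 /mrestr setIidl.
Qed.

End ImageMeasure.

Lemma conj_mulmx (F : fieldType) n (g A B : 'M[F]_n) : \det g != 0 ->
  (g *m A *m invmx g) *m (g *m B *m invmx g) = g *m (A *m B) *m invmx g.
Proof. by rewrite -det_unit => u; rewrite !mulmxA -(mulmxA (g *m A)) mulVmx // mulmx1. Qed.

Section CuspidalOrbit.
Variables (R : realType) (F : fieldType) (v : F -> int).
Hypothesis HF : nonarch_local_field v.
Variable n' : nat.
Local Notation n := n'.+1.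
Local Notation M := (MXm v n).
Local Open Scope ereal_scope.

(** Vanishing of the integrals of one real component; [fine] appears as in [cint]. *)
Definition real_cuspidal (w : M -> R) : Prop :=
  forall s : seq 'M[F]_n, proper_flag s -> forall y : 'M[F]_n, \det y != 0%R ->
  forall nu : {measure set M -> \bar R},
    haar_for (unip_rad s) (unip_rad s `&` Gi v 0%R) nu ->
    fine (\int[nu]_u (w ((u : 'M[F]_n) *m y))%:E) = 0%R.

Lemma measurable_unip_rad (s : seq 'M[F]_n) : measurable (unip_rad s : set M).
Proof.
have mt := @measurable_translate F v n' (- 1%:M)%R.
pose A j := nth 0%R (rcons s 1%:M) j; pose B j := cokermx (nth 0%R (0 :: s)%R j).
pose K j : set M := (fun u : M => - 1%:M + (u : 'M[F]_n) : M)%R @^-1`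
   [set N : M | A j *m (N : 'M[F]_n) *m B j = 0%R].
rewrite (_ : unip_rad s = @Gset F n `&`
   \bigcap_j (if (j < (size s).+1)%N then K j else setT)).
  apply: measurableI; first exact: (@measurable_Gset _ _ HF n).
  apply: bigcapT_measurable => j; case: ifP => // _.
  have [c1 h1] := mge_ex v (A j); have [c2 h2] := mge_ex v (B j).
  rewrite -[X in measurable X]setTI; apply: mt => //.
  apply: (@measurable_kernel _ _ HF _ (fun N => A j *m N *m B j) (c1 + c2)%R) => [N N'|k N hN].
    by rewrite mulmxDr mulmxDl.
  by apply: mgeW (mgeM HF (mgeM HF h1 hN) h2); lia.
apply/seteqP; split=> [u [du h]|u [du h]]; split=> //.
  move=> j _; case: ifP => // /h; rewrite submxE => /eqP.
  by rewrite /K /= [(- _ + _)%R]addrC.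
move=> j js; have := h j I; rewrite js /K /= [(- _ + _)%R]addrC submxE => ->.
by rewrite eqxx.
Qed.

Variables (x E : 'M[F]_n).
Hypothesis EE : (E * E = E)%R.
Hypothesis dx : \det x != 0%R.
Hypothesis Ex : GRing.comm E x.
Hypothesis cE : forall s, GRing.comm s x -> GRing.comm s E.
Variable mu : {measure set M -> \bar R}.
Hypothesis hmu : haarG mu.
Hypothesis mu1 : mu (Gi v 0%R) = 1%E.
Local Notation U k := (unip_part E k).
Local Notation cell := (@cell F v n' E).

Section OneOrbit.
Variable g : 'M[F]_n.
Hypothesis dg : \det g != 0%R.

(** With u the U-component of k, this element of the conjugated radical carries g x g^-1 to (g u) x
    (g u)^-1 by left multiplication, and left translation of k by U becomes translation in the
    radical. *)
Definition orbit_map (k : M) : M := g *m (U k *m x *m invmx (U k) *m invmx x) *m invmx g.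

Lemma measurable_orbit_map : measurable_fun setT orbit_map.
Proof.
have mU := measurable_unip_part HF E.
apply: (measurable_mulmx_fun HF); last exact: measurable_cst.
apply: (measurable_mulmx_fun HF); first exact: measurable_cst.
apply: (measurable_mulmx_fun HF); last exact: measurable_cst.
apply: (measurable_mulmx_fun HF); last first.
  exact: (measurableT_comp (@measurable_invmx _ _ HF n) mU).
by apply: (measurable_mulmx_fun HF) => //; exact: measurable_cst.
Qed.

Lemma orbit_mapE k : cell k ->
  orbit_map k = g *m (1 + commx x (U k - 1))%R *m invmx g.
Proof.
move=> ck; congr (_ *m _ *m _); rewrite -(unip_commutator EE dx Ex (cell_unip EE ck)).
by rewrite [(1 + _)%R]addrC subrK.
Qed.

Lemma unip_part_cell N (k : 'M[F]_n) : nilp E N -> cell k -> U ((1 + N) * k)%R = ((1 + N) * U k)%R.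
Proof. by move=> hN [_ d _]; exact: unip_part_mul. Qed.

Lemma orbit_map_mul N (k : 'M[F]_n) : nilp E N -> cell k ->
  orbit_map ((1 + N) * k)%R = g *m (1 + commx x N)%R *m invmx g *m orbit_map k.
Proof.
move=> hN ck; have hk := cell_unip EE ck; have ug : g \in unitmx by rewrite det_unit.
have ck' := cell_mul EE hN ck.
have e1 := orbit_mapE ck'.
have e2 := orbit_mapE ck.
rewrite e1 e2 (conj_mulmx _ _ dg); apply: (congr1 (fun A => g *m A *m invmx g)).
rewrite (unip_part_cell hN ck).
have eu : U k = (1 + (U k - 1))%R by rewrite addrC subrK.
have -> : ((1 + N) * U k - 1 = N + (U k - 1))%R.
  by rewrite {1}eu (unipM EE hN hk) addrAC subrr add0r.
rewrite commxD; apply: esym; apply: (unipM EE); exact: (commx_nilp EE Ex).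
Qed.

Lemma orbit_map_rad k : cell k -> unip_rad [:: 1%:M - g *m E *m invmx g]%R (orbit_map k).
Proof.
move=> ck; apply/(unip_radP dg EE); exists (commx x (U k - 1)%R); last exact: orbit_mapE.
by apply: (commx_nilp EE Ex); exact: (cell_unip EE ck).
Qed.

Lemma orbit_map_conj k : cell k -> orbit_map k *m Defs.conjg g x = Defs.conjg (g *m U k) x.
Proof.
move=> ck; have ug : g \in unitmx by rewrite det_unit.
have ux : x \in unitmx by rewrite det_unit.
have uU : U k \in unitmx.
  have := unip_det EE (cell_unip EE ck); rewrite [(1 + _)%R]addrC subrK.
  by rewrite det_unit.
rewrite /orbit_map /Defs.conjg !mulmxA -(mulmxA _ (invmx g) g) mulVmx // mulmx1.
rewrite -(mulmxA _ (invmx x) x) mulVmx // mulmx1 -(mulmxA _ (invmx (U k))); congr (_ *m _).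
have ugU : g *m U k \in unitmx by rewrite unitmx_mul ug.
apply: (can_inj (mulKmx ugU)); rewrite mulmxV // -mulmxA (mulmxA (U k)) mulmxV //.
by rewrite mul1mx mulmxV.
Qed.

End OneOrbit.
End CuspidalOrbit.

Section CuspidalVanishing.
Variables (R : realType) (F : fieldType) (v : F -> int).
Hypothesis HF : nonarch_local_field v.
Variable n' : nat.
Local Notation n := n'.+1.
Local Notation mge := (mge v).
Local Notation M := (MXm v n).
Local Open Scope ereal_scope.
Variables (x E : 'M[F]_n).
Hypothesis EE : (E * E = E)%R.
Hypothesis dx : \det x != 0%R.
Hypothesis Ex : GRing.comm E x.
Hypothesis cE : forall s, GRing.comm s x -> GRing.comm s E.
Variable mu : {measure set M -> \bar R}.
Hypothesis hmu : haarG mu.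
Hypothesis mu1 : mu (Gi v 0%R) = 1%E.
Local Notation U k := (unip_part E k).
Local Notation cell := (@cell F v n' E).
Local Notation phi g := (@orbit_map F v n' x E g).
Local Notation rad g := (@unip_rad F n [:: 1%:M - g *m E *m invmx g]%R).

Lemma commx_bound : exists c : int, forall N k, nilp E N -> mge k (commx x N) -> mge (k + c) N.
Proof.
have [c hc] := commx_inv HF EE dx Ex cE; exists c => N k hN hk.
have [N1 [hN1 e1 h1]] := hc _ (commx_nilp EE Ex hN).
suff -> : N = N1 by exact: h1.
apply/eqP; rewrite -subr_eq0; apply/eqP; apply: (commx_inj EE dx cE).
  by apply: nilpD => //; exact: nilpN.
have h : (commx x (N - N1) + commx x N1 = commx x N)%R by rewrite -commxD subrK.
by move: h; rewrite e1 => h; apply: (addIr (commx x N)); rewrite h add0r.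
Qed.

Lemma conj_mge (g : 'M[F]_n) : \det g != 0%R -> exists d : int, forall k (A : 'M[F]_n),
  mge k A -> mge (k + d) (g *m A *m invmx g) /\ mge (k + d) (invmx g *m A *m g).
Proof.
move=> dg; have [c1 h1] := mge_ex v g; have [c2 h2] := mge_ex v (invmx g).
exists (c1 + c2)%R => k A hA; split.
  by apply: mgeW (mgeM HF (mgeM HF h1 hA) h2); lia.
by apply: mgeW (mgeM HF (mgeM HF h2 hA) h1); lia.
Qed.

Section OneOrbit.
Variable g : 'M[F]_n.
Hypothesis dg : \det g != 0%R.

Let ug : g \in unitmx. Proof. by rewrite det_unit. Qed.

(** The part of the cell over the integral points of the radical; its mass normalizes the image
    measure. *)
Definition unit_cell : set M := cell `&` phi g @^-1` (Gi v 0%R).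

Lemma measurable_phi (A : set M) : measurable A -> measurable (phi g @^-1` A).
Proof.
by move=> mA; rewrite -[X in measurable X]setTI; apply: (measurable_orbit_map HF x E g).
Qed.

Lemma measurable_unit_cell : measurable unit_cell.
Proof.
apply: measurableI; first exact: (measurable_cell HF E).
by apply: measurable_phi; exact: measurable_K.
Qed.

(** An integral image bounds [commx] of U k - 1, hence by [commx_bound] U k - 1 itself. *)
Lemma unit_cell_fin : mu unit_cell < +oo.
Proof.
have [c hc] := commx_bound; have [d hd] := conj_mge dg.
apply: le_lt_trans (cellR_fin HF EE hmu (Num.min d 0 + c)%R).
apply: le_measure; rewrite ?inE; [exact: measurable_unit_cell|exact: measurable_cellR|].
move=> k [ck /(KP HF)[_ h0 _]]; split=> //; apply: hc; first exact: (cell_unip EE ck).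
have /hd[_] := h0; rewrite (orbit_mapE EE dx Ex g ck) add0r.
set B := (1 + _)%R; have -> : invmx g *m (g *m B *m invmx g) *m g = B.
  by rewrite -!mulmxA mulVmx // mulmx1 mulKmx.
move=> hB; have -> : commx x (U k - 1) = (B - 1)%R by rewrite /B [RHS]addrAC subrr add0r.
have h1 : mge 0 (1 : 'M[F]_n) by exact: mge1.
by apply: (mgeB HF); [apply: mgeW hB|apply: mgeW h1]; rewrite ge_min lexx ?orbT.
Qed.

Lemma unit_cell_pos : mu unit_cell != 0.
Proof.
have [d hd] := conj_mge dg; have [d' hd'] := conj_mge dx.
pose c := (`|d'| + `|d| : int)%R.
apply: contra_neq (cellR_pos HF EE hmu mu1 c) => mu0.
apply: (@subset_measure0 _ _ _ mu _ unit_cell) => //.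
- exact: measurable_cellR.
- exact: measurable_unit_cell.
move=> k [ck hk]; split=> //; have hN := cell_unip EE ck.
have hcx := commx_nilp EE Ex hN.
have h1 : mge 0 (1 : 'M[F]_n) by exact: mge1.
apply/(KP HF); rewrite (orbit_mapE EE dx Ex g ck); split.
- by rewrite !det_mulmx !mulf_neq0 ?det_invmx_neq0 // (unip_det EE).
- have -> : g *m (1 + commx x (U k - 1))%R *m invmx g =
            (1 + g *m commx x (U k - 1) *m invmx g)%R.
    by rewrite -[(1 + _)%R]/(1%:M + _)%R mulmxDr mulmx1 mulmxDl mulmxV.
  apply: (mgeD HF) => //.
  have h2 : mge `|d| (commx x (U k - 1)).
    apply: (mgeB HF); first by apply: mgeW hk; rewrite /c; lia.
    by have [h _] := hd' _ _ hk; apply: mgeW h; rewrite /c; lia.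
  by have [h _] := hd _ _ h2; apply: mgeW h; lia.
- rewrite !val_detM ?det_mulmx ?mulf_neq0 ?det_invmx_neq0 ?(unip_det EE) //.
  by rewrite (val_detV HF) // (unip_val_det HF EE) // addr0 subrr.
Qed.

(** Each h in the radical is g (1 + [commx x N]) g^-1 for some N, and translation by h corresponds
    to left translation of the cell by 1 + N, under which mu is invariant. *)
Lemma orbit_haar : exists (nu : {measure set M -> \bar R}) (c : R), [/\ (0 < c)%R,
  haar_for (rad g) (rad g `&` Gi v 0%R) nu &
  forall f, measurable_fun setT f -> (forall t, 0 <= f t) ->
     \int[nu]_t f t = c%:E * \int[mu]_(k in cell) f (phi g k)].
Proof.
have mH := measurable_unip_rad HF [:: 1%:M - g *m E *m invmx g]%R.
have cfin : mu unit_cell \is a fin_num by rewrite ge0_fin_numE // unit_cell_fin.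
pose c := (fine (mu unit_cell))^-1%R.
have c0 : (0 < c)%R.
  rewrite invr_gt0 lt_neqAle fine_ge0 // andbT eq_sym; apply: contra unit_cell_pos => /eqP h.
  by rewrite -(fineK cfin) h.
have [nu [hA hI]] := image_measure mu (NngNum (ltW c0)) (measurable_cell HF E)
  (measurable_orbit_map HF x E g).
have cellrad : cell `&` phi g @^-1` (~` rad g) = set0.
  by apply/seteqP; split=> // k [ck]; apply; exact: orbit_map_rad.
exists nu, c; split=> //; split.
- have -> : nu (~` rad g) = c%:E * mu (cell `&` phi g @^-1` (~` rad g)).
    by apply: hA; exact: measurableC.
  by rewrite cellrad measure0 mule0.
- move=> h A /(unip_radP dg EE)[N' hN' eh] mA.
  have [c' /(_ _ hN')[N [hN eN _]]] := commx_inv HF EE dx Ex cE.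
  have dh : \det (h : 'M[F]_n) != 0%R.
    by rewrite eh !det_mulmx !mulf_neq0 ?det_invmx_neq0 // (unip_det EE).
  have uh : (h : 'M[F]_n) \in unitmx by rewrite det_unit.
  have -> : [set (h : 'M[F]_n) *m (a : 'M[F]_n) | a in A] =
     [set y : M | A (invmx (h : 'M[F]_n) *m (y : 'M[F]_n))].
    apply/seteqP; split=> [_ [a Aa <-]|y Ay]; first by rewrite /= mulKmx.
    by exists (invmx (h : 'M[F]_n) *m (y : 'M[F]_n)) => //; rewrite mulKVmx.
  have mhA := measurable_lpre HF (invmx (h : 'M[F]_n)) mA.
  rewrite (hA _ mhA) (hA _ mA); congr (_ * _).
  have hNN := nilpN hN; have du := unip_det EE hNN.
  have mS : measurable (cell `&` phi g @^-1` A).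
    by apply: measurableI; [exact: (measurable_cell HF E)|exact: measurable_phi].
  rewrite -(hG_linv hmu du mS); congr (mu _); apply/seteqP.
  have conv (k : M) : cell k -> phi g ((1 - N) *m (k : 'M[F]_n))%R = invmx (h : 'M[F]_n) *m phi g k.
    move=> ck; rewrite [phi g _](orbit_map_mul EE dx Ex dg hNN ck); congr (_ *m _).
    have -> : commx x (- N) = (- N')%R.
      by rewrite -eN /commx mulrN mulNr opprK opprB addrC.
    apply: (can_inj (mulKmx uh)); rewrite mulmxV // eh conj_mulmx //.
    by rewrite -[_ *m (1 - N')%R]/((1 + N') * (1 - N'))%R (unipM EE) ?subrr ?addr0 ?mulmx1 ?mulmxV //; exact: nilpN.
  split=> k; last first.
    move=> [/(cell_mul EE hN) ck Ak].
    have e : ((1 + N) * ((1 - N) *m (k : 'M[F]_n)) = k)%R.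
      rewrite -[(1 - N)%R *m _]/((1 - N) * (k : 'M[F]_n))%R mulrA (unipM EE) //.
      by rewrite subrr addr0 mul1r.
    by move: ck; rewrite e => ck; split=> //; rewrite /= -conv.
  move=> [ck Ak]; split; first exact: (cell_mul EE hNN ck).
  by rewrite /= conv.
rewrite (hA _ (measurableI _ _ mH (@measurable_K F v HF n'))).
have -> : cell `&` phi g @^-1` (rad g `&` Gi v 0%R) = unit_cell.
  apply/seteqP; split=> k; first by move=> [h1 [_ h2]].
  by move=> [h1 h2]; split=> //; split=> //; exact: orbit_map_rad.
by rewrite /= -(fineK cfin) -EFinM mulVf // -invr_eq0 -/c gt_eqF.
Qed.

End OneOrbit.
End CuspidalVanishing.

Section CuspidalAverage.
Variables (R : realType) (F : fieldType) (v : F -> int).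
Hypothesis HF : nonarch_local_field v.
Variable n' : nat.
Local Notation n := n'.+1.
Local Notation M := (MXm v n).
Local Open Scope ereal_scope.
Variables (x E : 'M[F]_n).
Hypothesis EE : (E * E = E)%R.
Hypothesis dx : \det x != 0%R.
Hypothesis Ex : GRing.comm E x.
Hypothesis cE : forall s, GRing.comm s x -> GRing.comm s E.
Hypothesis E0 : E != 0%R.
Hypothesis E1 : E != 1%R.
Variable mu : {measure set M -> \bar R}.
Hypothesis hmu : haarG mu.
Hypothesis mu1 : mu (Gi v 0%R) = 1%E.
Local Notation U k := (unip_part E k).
Local Notation cell := (@cell F v n' E).
Local Notation cellR := (@cellR F v n' E).

Variable w : M -> R.
Hypothesis mw : measurable_fun setT w.
Hypothesis cw : real_cuspidal w.
Local Notation q g := (w (Defs.conjg g x)).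
Local Notation pos z := (Num.max z 0%R).

Lemma measurable_conj : measurable_fun setT (fun g : M => Defs.conjg (g : 'M[F]_n) x : M).
Proof.
apply: (measurable_mulmx_fun HF); first exact: (measurable_rmul HF).
exact: (@measurable_invmx _ _ HF n).
Qed.

Lemma measurable_pos d (T : measurableType d) (f : T -> R) : measurable_fun setT f ->
  measurable_fun setT (fun t => (pos (f t))%:E).
Proof. by move=> mf; apply/measurable_EFinP; apply: measurable_maxr => //; exact: measurable_cst. Qed.

(** Cuspidality at y = g x g^-1 for the measure of [orbit_haar]. The support condition makes both
    integrals finite; this is needed since [fine] also sends infinite values to 0. *)
Lemma cusp_orbit (g : 'M[F]_n) (l : int) (C : R) : \det g != 0%R ->
  (forall k, cell k -> q (g *m U k) != 0%R -> cellR l k /\ (`|q (g *m U k)| <= C)%R) ->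
  \int[mu]_(k in cell) (pos (q (g *m U k)))%:E = \int[mu]_(k in cell) (pos (- q (g *m U k)))%:E.
Proof.
move=> dg hC; have [nu [c [c0 hnu hI]]] := orbit_haar HF EE dx Ex cE hmu mu1 dg.
have dy : \det (Defs.conjg g x) != 0%R by rewrite !det_mulmx !mulf_neq0 ?det_invmx_neq0.
have := cw (idem_flag dg EE E0 E1) dy hnu.
have mwy : measurable_fun setT (fun u : M => w ((u : 'M[F]_n) *m Defs.conjg g x)).
  exact: (measurableT_comp mw (measurable_rmul HF (Defs.conjg g x))).
rewrite integralE.
have mcell := measurable_cell HF E.
have part (s : R -> R) : (s = id \/ s = -%R) ->
   \int[nu]_u (pos (s (w ((u : 'M[F]_n) *m Defs.conjg g x))))%:E =
   c%:E * \int[mu]_(k in cell) (pos (s (q (g *m U k))))%:E.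
  move=> hs; rewrite hI.
  - by congr (_ * _); apply: eq_integral => k; rewrite inE => ck; rewrite (orbit_map_conj EE dx dg ck).
  - apply: (measurable_pos (f := fun u : M => s (w ((u : 'M[F]_n) *m Defs.conjg g x)))).
    by case: hs => -> //; exact: measurable_funN.
  - by move=> t; rewrite lee_fin le_max lexx orbT.
have -> : \int[nu]_u (fun u : M => (w ((u : 'M[F]_n) *m Defs.conjg g x))%:E)^\+ u =
   c%:E * \int[mu]_(k in cell) (pos (q (g *m U k)))%:E.
  rewrite -(part id (or_introl erefl)); apply: eq_integral => u _.
  by rewrite funeposE EFin_max.
have -> : \int[nu]_u (fun u : M => (w ((u : 'M[F]_n) *m Defs.conjg g x))%:E)^\- u =
   c%:E * \int[mu]_(k in cell) (pos (- q (g *m U k)))%:E.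
  rewrite -(part -%R (or_intror erefl)); apply: eq_integral => u _.
  by rewrite funenegE EFin_max.
have mqU : measurable_fun setT (fun k : M => q (g *m U k)).
  apply: (measurableT_comp mw); apply: (measurableT_comp measurable_conj).
  exact: (measurableT_comp (measurable_lmul HF g) (measurable_unip_part HF E)).
have fin (s : R -> R) : (s = id \/ s = -%R) ->
   \int[mu]_(k in cell) (pos (s (q (g *m U k))))%:E \is a fin_num.
  move=> hs; have p0 (k : M) : 0 <= (pos (s (q (g *m U k))))%:E by rewrite lee_fin le_max lexx orbT.
  have C0 : (0 <= Num.max C 0)%R by rewrite le_max lexx orbT.
  rewrite ge0_fin_numE; last by apply: integral_ge0 => k _; exact: p0.
  apply: (@le_lt_trans _ _ (\int[mu]_(k in cell) ((Num.max C 0)%:E * (\1_(cellR l) k)%:E))).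
    apply: ge0_le_integral => //.
    - apply: measurable_funTS; apply: (measurable_pos (f := fun k : M => s (q (g *m U k)))).
      by case: hs => -> //; exact: measurable_funN.
    - apply: measurable_funTS; apply: emeasurable_funM; first exact: measurable_cst.
      by apply/measurable_EFinP; apply: measurable_indic; exact: (measurable_cellR HF).
    - move=> k ck; have [e0|ne] := eqVneq (q (g *m U k)) 0%R.
        have -> : s (q (g *m U k)) = 0%R by rewrite e0; case: hs => ->; rewrite ?oppr0.
        by rewrite maxxx -EFinM lee_fin mulr_ge0 // indicE.
      have [h1 h2] := hC k ck ne; rewrite indicE mem_set // mule1 lee_fin ge_max C0 andbT.
      rewrite le_max; apply/orP; left; apply: le_trans h2.
      by case: hs => ->; rewrite ?ler_norm // -normrN ler_norm.
  rewrite ge0_integralZl //; last first.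
    apply: measurable_funTS; apply/measurable_EFinP; apply: measurable_indic.
    exact: (measurable_cellR HF).
  rewrite integral_indic //; last exact: (measurable_cellR HF).
  apply: lte_mul_pinfty => //.
  apply: le_lt_trans (cellR_fin HF EE hmu l); apply: le_measure; rewrite ?inE.
  - by apply: measurableI => //; exact: (measurable_cellR HF).
  - exact: (measurable_cellR HF).
  - exact: subIsetl.
have /fineK <- := fin id (or_introl erefl); have /fineK <- := fin -%R (or_intror erefl).
rewrite -!EFinM -EFinB /= => /eqP; rewrite -mulrBr mulf_eq0 gt_eqF //= subr_eq0.
by move=> /eqP ->.
Qed.

End CuspidalAverage.

(** * Vanishing on bounded sets that are stable under U within the support *)

Section UnipotentVanishing.
Variables (R : realType) (F : fieldType) (v : F -> int).
Hypothesis HF : nonarch_local_field v.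
Variable n' : nat.
Local Notation n := n'.+1.
Local Notation mge := (mge v).
Local Notation M := (MXm v n).
Local Open Scope ereal_scope.
Variables (x E : 'M[F]_n).
Hypothesis EE : (E * E = E)%R.
Hypothesis dx : \det x != 0%R.
Hypothesis Ex : GRing.comm E x.
Hypothesis cE : forall s, GRing.comm s x -> GRing.comm s E.
Hypothesis E0 : E != 0%R.
Hypothesis E1 : E != 1%R.
Variable mu : {measure set M -> \bar R}.
Hypothesis hmu : haarG mu.
Hypothesis mu1 : mu (Gi v 0%R) = 1%E.
Local Notation U k := (unip_part E k).
Local Notation cell := (@cell F v n' E).
Local Notation cellR := (@cellR F v n' E).

Variable w : M -> R.
Hypothesis mw : measurable_fun setT w.
Hypothesis cw : real_cuspidal w.
Local Notation q g := (w (Defs.conjg g x)).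
Local Notation pos z := (Num.max z 0%R).

Variables (S : set M) (l0 : int) (C : R).
Hypothesis mS : measurable S.
Hypothesis SG : S `<=` @Gset F n.
Hypothesis Sl : forall g h : M, S g -> S h -> mge l0 (invmx (g : 'M[F]_n) *m (h : 'M[F]_n)).
Hypothesis SC : forall g : M, S g -> (`|q g| <= C)%R.
Hypothesis Sclosed : forall (g N : 'M[F]_n), S g -> nilp E N -> q g != 0%R ->
  q (g * (1 + N))%R != 0%R -> S (g * (1 + N))%R.

Local Notation l := (Num.min l0 0%R).
Let shift (p : M -> R) (g k : M) : R :=
  (\1_(cellR l) k * (\1_S ((g : 'M[F]_n) *m U k : M) * p ((g : 'M[F]_n) *m U k)))%R.

Let cancelE (a : R) (X Y : \bar R) : a != 0%R -> a%:E * X = a%:E * Y -> X = Y.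
Proof.
move=> a0 h; have e Z : Z = (a^-1)%:E * (a%:E * Z) by rewrite muleA -EFinM mulVf // mul1e.
by rewrite (e X) h -e.
Qed.

(** Tonelli's theorem, and right invariance of mu under each U k. *)
Lemma average_shift (p : M -> R) : measurable_fun setT p -> (forall g, 0 <= p g)%R ->
  mu (cellR l) * \int[mu]_(g in S) (p g)%:E = \int[mu]_g \int[mu]_k (shift p g k)%:E.
Proof.
move=> mp p0; have smu := haarG_sigma_finite HF hmu.
have mU := measurable_unip_part HF E; have mR := measurable_cellR HF E l.
have mfst : measurable_fun setT (fst : M * M -> M) by exact: measurable_fst.
have msnd : measurable_fun setT (snd : M * M -> M) by exact: measurable_snd.
have mSp : measurable_fun setT (fun g => \1_S g * p g)%R.
  by apply: measurable_funM => //; exact: measurable_indic.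
have mR1 : measurable_fun setT (\1_(cellR l) : M -> R) by exact: measurable_indic.
have mf : measurable_fun setT (fun z : M * M => (shift p z.1 z.2)%:E).
  apply/measurable_EFinP; apply: measurable_funM.
    exact: (measurableT_comp mR1 msnd).
  apply: (measurableT_comp mSp).
  by apply: (measurable_mulmx_fun HF) => //; exact: (measurableT_comp mU msnd).
have f0 z : 0 <= (shift p z.1 z.2)%:E by rewrite lee_fin !mulr_ge0 // indicE.
rewrite (tonelli smu smu mf f0) /=.
pose I := \int[mu]_(g in S) (p g)%:E.
have I0 : 0 <= I by apply: integral_ge0 => g _; rewrite lee_fin.
have eI : I = \int[mu]_g (\1_S g * p g)%:E.
  rewrite /I integral_mkcond; apply: eq_integral => g _; rewrite patchE indicE.
  by case: ifP => _; rewrite ?mul1r ?mul0r.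
transitivity (\int[mu]_k ((\1_(cellR l) k)%:E * I)).
  rewrite ge0_integralZr //; last 1 first.
  - by apply/measurable_EFinP; apply: measurable_indic.
  by rewrite integral_indicT.
apply: eq_integral => k _; have [hk|hk] := pselect (cellR l k); last first.
  rewrite indicE memNset // mul0e integral0_eq // => g _.
  by rewrite /shift indicE memNset // mul0r.
have dU : \det (U k) != 0%R.
  have [ck _] := hk; have := unip_det EE (cell_unip EE ck).
  by rewrite [(1 + _)%R]addrC subrK.
rewrite indicE mem_set // mul1e eI.
rewrite -(rinv_integral HF (haarG_rinv HF hmu mu1 dU) (f := fun g : M => (\1_S g * p g)%:E)).
- by apply: eq_integral => g _; rewrite /shift [\1_(cellR l) k]indicE mem_set // mul1r.
- exact/measurable_EFinP.
- by move=> g; rewrite lee_fin mulr_ge0 // indicE.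
Qed.

Lemma unip_vanish :
  \int[mu]_(g in S) (pos (q g))%:E = \int[mu]_(g in S) (pos (- q g))%:E.
Proof.
have mq : measurable_fun setT (fun g : M => q g) := measurableT_comp mw (measurable_conj HF x).
have fin : mu (cellR l) \is a fin_num by rewrite ge0_fin_numE // (cellR_fin HF EE hmu).
have /eqP nz := cellR_pos HF EE hmu mu1 l.
have fnz : fine (mu (cellR l)) != 0%R.
  by apply/eqP => h; apply: nz; rewrite -(fineK fin) h.
apply: (cancelE fnz); rewrite (fineK fin) !average_shift //; first last.
- by move=> g; rewrite le_max lexx orbT.
- by apply: measurable_maxr => //; exact: measurable_cst.
- by move=> g; rewrite le_max lexx orbT.
- by apply: measurable_maxr; [exact: measurable_funN|exact: measurable_cst].
apply: eq_integral => g _.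
have [[k0 [ck0 [Sk0 qk0]]]|no] := pselect (exists k0, cellR l k0 /\
    (S ((g : 'M[F]_n) *m U k0) /\ q ((g : 'M[F]_n) *m U k0) != 0%R)); last first.
  have z (s : R -> R) k : (s = id \/ s = -%R) -> shift (fun h : M => pos (s (q h))) g k = 0%R.
    move=> hs; rewrite /shift !indicE; have [hk|hk] := boolP (k \in cellR l); last by rewrite mul0r.
    have [Sk|Sk] := boolP (_ \in S); last by rewrite mul0r mulr0.
    have [->|ne] := eqVneq (q ((g : 'M[F]_n) *m U k)) 0%R.
      by case: hs => ->; rewrite ?oppr0 maxxx !mulr0.
    by case: no; exists k; rewrite inE in hk; rewrite inE in Sk.
  rewrite !integral0_eq // => k _; first by rewrite (z (fun z => - z)%R) //; right.
  by rewrite (z id) //; left.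
have dgU : \det ((g : 'M[F]_n) *m U k0) != 0%R by exact: SG.
have dg : \det (g : 'M[F]_n) != 0%R.
  by apply: contraNneq dgU; rewrite det_mulmx => ->; rewrite mul0r.
have key k : cell k -> q ((g : 'M[F]_n) *m U k) != 0%R -> cellR l k /\ S ((g : 'M[F]_n) *m U k).
  move=> ck qk; have [c0 m0] := ck0; have N0 := cell_unip EE c0; have N1 := cell_unip EE ck.
  have hN := nilpD N1 (nilpN N0).
  have e : (g : 'M[F]_n) *m U k =
     (((g : 'M[F]_n) *m U k0) * (1 + (U k - 1 - (U k0 - 1))))%R.
    rewrite -[RHS]mulrA; congr (_ *m _).
    have e0 : U k0 = (1 + (U k0 - 1))%R by rewrite addrC subrK.
    rewrite {1}e0 (unipM EE N0 hN) [((U k0 - 1) + _)%R]addrC subrK.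
    by rewrite addrC subrK.
  have Sk : S ((g : 'M[F]_n) *m U k).
    by rewrite e; apply: Sclosed => //; rewrite -e.
  split=> //; split=> //; have := Sl Sk0 Sk; rewrite e.
  have ugU : (g : 'M[F]_n) *m U k0 \in unitmx by rewrite det_unit.
  rewrite [invmx _ *m _](mulKmx ugU) => h.
  have h1 : mge 0 (1 : 'M[F]_n) by exact: mge1.
  have h2 : mge l (1 + (U k - 1 - (U k0 - 1)) - 1)%R.
    by apply: (mgeB HF); [apply: mgeW h|apply: mgeW h1]; rewrite ge_min lexx ?orbT.
  have -> : (U k - 1 = (1 + (U k - 1 - (U k0 - 1)) - 1) + (U k0 - 1))%R.
    by rewrite [(1 + _)%R]addrC addrK subrK.
  exact: (mgeD HF).
have fold (s : R -> R) : (s = id \/ s = -%R) ->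
   \int[mu]_k (shift (fun h : M => pos (s (q h))) g k)%:E =
   \int[mu]_(k in cell) (pos (s (q ((g : 'M[F]_n) *m U k))))%:E.
  move=> hs; rewrite [RHS]integral_mkcond; apply: eq_integral => k _; rewrite patchE /shift !indicE.
  case: ifPn => [/set_mem ck|hk]; last first.
    rewrite [k \in _]memNset ?mul0r //; move/negP: hk; rewrite inE => hk [h _].
    exact: hk.
  have [->|ne] := eqVneq (q ((g : 'M[F]_n) *m U k)) 0%R.
    by case: hs => ->; rewrite ?oppr0 maxxx !mulr0.
  by have [h1 h2] := key k ck ne; rewrite !mem_set // !mul1r.
rewrite (fold id (or_introl erefl)) (fold -%R (or_intror erefl)).
apply: (@cusp_orbit _ _ _ HF _ _ _ EE dx Ex cE E0 E1 _ hmu mu1 _ mw cw (g : 'M[F]_n) l C dg).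
by move=> k ck ne; have [h1 h2] := key k ck ne; split=> //; exact: SC.
Qed.

End UnipotentVanishing.

(** * Truncation of the orbital integral *)

Section ConjugationInvariants.
Variables (F : fieldType) (n' : nat).
Local Notation n := n'.+1.
Implicit Types g x : 'M[F]_n.

Lemma char_poly_conj g x : \det g != 0 -> char_poly (Defs.conjg g x) = char_poly x.
Proof.
move=> dg; have ug : g \in unitmx by rewrite det_unit.
pose P := map_mx polyC g; pose Q := map_mx polyC (invmx g).
have PQ : P *m Q = 1%:M by rewrite -map_mxM mulmxV // map_mx1.
have e : char_poly_mx (Defs.conjg g x) = P *m char_poly_mx x *m Q.
  rewrite /char_poly_mx /Defs.conjg !map_mxM mulmxBr mulmxBl; congr (_ - _).
  by rewrite scalar_mxC -mulmxA PQ mulmx1.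
rewrite /char_poly e !det_mulmx mulrAC -det_mulmx PQ det1 mul1r.
by [].
Qed.

Lemma discr_conj g x : \det g != 0 -> discr (Defs.conjg g x) = discr x.
Proof. by move=> dg; rewrite /discr char_poly_conj. Qed.

Lemma det_conj g x : \det g != 0 -> \det (Defs.conjg g x) = \det x.
Proof. by move=> dg; rewrite !det_mulmx det_inv mulrAC divff ?mul1r. Qed.

Lemma discr_separable x : discr x != 0 -> separable_poly (char_poly x).
Proof.
rewrite /discr mulf_eq0 negb_or => /andP[_]; rewrite resultant_eq0 -leqNgt => h.
rewrite unlock /coprimep eqn_leq h /= lt0n size_poly_eq0 gcdp_eq0 negb_and.
by rewrite monic_neq0 // char_poly_monic.
Qed.

End ConjugationInvariants.

Import HBNNSimple.
Section AmbientFunctions.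
Variables (R : realType) (F : fieldType) (v : F -> int).
Hypothesis HF : nonarch_local_field v.
Variable n' : nat.
Local Notation n := n'.+1.
Local Notation M := (MXm v n).
Local Open Scope ereal_scope.

(* The integrands of the theorem need not be measurable outside GL_n(F). *)
Lemma integral_eq_off_null (nu : {measure set M -> \bar R}) (G : set M) (f f' : M -> \bar R) :
  measurable G -> nu (~` G) = 0 -> (forall t, G t -> f t = f' t) ->
  \int[nu]_t f t = \int[nu]_t f' t.
Proof.
move=> mG nG; have ge0 (p p' : M -> \bar R) : (forall t, 0 <= p t) -> (forall t, 0 <= p' t) ->
    (forall t, G t -> p t = p' t) -> \int[nu]_t p t <= \int[nu]_t p' t.
  (* The integral of a nonnegative function, measurable or not, is a supremum over simple functions
     below it; such a simple function is cut off to G without changing its integral. *)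
  move=> p0 p'0 e; rewrite ge0_integralTE // ge0_integralTE //.
  apply: ge_ereal_sup => _ [h hp <-]; apply: ereal_sup_ubound.
  exists (proj_nnsfun h mG).
    move=> t /=; rewrite /mindic indicE; have [Gt|Gt] := pselect (G t).
      by rewrite mem_set // mulr1 -e.
    by rewrite memNset // mulr0.
  have mh : measurable_fun setT (h : M -> R) by exact: measurable_funPT.
  have mh' : measurable_fun setT (fun t => (h t)%:E) by exact/measurable_EFinP.
  rewrite -!integralT_nnsfun.
  rewrite -(integral_null mG nG mh'); last by move=> t; rewrite lee_fin fun_ge0.
  rewrite [RHS]integral_mkcond; apply: eq_integral => t _; rewrite patchE /= /mindic indicE.
  by case: ifP => _; rewrite ?mulr1 ?mulr0.
have ge0e (p p' : M -> \bar R) : (forall t, 0 <= p t) -> (forall t, 0 <= p' t) ->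
    (forall t, G t -> p t = p' t) -> \int[nu]_t p t = \int[nu]_t p' t.
  by move=> p0 p'0 e; apply/eqP; rewrite eq_le !ge0 // => t Gt; rewrite e.
move=> e; rewrite integralE [RHS]integralE; congr (_ - _); apply: ge0e => //.
- by move=> t Gt; rewrite !funeposE e.
- by move=> t Gt; rewrite !funenegE e.
Qed.

(** Smoothness is a condition on GL_n(F) only; the value 0 at singular matrices makes the function
    measurable. *)
Definition on_G (w : M -> R) (g : M) : R := if \det (g : 'M[F]_n) == 0%R then 0%R else w g.

Lemma on_GE w (g : M) : \det (g : 'M[F]_n) != 0%R -> on_G w g = w g.
Proof. by rewrite /on_G => /negbTE ->. Qed.

Variable m : M -> R[i].
Hypothesis Hsmooth : smooth_on_G m.
Variable p : R[i] -> R.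

Lemma measurable_on_G : measurable_fun setT (on_G (p \o m)).
Proof.
apply: (measurable_local HF) => [x dx|x y dx dy]; last by rewrite /on_G dx dy eqxx.
have [k hk] := Hsmooth dx; have [j hj] := val_det_near HF dx.
exists (Num.max k j) => y hy.
have [|dy _] := hj y; first by apply: ballW hy; rewrite le_max lexx orbT.
by rewrite !on_GE //= hk //; apply: ballW hy; rewrite le_max lexx.
Qed.

Lemma bounded_on_Cpt k l : exists C : R, forall g : M, Cpt k l g -> (`|p (m g)| <= C)%R.
Proof.
apply: (@compact_ind _ _ HF n (fun U : set M => exists C : R, forall g, U g -> `|p (m g)| <= C)%R).
- by exists 0%R.
- move=> A B [C1 h1] [C2 h2]; exists (Num.max C1 C2) => g [/h1 h|/h2 h].
    by rewrite le_max h.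
  by rewrite le_max h orbT.
- by move=> A B AB [C h]; exists C => g /AB /h.
- move=> x dx; have [j hj] := Hsmooth dx; exists j, `|p (m x)|%R => g /hj ->.
  exact: lexx.
Qed.

Lemma on_G_cuspidal : (forall s : seq 'M[F]_n, proper_flag s -> forall y : 'M[F]_n, \det y != 0%R ->
  forall nu : {measure set M -> \bar R}, haar_for (unip_rad s) (unip_rad s `&` Gi v 0%R) nu ->
    fine (\int[nu]_u (p (m ((u : 'M[F]_n) *m y)))%:E) = 0%R) -> real_cuspidal (on_G (p \o m)).
Proof.
move=> h s hs y dy nu hnu; rewrite -(h s hs y dy nu hnu); congr fine.
apply: (integral_eq_off_null (@measurable_Gset _ _ HF n)) => [|u du].
  have [n0 _ _] := hnu; apply: (@subset_measure0 _ _ _ nu _ (~` unip_rad s)) => //.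
  - exact: measurableC (@measurable_Gset _ _ HF n).
  - exact: measurableC (measurable_unip_rad HF s).
  - by apply: subsetC => u [].
by rewrite on_GE // det_mulmx mulf_neq0.
Qed.

End AmbientFunctions.

Section Adjoint.
Variables (R : realType) (F : fieldType) (v : F -> int).
Hypothesis HF : nonarch_local_field v.
Variable n' : nat.
Local Notation n := n'.+1.
Local Notation mge := (mge v).
Local Notation pw := (pw HF).
Local Notation M := (MXm v n).
Local Notation fundZ := (@fundZ F v n').

(** The exponent k is the valuation of the scalar factor, which leaves inequalities on g itself. *)
Lemma ZGiP (i : int) (g : 'M[F]_n) : ZGi v i g <->
  \det g != 0 /\ exists k, mge (k - i) g /\ v (\det g) - k * n%:Z <= i.
Proof.
split=> [[z [h [[a [a0 ->]] [[dh /ovGP[vh hh]] ->]]]]|[dg [k [hk vk]]]].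
  have da : \det (a%:M : 'M[F]_n) != 0 by rewrite det_scalar expf_neq0.
  split; first by rewrite det_mulmx mulf_neq0.
  exists (v a); split.
    rewrite mul_scalar_mx; apply: (mgeZ HF) => //.
    by rewrite vgeP.
  by rewrite val_detM // (val_scalar HF) // -[(v a *+ n)]mulr_natr natz addrAC subrr add0r.
have p0 := pw_neq0 HF k; have p0' := pw_neq0 HF (- k).
exists (pw k)%:M, (pw (- k) *: g); split; first by exists (pw k).
split; last by rewrite mul_scalar_mx scalerA pwKV scale1r.
split; first by rewrite detZ mulf_neq0 // expf_neq0.
apply/ovGP; split; last first.
  have -> : - i = - k + (k - i) by rewrite addKr.
  by apply/(mgeZ_pw HF).
rewrite detZ (valM HF) ?expf_neq0 // (valX HF) // val_pw.
by rewrite -[(- k *+ n)]mulr_natr natz mulNr addrC.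
Qed.

Lemma ZGi_mono i j : i <= j -> @ZGi F v n i `<=` @ZGi F v n j.
Proof.
move=> ij g /ZGiP[dg [k [hk vk]]]; apply/ZGiP; split=> //; exists k; split.
  by apply: mgeW hk; lia.
exact: le_trans ij.
Qed.

Lemma measurable_ZGi i : measurable (ZGi v i : set M).
Proof.
apply: (open_measurable HF) => g /ZGiP[dg [k [hk vk]]].
have [j hj] := val_det_near HF dg; exists (Num.max j (k - i)) => h hh.
have [|dh vh] := hj h; first by apply: ballW hh; rewrite le_max lexx.
apply/ZGiP; split=> //; exists k; split; last by rewrite vh.
rewrite -[h : 'M[F]_n](subrK g); apply: (mgeD HF) => //.
by have /mballE := hh; apply: mgeW; rewrite le_max lexx orbT.
Qed.

Lemma ZGi_fund (i : nat) (g : M) : ZGi v i%:Z g -> fundZ g ->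
  [/\ \det (g : 'M[F]_n) != 0, mge (- (2 * i)%N%:Z) (g : 'M[F]_n),
     0 <= v (\det (g : 'M[F]_n)) & v (\det (g : 'M[F]_n)) <= n%:Z].
Proof.
move=> /ZGiP[dg [k [hk vk]]] [_ /andP[v0 vn]]; split=> //; last exact: ltW.
apply: mgeW hk; move: v0 vk; move: (v _) => D v0 vk.
have : - i%:Z <= k by rewrite leNgt; apply/negP => lt; nia.
by lia.
Qed.

Lemma fund_ratio (b : nat) (g h : 'M[F]_n) : \det g != 0 -> mge (- b%:Z) g -> mge (- b%:Z) h ->
  v (\det g) <= n%:Z -> mge (- (n * b + n)%N%:Z) (invmx g *m h).
Proof.
move=> dg hg hh vg; apply: mgeW (mgeM HF (mge_inv HF dg hg) hh).
by rewrite -[((- b%:Z) *+ _)]mulr_natr natz; move: vg; move: (v _) => D; rewrite /=; nia.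
Qed.

Variables (x : 'M[F]_n) (r : nat) (e : 'I_r -> 'M[F]_n) (v0 : 'cV[F]_n).
Hypothesis sd : split_data x e v0.
Hypothesis dx : \det x != 0.
Variable H : nat.
Local Notation tame := (tame v x H).
Hypothesis tame1 : tame 1%:M.
Local Notation good := (good v e H).
Local Notation mingood := (mingood v e H).
Local Notation eJ := (eJ e).

Lemma mge_cong_mul k (X A : 'M[F]_n) : mge 1 X -> mge k A -> mge k ((1 + X) * A).
Proof.
move=> hX hA; rewrite mulrDl mul1r; apply: (mgeD HF) => //.
by apply: mgeW (mgeM HF hX hA); lia.
Qed.

Lemma cong_left (P : 'M[F]_n -> Prop) (X g : 'M[F]_n) :
  (forall X g, mge 1 X -> P g -> P ((1 + X) * g)) -> mge 1 X -> P ((1 + X) * g) -> P g.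
Proof.
move=> hP hX; have [Y hY eY] := cong_inv HF (lexx 1) hX.
move=> /(hP _ _ hY); rewrite mulrA.
have -> : (1 + Y) * (1 + X) = 1.
  have [d _] := cong_det HF hX.
  by rewrite -[1 + Y]/(1%:M + Y) -eY; apply: mulVmx; rewrite det_unit.
by rewrite mul1r.
Qed.

(** Left multiplication by a matrix congruent to 1 preserves the valuation of every matrix. This
    makes the set defined by [mingood] open, hence measurable. *)
Lemma good_cong J X g : mge 1 X -> good J g -> good J ((1 + X) * g).
Proof.
move=> hX gJ a b aJ bJ; have [N hN h] := gJ a b aJ bJ; exists N => // k.
rewrite -!mulrA => /(cong_left (fun X g => @mge_cong_mul k X g) hX) => hk.
by apply: mge_cong_mul => //; rewrite mulrA; apply: h.
Qed.

Lemma mingood_cong J X g : mge 1 X -> mingood J g -> mingood J ((1 + X) * g).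
Proof.
move=> hX [J0 JT gJ mJ]; split=> //; first exact: good_cong.
move=> J' pJ J'0 /(cong_left (fun X g => @good_cong J' X g) hX).
exact: mJ.
Qed.

Lemma measurable_mingood J : measurable [set g : M | \det (g : 'M[F]_n) != 0 /\ mingood J (g : 'M[F]_n)].
Proof.
apply: (open_measurable HF) => g [dg hg]; have [c hc] := mge_ex v (invmx g).
have [j hj] := val_det_near HF dg; exists (Num.max j (1 - c)) => h hh.
have [|dh _] := hj h; first by apply: ballW hh; rewrite le_max lexx.
split=> //; have -> : (h : 'M[F]_n) = (1 + (h - g) *m invmx g) * g.
  rewrite mulrDl mul1r -[_ *m invmx g * g]/((h - g) *m invmx g *m g).
  by rewrite mulmxKV ?det_unit // addrC subrK.
apply: mingood_cong => //; have -> : 1 = 1 - c + c by rewrite subrK.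
have /mballE hh' := hh; apply: (mgeM HF) => //.
by apply: mgeW hh'; rewrite le_max lexx orbT.
Qed.

Lemma eJ_neq0 J : J != finset.set0 -> eJ J != 0.
Proof.
move=> /finset.set0Pn[a aJ]; have [h _] := eJ_in sd aJ.
by apply: contraNneq (sd_nz sd a) => e0; rewrite -h e0 mul0r.
Qed.

Lemma eJ_neq1 J : J != [set: 'I_r]%SET -> eJ J != 1.
Proof.
move=> JT; have [b bJ] : exists b, b \notin J.
  apply/not_existsP => h; move/eqP: JT; apply; apply/eqP.
  rewrite finset.eqEsubset finset.subsetT; apply/fintype.subsetP => b _.
  by apply/negPn/negP; exact: h.
have [h _] := eJ_notin sd bJ.
by apply: contraNneq (sd_nz sd b) => e1; rewrite -h e1 mul1r.
Qed.

Variable mu : {measure set M -> \bar R}.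
Hypothesis hmu : haarG mu.
Hypothesis mu1 : mu (Gi v 0) = 1%E.
Variable w : M -> R.
Hypothesis mw : measurable_fun setT w.
Hypothesis cw : real_cuspidal w.
Local Notation q g := (w (Defs.conjg g x)).
Local Notation pos z := (Num.max z 0).
Hypothesis tame_q : forall g : 'M[F]_n, \det g != 0 -> q g != 0 -> tame g.
Variable i : nat.
Variable C : R.
(** The depth in [mingood_ex], increased by n because determinants on [fundZ] have valuation up to n
    - 1. *)
Local Notation i0 := (n + (n * (3 * H + 1) + 4 * H + 1))%N.
Hypothesis i0i : (i0 <= i)%N.
Hypothesis qC : forall g : M, ZGi v i%:Z g -> fundZ g -> `|q g| <= C.

Definition shell : set M := (ZGi v i%:Z `&` fundZ) `\` ZGi v i0%:Z.

Lemma measurable_shell : measurable shell.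
Proof.
apply: measurableD; last exact: measurable_ZGi.
by apply: measurableI; [exact: measurable_ZGi|exact: measurable_fundZ].
Qed.

Lemma shell_mingood g : shell g -> q g != 0 -> exists J, mingood J g.
Proof.
move=> [[/ZGiP[dg _] [_ /andP[v0' vn]]] out] qg; have tg := tame_q dg qg.
apply: (mingood_ex HF sd tame1 tg v0') => h; apply: out; apply/ZGiP; split=> //.
exists 0; split; first by apply: mgeW h; lia.
by rewrite mul0r subr0; apply: ltW; apply: lt_le_trans vn _; lia.
Qed.

Definition stratum J : set M := shell `&` [set g : M | \det (g : 'M[F]_n) != 0 /\ mingood J (g : 'M[F]_n)].

Lemma measurable_stratum J : measurable (stratum J).
Proof. by apply: measurableI; [exact: measurable_shell|exact: measurable_mingood]. Qed.

Lemma ZGi_unip J N (g : 'M[F]_n) (j : int) : tame g -> tame (g * (1 + N)) -> nilp (eJ J) N ->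
  mingood J g -> ZGi v j g -> ZGi v j (g * (1 + N)).
Proof.
move=> tg tgu hN mg /ZGiP[dg [k [hk vk]]]; have EE := eJ_idem sd J.
apply/ZGiP; split; first by case: tgu.
exists k; split; first exact: (mingood_mge HF sd tame1 tg tgu hN mg hk).
by rewrite val_detM ?(unip_det EE) // (unip_val_det HF EE) // addr0.
Qed.

(** [unip_vanish] for E = e_J, the stratum being stable by [mingood_unip] and [ZGi_unip]. Staying
    outside Z(G) G_{i0} is [ZGi_unip] read backwards, from g u to g. *)
Lemma stratum_vanish J :
  (\int[mu]_(g in stratum J) (pos (q g))%:E = \int[mu]_(g in stratum J) (pos (- q g))%:E)%E.
Proof.
have [[g0 [_ [_ [J0 JT _ _]]]]|no] := pselect (exists g, stratum J g); last first.
  have -> : stratum J = set0 by apply/seteqP; split=> // g Jg; case: no; exists g.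
  by rewrite !integral_set0.
have EE := eJ_idem sd J; have cE s : GRing.comm s x -> GRing.comm s (eJ J).
  by move=> cs; exact: (sd_comm sd cs (eJ_comm sd J)).
have bnd g : stratum J g -> [/\ \det g != 0, mge (- (2 * i)%N%:Z) g, 0 <= v (\det g) & v (\det g) <= n%:Z].
  by move=> [[[h1 h2] _] _]; exact: ZGi_fund.
apply: (@unip_vanish R F v HF n' x (eJ J) EE dx (eJ_comm sd J) cE (eJ_neq0 J0) (eJ_neq1 JT)
  mu hmu mu1 w mw cw (stratum J) (- (n * (2 * i) + n)%N%:Z) C (measurable_stratum J)).
- by move=> g /bnd[].
- by move=> g h /bnd[d1 h1 _ v1] /bnd[_ h2 _ _]; exact: fund_ratio.
- by move=> g [[[h1 h2] _] _]; exact: qC.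
move=> g N [[[zg [dg fg]] out] [_ mg]] hN qg qgu.
have dgu : \det (g * (1 + N)) != 0 by rewrite det_mulmx mulf_neq0 // (unip_det EE).
have tg := tame_q dg qg; have tgu := tame_q dgu qgu.
have mgu := mingood_unip HF sd tg hN mg.
have eg : g * (1 + N) * (1 - N) = g.
  by rewrite -mulrA (unipM EE) ?subrr ?addr0 ?mulr1 //; exact: nilpN.
split; last by split.
split; first split.
- exact: (ZGi_unip tg tgu hN mg zg).
- by split=> //; rewrite val_detM ?(unip_det EE) // (unip_val_det HF EE) // addr0.
move=> zgu; apply: out; have := ZGi_unip tgu _ (nilpN hN) mgu zgu.
by rewrite eg; apply.
Qed.

(** On the support of q each point of the shell has exactly one minimal good set, by [shell_mingood]
    and [mingood_uniq]; off the support all integrands vanish. *)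
Lemma shell_split (s : R -> R) : s = id \/ s = -%R ->
  (\int[mu]_(g in shell) (pos (s (q g)))%:E =
   \sum_(J : {set 'I_r}) \int[mu]_(g in stratum J) (pos (s (q g)))%:E)%E.
Proof.
move=> hs; pose P (g : M) : \bar R := (pos (s (q g)))%:E.
have mq : measurable_fun setT (fun g : M => q g) := measurableT_comp mw (measurable_conj HF x).
have mP : measurable_fun setT P.
  apply: (measurable_pos (f := fun g : M => s (q g))).
  by case: hs => -> //; exact: measurable_funN.
have P0 g : (0 <= P g)%E by rewrite lee_fin le_max lexx orbT.
rewrite integral_mkcond.
under [RHS]eq_bigr do rewrite integral_mkcond.
rewrite -ge0_integral_sum //.
- apply: eq_integral => g _; rewrite patchE.
  have sum0 : q g = 0 -> (\sum_(J : {set 'I_r}) (P \_ (stratum J)) g = 0)%E.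
    move=> q0; rewrite big1 // => J _; rewrite patchE; case: ifP => // _.
    by rewrite /P q0; case: hs => ->; rewrite ?oppr0 maxxx.
  have [q0|ne] := eqVneq (q g) 0.
    rewrite [RHS](sum0 q0); case: ifP => // _.
    by rewrite q0; case: hs => ->; rewrite ?oppr0 maxxx.
  case: ifPn => [/set_mem sg|out]; last first.
    rewrite big1 // => J _; rewrite patchE memNset // => -[sg _].
    by move/negP: out; apply; rewrite inE.
  have [J mJ] := shell_mingood sg ne; have [[/ZGiP[dg _] _] _] := sg.
  rewrite (bigD1 J) //= big1 ?adde0; first by rewrite patchE mem_set.
  move=> J' ne'; rewrite patchE memNset // => -[_ [_ mJ']].
  move/eqP: ne'; apply.
  exact: (mingood_uniq HF sd (tame_q dg ne) mJ' mJ).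
- move=> J; apply/(measurable_restrictT _ (measurable_stratum J)).
  exact: measurable_funTS.
- by move=> J g _; rewrite patchE; case: ifP => _; [exact: P0|exact: lexx].
Qed.

Lemma shell_vanish :
  (\int[mu]_(g in shell) (pos (q g))%:E = \int[mu]_(g in shell) (pos (- q g))%:E)%E.
Proof.
rewrite (shell_split (s := id)); last by left.
rewrite (shell_split (s := -%R)); last by right.
by apply: eq_bigr => J _; exact: stratum_vanish.
Qed.

End Adjoint.

Section Truncation.
Variables (R : realType) (F : fieldType) (v : F -> int).
Hypothesis HF : nonarch_local_field v.
Variable n' : nat.
Local Notation n := n'.+1.
Local Notation M := (MXm v n).
Local Notation fundZ := (@fundZ F v n').

Lemma conj_stab (g z x : 'M[F]_n) : \det g != 0 -> \det z != 0 -> z *m x = x *m z ->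
  Defs.conjg (g *m z) x = Defs.conjg g x.
Proof.
rewrite -!det_unit => ug uz zx; rewrite /Defs.conjg -(mulmxA g z x) zx mulmxA.
have ugz : g *m z \in unitmx by rewrite unitmx_mul ug.
have -> : invmx (g *m z) = invmx z *m invmx g.
  by apply: (can_inj (mulKmx ugz)); rewrite mulmxV // -mulmxA (mulmxA z) mulmxV // mul1mx mulmxV.
by rewrite !mulmxA mulmxK.
Qed.

Lemma ZGi_Zmul (i : int) (g z : 'M[F]_n) : Zset z -> ZGi v i g -> ZGi v i (g *m z).
Proof.
move=> [a [a0 ->]] [_ [h [[b [b0 ->]] [hh ->]]]]; exists (b * a)%:M, h; split.
  by exists (b * a); rewrite mulf_neq0.
by split=> //; rewrite scalar_mxC mulmxA -scalar_mxM mulrC.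
Qed.

Lemma ZGi_Z (i : int) (g z : 'M[F]_n) : Zset z -> ZGi v i (g *m z) <-> ZGi v i g.
Proof.
move=> Zz; split; last exact: ZGi_Zmul.
have Zi : Zset (invmx z).
  by have [a [a0 ->]] := Zz; exists a^-1; rewrite invr_neq0 // invmx_scalar.
move=> /(ZGi_Zmul Zi); rewrite mulmxK // det_unit.
exact: (ZsetG Zz).
Qed.

Variables (x : 'M[F]_n) (r : nat) (e : 'I_r -> 'M[F]_n) (v0 : 'cV[F]_n).
Hypothesis sd : split_data x e v0.
Hypothesis dx : \det x != 0.
Variable H : nat.
Local Notation tame := (tame v x H).
Hypothesis tame1 : tame 1%:M.
Variable mu : {measure set M -> \bar R}.
Hypothesis hmu : haarG mu.
Hypothesis mu1 : mu (Gi v 0) = 1%E.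
Variable w : M -> R.
Hypothesis mw : measurable_fun setT w.
Hypothesis cw : real_cuspidal w.
Local Notation q g := (w (Defs.conjg g x)).
Local Notation pos z := (Num.max z 0).
Hypothesis tame_q : forall g : 'M[F]_n, \det g != 0 -> q g != 0 -> tame g.
Hypothesis qC : forall i : nat, exists C, forall g : M, ZGi v i%:Z g -> fundZ g -> `|q g| <= C.
Local Notation i0 := (n + (n * (3 * H + 1) + 4 * H + 1))%N.
Local Notation trunc i := (ZGi v i%:Z `&` fundZ).
Local Notation shell i := (@shell F v n' H i).
Variables (nu : {measure set M -> \bar R}) (psi : M -> R).
Hypothesis hnu : haar_for Zset (@Zcpt F v n) nu.
Hypothesis hpsi : quot_weight nu psi.
Local Open Scope ereal_scope.

Lemma measurable_trunc (i : nat) : measurable (trunc i : set M).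
Proof. by apply: measurableI; [exact: measurable_ZGi|exact: measurable_fundZ]. Qed.

Let mq : measurable_fun setT (fun g : M => q g).
Proof. exact: (measurableT_comp mw (measurable_conj HF x)). Qed.

Let sq (s : R -> R) : Prop := s = id \/ s = -%R.

Let mpos s : sq s -> measurable_fun setT (fun g : M => (pos (s (q g)))%:E).
Proof.
move=> hs; apply: (measurable_pos (f := fun g : M => s (q g))).
by case: hs => -> //; exact: measurable_funN.
Qed.

Let pos0 (s : R -> R) (g : M) : 0 <= (pos (s (q g)))%:E.
Proof. by rewrite lee_fin le_max lexx orbT. Qed.

Let pos_abs (s : R -> R) (g : M) : sq s -> (pos (s (q g)) <= `|q g|)%R.
Proof.
by move=> hs; rewrite ge_max normr_ge0 andbT; case: hs => ->; rewrite ?ler_norm // -normrN ler_norm.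
Qed.

(** The integrand without psi is invariant under the centre, so [Z_unfold] applies. *)
Lemma trunc_unfold (s : R -> R) (i : nat) : sq s ->
  \int[mu]_(g in ZGi v i%:Z) (pos (s (q g)) * psi g)%:E =
  \int[mu]_(g in trunc i) (pos (s (q g)))%:E.
Proof.
move=> hs; pose G (g : M) : R := (\1_(ZGi v i%:Z : set M) g * pos (s (q g)))%R.
have mG : measurable_fun setT G.
  apply: measurable_funM; first by apply: measurable_indic; exact: measurable_ZGi.
  by have /measurable_EFinP := mpos hs.
have G0 g : (0 <= G g)%R by rewrite mulr_ge0 ?indicE // le_max lexx orbT.
have GZ (g t : M) : Zset t -> G ((g : 'M[F]_n) *m (t : 'M[F]_n)) = G g.
  move=> Zt; rewrite /G !indicE; have [h|h] := pselect (ZGi v i%:Z g); last first.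
    by rewrite !memNset ?mul0r //; apply: contra_not h => /(ZGi_Z _ _ Zt).
  have /(ZGiP HF)[dg _] := h; have [a [a0 et]] := Zt.
  have dt : \det (t : 'M[F]_n) != 0%R by exact: (ZsetG Zt).
  have ct : (t : 'M[F]_n) *m x = x *m (t : 'M[F]_n) by rewrite et scalar_mxC.
  by rewrite (conj_stab dg dt ct) !mem_set //; exact: ZGi_Zmul.
have := Z_unfold HF hmu mu1 hnu hpsi mG G0 GZ.
have -> : \int[mu]_g (G g * psi g)%:E = \int[mu]_(g in ZGi v i%:Z) (pos (s (q g)) * psi g)%:E.
  rewrite [RHS]integral_mkcond; apply: eq_integral => g _; rewrite patchE /G indicE.
  by case: ifP => _; rewrite ?mul1r ?mul0r.
move=> ->; rewrite [RHS]integral_mkcond; apply: eq_integral => g _; rewrite patchE /G !indicE.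
case: ifPn => [/set_mem[h1 h2]|/negP h]; first by rewrite !mem_set // mul1r mulr1.
have [h1|h1] := pselect (ZGi v i%:Z g); last by rewrite [g \in ZGi _ _]memNset // !mul0r.
rewrite [g \in fundZ]memNset ?mulr0 // => h2; apply: h.
exact: mem_set.
Qed.

Lemma trunc_fin (s : R -> R) (i : nat) : sq s -> \int[mu]_(g in trunc i) (pos (s (q g)))%:E \is a fin_num.
Proof.
move=> hs; have [C hC] := qC i; have mT := measurable_trunc i.
rewrite ge0_fin_numE; last by apply: integral_ge0 => g _; exact: pos0.
apply: (@le_lt_trans _ _ (\int[mu]_(g in trunc i) (Num.max C 0)%:E)).
  apply: ge0_le_integral => //.
  - by apply: measurable_funTS; exact: mpos.
  - move=> g [h1 h2]; rewrite lee_fin le_max; apply/orP; left.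
    exact: le_trans (pos_abs g hs) (hC g h1 h2).
rewrite integral_cst //; apply: lte_mul_pinfty => //.
  by rewrite lee_fin le_max lexx orbT.
apply: le_lt_trans (mu_Cpt HF hmu (- (2 * i)%N%:Z)%R n%:Z); apply: le_measure; rewrite ?inE //.
  exact: measurable_Cpt.
by move=> g [h1 h2]; have [d1 d2 d3 d4] := ZGi_fund HF h1 h2.
Qed.

(** Beyond i0 the truncation only gains a shell, on which positive and negative parts have equal
    integrals. *)
Lemma trunc_diff (i : nat) : exists j : nat, (j <= i0)%N /\
  (fine (\int[mu]_(g in trunc i) (pos (q g))%:E) - fine (\int[mu]_(g in trunc i) (pos (- q g))%:E) =
   fine (\int[mu]_(g in trunc j) (pos (q g))%:E) - fine (\int[mu]_(g in trunc j) (pos (- q g))%:E))%R.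
Proof.
have [|lt] := leqP i i0; first by exists i.
exists i0; split=> //; have [C hC] := qC i.
have hv := shell_vanish HF sd dx tame1 hmu mu1 mw cw tame_q (ltnW lt) hC.
have ms := @measurable_shell F v HF n' H i.
have sub : trunc i0 `<=` trunc i.
  by move=> g [h1 h2]; split=> //; apply: (ZGi_mono HF _ h1); rewrite lez_nat ltnW.
have dec : trunc i = trunc i0 `|` shell i.
  apply/seteqP; split=> g; last by case=> [/sub//|[h _]].
  by move=> h; have [h'|h'] := pselect (ZGi v i0%:Z g); [left|right]; case: h.
have disj : [disjoint trunc i0 & shell i].
  by apply/disj_setPRL => g [_ h] [h' _].
have add s : sq s -> fine (\int[mu]_(g in trunc i) (pos (s (q g)))%:E) =
   (fine (\int[mu]_(g in trunc i0) (pos (s (q g)))%:E) +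
    fine (\int[mu]_(g in shell i) (pos (s (q g)))%:E))%R.
  move=> hs; have f1 := trunc_fin i0 hs; have f2 := trunc_fin i hs.
  have e1 : \int[mu]_(g in trunc i) (pos (s (q g)))%:E =
    \int[mu]_(g in trunc i0) (pos (s (q g)))%:E + \int[mu]_(g in shell i) (pos (s (q g)))%:E.
    rewrite dec ge0_integral_setU //; first exact: measurable_trunc.
    by apply: measurable_funTS; exact: mpos.
  rewrite e1 fineD //; move: f2; rewrite e1 fin_numD => /andP[_ //].
have := add id (or_introl erefl); have := add -%R (or_intror erefl).
by move=> /= -> ->; rewrite hv opprD addrACA subrr addr0.
Qed.

(** A difference of two nonnegative numbers is at most the larger one in absolute value, and both
    are bounded by the integral of |q| over the truncation at i0, whatever i is. *)
Lemma component_bound (i : nat) :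
  `|fine (\int[mu]_(g in ZGi v i%:Z) (q g * psi g)%:E)|%:E <=
  \int[mu]_(g in trunc i0) `|q g|%:E.
Proof.
have [psi0 mpsi _] := hpsi.
rewrite integralE.
have -> : \int[mu]_(g in ZGi v i%:Z) (fun g : M => (q g * psi g)%:E)^\+ g =
    \int[mu]_(g in trunc i) (pos (q g))%:E.
  rewrite -(trunc_unfold (s := id)); last by left.
  by apply: eq_integral => g _; rewrite funeposE -EFin_max maxr_pMl ?mul0r.
have -> : \int[mu]_(g in ZGi v i%:Z) (fun g : M => (q g * psi g)%:E)^\- g =
    \int[mu]_(g in trunc i) (pos (- q g))%:E.
  rewrite -(trunc_unfold (s := -%R)); last by right.
  by apply: eq_integral => g _; rewrite funenegE -EFinN -EFin_max -mulNr maxr_pMl ?mul0r.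
have F1 j := trunc_fin (s := id) j (or_introl erefl).
have F2 j := trunc_fin (s := -%R) j (or_intror erefl).
rewrite fineB; [|exact: F1|exact: F2].
have [j [ji ->]] := trunc_diff i.
have le s : sq s -> \int[mu]_(g in trunc j) (pos (s (q g)))%:E <= \int[mu]_(g in trunc i0) `|q g|%:E.
  move=> hs; have sub : trunc j `<=` trunc i0.
    by move=> g [h1 h2]; split=> //; apply: (ZGi_mono HF _ h1); rewrite lez_nat.
  apply: le_trans (ge0_subset_integral mu (measurable_trunc j) (measurable_trunc i0) _ _ sub) _.
  - by apply: measurable_funTS; exact: mpos.
  - by move=> g _; exact: pos0.
  apply: ge0_le_integral => //.
  - exact: measurable_trunc.
  - by apply: measurable_funTS; exact: mpos.
  - apply: measurable_funTS; apply/measurable_EFinP.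
    exact: (measurableT_comp (@normr_measurable R setT) mq).
  - by move=> g _; rewrite lee_fin; exact: pos_abs.
have := le id (or_introl erefl); have := le -%R (or_intror erefl).
rewrite /= -(fineK (F1 j)) -(fineK (F2 j)) /=.
have p1 : (0 <= fine (\int[mu]_(g in trunc j) (pos (q g))%:E))%R.
  by apply: fine_ge0; apply: integral_ge0 => g _; exact: (pos0 id).
have p2 : (0 <= fine (\int[mu]_(g in trunc j) (pos (- q g))%:E))%R.
  by apply: fine_ge0; apply: integral_ge0 => g _; exact: (pos0 -%R).
move: p1 p2; move: (fine _) (fine _) => A B A0 B0 hB hA.
have [AB|AB] := leP A B.
  by apply: le_trans hA; rewrite lee_fin ler_norml; apply/andP; split; lra.
by apply: le_trans hB; rewrite lee_fin ler_norml; apply/andP; split; lra.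
Qed.

End Truncation.

(** * The polynomial bound *)

(** Taking the value at 1 as the constant makes the class closed under sums and multiples without
    existentials, and the final polynomial explicit. *)
Definition linear_growth (f : nat -> nat) : Prop := forall o, (f o <= f 1 * o.+1)%N.

Lemma growth_const k : linear_growth (fun=> k).
Proof. by move=> o; rewrite mulnS leq_addr. Qed.

Lemma growth_id : linear_growth id.
Proof. by move=> o; rewrite mul1n. Qed.

Lemma growthD f g : linear_growth f -> linear_growth g -> linear_growth (fun o => f o + g o)%N.
Proof. by move=> hf hg o; rewrite mulnDl leq_add. Qed.

Lemma growthM k f : linear_growth f -> linear_growth (fun o => k * f o)%N.
Proof. by move=> hf o; rewrite -mulnA leq_mul2l hf orbT. Qed.

Lemma leq_exp2rW m k e : (m <= k)%N -> (m ^ e <= k ^ e)%N.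
Proof. by case: e => [|e] h //; rewrite leq_exp2r. Qed.

(** For o >= 1 use o + 1 <= 2 o; for o = 0 the term 0^0 = 1 suffices. *)
Lemma pow_sum_bound (o k : nat) : (o.+1 ^ k <= 2 ^ k * \sum_(j < k.+1) o ^ j)%N.
Proof.
case: o => [|o].
  by rewrite exp1n muln_gt0 expn_gt0 /= big_ord_recl expn0.
apply: (@leq_trans ((2 * o.+1) ^ k)); first by apply: leq_exp2rW; lia.
by rewrite expnMn leq_mul2l big_ord_recr /= leq_addl orbT.
Qed.

Section Constants.
Variables n c : nat.

(** [pb_horner_bound] for entries of valuation at least - (o + 2c), as in [conj_ZGi_mge], and d = o.
    Below, [depth_const] is the resulting i0, and [fiber_const] the number 2D + 1 of [torus_count]
    for b = 2 i0. *)
Definition tame_const (o : nat) : nat := (4 * (n * n) * (o + 2 * c) + o)%N.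
Definition depth_const (o : nat) : nat :=
  (n + (n * (3 * tame_const o + 1) + 4 * tame_const o + 1))%N.
Definition fiber_const (o : nat) : nat :=
  (n * (n * (2 * depth_const o) + n + tame_const o)).*2.+1.

Lemma growth_fiber : linear_growth fiber_const.
Proof.
have gt : linear_growth tame_const.
  apply: growthD; last exact: growth_id.
  by apply: growthM; apply: growthD; [exact: growth_id|exact: growth_const].
have gd : linear_growth depth_const.
  apply: growthD; first exact: growth_const.
  apply: growthD; last exact: growth_const.
  apply: growthD; last exact: growthM.
  apply: growthM; apply: growthD; last exact: growth_const.
  exact: growthM.
suff : linear_growth (fun o => 2 * (n * (n * (2 * depth_const o) + n + tame_const o)) + 1)%N.
  by move=> h o; have := h o; rewrite /fiber_const !addn1 !mul2n.
apply: growthD; last exact: growth_const.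
do 2!apply: growthM; apply: growthD => //; apply: growthD; last exact: growth_const.
by do 2!apply: growthM.
Qed.

(** All coefficients are equal, as in [pow_sum_bound]; the outer factor 2 accounts for real and
    imaginary parts. *)
Definition bound_poly : {poly nat} :=
  \poly_(j < n.+1) (2 * ((2 * fiber_const 1) ^ n))%N.

Lemma bound_polyE (R : realType) (o : nat) : (2 * fiber_const o ^ n)%N%:R <=
  (map_poly (fun k : nat => k%:R : R) bound_poly).[o%:R].
Proof.
have -> : map_poly (fun k : nat => k%:R : R) bound_poly =
    \poly_(j < n.+1) (2 * ((2 * fiber_const 1) ^ n))%N%:R.
  by apply/polyP => j; rewrite coef_map_id0 // !coef_poly; case: ifP.
rewrite horner_poly.
have -> : \sum_(j < n.+1) (2 * (2 * fiber_const 1) ^ n)%N%:R * (o%:R : R) ^+ j =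
    (2 * (2 * fiber_const 1) ^ n * \sum_(j < n.+1) o ^ j)%N%:R.
  rewrite [RHS]natrM natr_sum mulr_sumr; apply: eq_bigr => j _.
  by rewrite natrX.
rewrite ler_nat -mulnA leq_mul2l /=.
apply: (@leq_trans ((fiber_const 1 * o.+1) ^ n)).
  by apply: leq_exp2rW; exact: growth_fiber.
rewrite !expnMn -mulnA [(2 ^ n * _)%N]mulnC -mulnA leq_mul2l.
by rewrite [X in (_ <= X)%N]mulnC pow_sum_bound orbT.
Qed.

End Constants.

Lemma cmod_Re (R : realType) (z : R[i]) : `|complex.Re z| <= cmod z.
Proof.
rewrite /cmod -sqrtr_sqr ler_sqrt ?lerDl ?sqr_ge0 //.
by rewrite addr_ge0 ?sqr_ge0.
Qed.

Lemma cmod_Im (R : realType) (z : R[i]) : `|complex.Im z| <= cmod z.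
Proof.
rewrite /cmod -sqrtr_sqr ler_sqrt ?lerDr ?sqr_ge0 //.
by rewrite addr_ge0 ?sqr_ge0.
Qed.

Lemma cmod_le (R : realType) (z : R[i]) : cmod z <= `|complex.Re z| + `|complex.Im z|.
Proof.
rewrite /cmod -[X in _ <= X]ger0_norm ?addr_ge0 // -sqrtr_sqr ler_sqrt ?sqr_ge0 //.
rewrite sqrrD !real_normK ?num_real // addrAC lerDl.
by rewrite mulrn_wge0 // mulr_ge0.
Qed.

Lemma Re_mulr (R : realType) (z : R[i]) (t : R) : complex.Re (z * t%:C%C) = complex.Re z * t.
Proof. by case: z => a b /=; rewrite mulr0 subr0. Qed.

Lemma Im_mulr (R : realType) (z : R[i]) (t : R) : complex.Im (z * t%:C%C) = complex.Im z * t.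
Proof. by case: z => a b /=; rewrite mulr0 add0r. Qed.

Section Support.
Variables (F : fieldType) (v : F -> int).
Hypothesis HF : nonarch_local_field v.
Variable n' : nat.
Local Notation n := n'.+1.
Local Notation mge := (mge v).
Variable x : 'M[F]_n.
Hypothesis hx : rss x.

(** A negative ov_G(x) would mean integral entries with a determinant of negative valuation. *)
Lemma ovrss_ge0 : 0 <= ovrss v x.
Proof.
have [dx _] := hx; rewrite /ovrss le_max; apply/orP; left.
have [h1 h2] := (ovGP v (ovG v x) x).1 (lexx _).
have := vge_det HF h2; rewrite vgeP // -[((- _) *+ _)]mulr_natr natz.
rewrite leNgt; move: h1; move: (ovG v x) (v _) => a b h1 h3; apply/negP => h4; nia.
Qed.

Variables o c : nat.
Hypothesis ho : ovrss v x <= o%:Z.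

Lemma rss_bounds : [/\ \det x != 0, mge (- o%:Z) x, v (\det x) <= o%:Z & v (discr x) <= o%:Z].
Proof.
have [dx _] := hx; move: ho; rewrite /ovrss ge_max => /andP[/ovGP[h1 h2] h3].
by split.
Qed.

(** The conjugate has the determinant of x, of valuation at least - n o. This bounds the scalar
    exponent below by - (o + c), and the entries lose c more. *)
Lemma conj_ZGi_mge (g : 'M[F]_n) : \det g != 0 -> ZGi v c%:Z (Defs.conjg g x) ->
  mge (- (o + 2 * c)%N%:Z) (Defs.conjg g x).
Proof.
move=> dg /(ZGiP HF)[_ [k [hk vk]]]; have [dx h1 h2 _] := rss_bounds.
apply: mgeW hk; move: vk; rewrite (det_conj x dg).
have := vge_det HF h1; rewrite vgeP // -[((- _) *+ _)]mulr_natr natz.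
move: (v _) => D h3 h4; have : - (o + c)%N%:Z <= k.
  by rewrite leNgt; apply/negP => lt; nia.
by lia.
Qed.

(** Conjugation by g turns f(x) into f(g x g^-1), so [pb_horner_bound] is applied to the conjugate,
    which has the same discriminant. *)
Lemma tame_conj (g : 'M[F]_n) (r : nat) (e : 'I_r -> 'M[F]_n) (v0 : 'cV[F]_n) :
  split_data x e v0 -> \det g != 0 -> mge (- (o + 2 * c)%N%:Z) (Defs.conjg g x) ->
  tame v x (tame_const n c o) g.
Proof.
move=> sd dg hg; have [dx h1 h2 h3] := rss_bounds; have [_ ddx] := hx.
split=> // s cs ps; have [f ef] := sd_horner sd cs.
have ug : g \is a GRing.unit by rewrite -[_ \is a _]/(g \in unitmx) det_unit.
have eg : g *m s *m invmx g = horner_mx (Defs.conjg g x) f.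
  by rewrite (horner_mx_uconj f x ug) -ef.
have pg : pb v (horner_mx (Defs.conjg g x) f) by rewrite -eg; exact: pb_conj.
have := pb_horner_bound HF (_ : 0 <= (o + 2 * c)%N%:Z) hg _ _ pg.
rewrite (discr_conj x dg) eg => /(_ o%:Z isT ddx h3).
by apply: mgeW; rewrite /tame_const; lia.
Qed.

End Support.

(** Real and imaginary parts of m are bounded separately, each by the integral of |m| over the
    truncation, whence the factor 2; this integral is then folded along G_x. *)
Lemma final_bound (R : realType) (F : fieldType) (v : F -> int) (n' : nat)
  (HF : nonarch_local_field v)
  (muG : {measure set (MXm v n'.+1) -> \bar R}) (HmuG : haar_for Gset (Gi v 0) muG)
  (muZ : {measure set (MXm v n'.+1) -> \bar R}) (HmuZ : haar_for Zset (@Zcpt F v n'.+1) muZ)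
  (m : MXm v n'.+1 -> R[i])
  (Hsmooth : smooth_on_G m) (Hcusp : cuspidal m) (c : nat)
  (Hcpt : forall g : MXm v n'.+1, \det (g : 'M[F]_n'.+1) != 0 -> m g != 0 -> ZGi v c%:Z g)
  (x : 'M[F]_n'.+1) (hx : rss x)
  (muGx : {measure set (MXm v n'.+1) -> \bar R})
  (HmuGx : haar_for (centralizer x) (maxcpt v x) muGx)
  (psiZ : MXm v n'.+1 -> R) (hpsiZ : quot_weight muZ psiZ)
  (psix : MXm v n'.+1 -> R) (hpsix : quot_weight muGx psix)
  (i o : nat) (ho : ovrss v x <= o%:Z) :
  ((cmod (Acal muG psiZ i m x))%:E <=
     (2 * fiber_const n'.+1 c o ^ n'.+1)%N%:R%:E * Omega_abs muG psix m x)%E.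
Proof.
pose n := n'.+1; pose M := MXm v n.
have [n0 _ mu1] := HmuG.
have hmu : haarG muG.
  split=> // [h dh|]; first exact: (haar_linv HF HmuG dh dh).
  by rewrite mu1 ltry.
have [dx ddx] := hx.
have [r [e [v0 sd]]] := split_data_ex (discr_separable ddx).
pose H := tame_const n c o.
have tame1 : tame v x H 1%:M.
  apply: (tame_conj (c := c) HF hx ho sd); first by rewrite det1 oner_neq0.
  rewrite /Defs.conjg mul1mx invmx1 mulmx1.
  by have [_ h _ _] := rss_bounds hx ho; apply: mgeW h; lia.
have tame_m (g : M) : \det (g : 'M[F]_n) != 0 -> m (Defs.conjg g x) != 0 -> tame v x H g.
  move=> dg mg; apply: (tame_conj (c := c) HF hx ho sd) => //.
  apply: (conj_ZGi_mge HF hx ho dg); apply: Hcpt => //.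
  by rewrite det_conj.
have conjG (g : M) : \det (g : 'M[F]_n) != 0 -> \det (Defs.conjg g x) != 0.
  by move=> dg; rewrite det_conj.
have mcm := measurable_on_G HF Hsmooth (@cmod R).
pose G (g : M) : R := \1_(@Gset F n) g * on_G (@cmod R \o m) (Defs.conjg g x).
have cmod0 (z : R[i]) : 0 <= cmod z by rewrite sqrtr_ge0.
have mG : measurable_fun setT G.
  apply: measurable_funM; last exact: (measurableT_comp mcm (measurable_conj HF x)).
  by apply: measurable_indic; exact: (@measurable_Gset _ _ HF n).
have G0 g : 0 <= G g.
  rewrite /G mulr_ge0 ?indicE // /on_G; case: ifP => _ //.
  exact: cmod0.
have GE (g : M) : \det (g : 'M[F]_n) != 0 -> G g = cmod (m (Defs.conjg g x)).
  by move=> dg; rewrite /G indicE mem_set // mul1r on_GE ?conjG.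
have GT (g t : M) : centralizer x t -> G ((g : 'M[F]_n) *m (t : 'M[F]_n)) = G g.
  move=> [dt ct]; have [dg|/negP/negPn/eqP dg] := pselect (\det (g : 'M[F]_n) != 0).
    by rewrite !GE ?det_mulmx ?mulf_neq0 // (conj_stab dg dt ct).
  by rewrite /G !indicE !memNset ?mul0r // /Gset /= ?det_mulmx dg ?mul0r eqxx.
pose i0 := depth_const n c o.
have mT : measurable (ZGi v i0%:Z `&` @fundZ F v n' : set M) by exact: measurable_trunc.
have part (p : R[i] -> R) : (forall z, `|p z| <= cmod z) -> (p 0 = 0) ->
    (forall s : seq 'M[F]_n, proper_flag s -> forall y : 'M[F]_n, \det y != 0 ->
      forall nu : {measure set M -> \bar R}, haar_for (unip_rad s) (unip_rad s `&` Gi v 0) nu ->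
      fine (\int[nu]_u (p (m ((u : 'M[F]_n) *m y)))%:E)%E = 0) ->
    (`|fine (\int[muG]_(g in ZGi v i%:Z) (p (m (Defs.conjg g x)) * psiZ g)%:E)|%:E <=
     \int[muG]_g (G g * \1_(ZGi v i0%:Z `&` @fundZ F v n' : set M) g)%:E)%E.
  move=> hp p0 hcusp; pose w := on_G (p \o m).
  have cw : real_cuspidal w := on_G_cuspidal HF hcusp.
  have mw : measurable_fun setT w := measurable_on_G HF Hsmooth p.
  have wE (g : M) : \det (g : 'M[F]_n) != 0 -> w (Defs.conjg g x) = p (m (Defs.conjg g x)).
    by move=> dg; rewrite /w on_GE ?conjG.
  have tame_q (g : 'M[F]_n) : \det g != 0 -> w (Defs.conjg g x) != 0 -> tame v x H g.
    move=> dg; rewrite wE // => pg; apply: tame_m => //.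
    by apply: contraNneq pg => ->; rewrite p0.
  have qC (j : nat) : exists C, forall g : M, ZGi v j%:Z g -> @fundZ F v n' g -> `|w (Defs.conjg g x)| <= C.
    have [a ha] := mge_exN v x.
    have [C hC] := bounded_on_Cpt HF Hsmooth p
      (- (2 * j)%N%:Z - a%:Z - (n * (2 * j) + n)%N%:Z) (v (\det x)).
    exists C => g h1 h2; have [d1 d2 d3 d4] := ZGi_fund HF h1 h2.
    rewrite wE //; apply: hC; split; [exact: conjG| |by rewrite det_conj].
    apply: (mgeM HF); first exact: (mgeM HF).
    rewrite -[invmx _]mulmx1; apply: (fund_ratio HF d1 d2 _ d4).
    by have h : mge v 0 (1%:M : 'M[F]_n) by [exact: mge1]; apply: mgeW h; lia.
  have -> : (\int[muG]_(g in ZGi v i%:Z) (p (m (Defs.conjg g x)) * psiZ g)%:E =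
             \int[muG]_(g in ZGi v i%:Z) (w (Defs.conjg g x) * psiZ g)%:E)%E.
    by apply: eq_integral => g /set_mem/(ZGiP HF)[dg _]; rewrite wE.
  apply: le_trans (component_bound HF sd dx tame1 hmu mu1 mw cw tame_q qC HmuZ hpsiZ i) _.
  rewrite integral_mkcond; apply: ge0_le_integral => //.
  - by move=> g _; rewrite patchE; case: ifP => // _; rewrite lee_fin normr_ge0.
  - apply/(measurable_restrictT _ mT).
    apply: measurable_funTS; apply/measurable_EFinP.
    apply: (measurableT_comp (@normr_measurable R setT)).
    exact: (measurableT_comp mw (measurable_conj HF x)).
  - apply/measurable_EFinP; apply: measurable_funM => //; exact: measurable_indic.
  move=> g _; rewrite patchE indicE; case: ifPn => [/set_mem hg|_]; last by rewrite mulr0.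
  have [/(ZGiP HF)[dg _] _] := hg.
  by rewrite mulr1 lee_fin wE // GE.
pose N := (fiber_const n c o ^ n)%N.
have fold : (\int[muG]_g (G g * \1_(ZGi v i0%:Z `&` @fundZ F v n' : set M) g)%:E <=
    N%:R%:E * Omega_abs muG psix m x)%E.
  have -> : Omega_abs muG psix m x = (\int[muG]_(g in @Gset F n) (G g * psix g)%:E)%E.
    by apply: eq_integral => g /set_mem dg; rewrite GE.
  apply: (torus_fold HF sd hmu mu1 HmuGx hpsix mG G0 GT tame1 (b := (2 * i0)%N)).
    exact: mT.
  by move=> y [h1 h2]; exact: ZGi_fund.
have fRe := part (@complex.Re R) (@cmod_Re R) erefl
  (fun s hs y dy nu hnu => congr1 (@complex.Re R) ((Hcusp s hs y dy).2 nu hnu)).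
have fIm := part (@complex.Im R) (@cmod_Im R) erefl
  (fun s hs y dy nu hnu => congr1 (@complex.Im R) ((Hcusp s hs y dy).2 nu hnu)).
apply: (@le_trans _ _ (`|complex.Re (Acal muG psiZ i m x)| +
                       `|complex.Im (Acal muG psiZ i m x)|)%:E).
  by rewrite lee_fin cmod_le.
rewrite natrM EFinM -muleA -[2%:R]/(1 + 1 : R) !EFinD.
have Om0 : (0 <= N%:R%:E * Omega_abs muG psix m x)%E.
  apply: mule_ge0; first by rewrite lee_fin.
  apply: integral_ge0 => g _; rewrite lee_fin mulr_ge0 //.
  by have [h _ _] := hpsix; exact: h.
rewrite ge0_muleDl ?lee_fin // mul1e; apply: leeD.
  apply: le_trans fold; apply: le_trans fRe; rewrite lee_fin /Acal /cint /=.
  by under eq_integral do rewrite Re_mulr.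
apply: le_trans fold; apply: le_trans fIm; rewrite lee_fin /Acal /cint /=.
by under eq_integral do rewrite Im_mulr.
Qed.

Theorem theoremB (R : realType) (F : fieldType) (v : F -> int) (n : nat)
  (n_gt0 : (0 < n)%N) (HF : nonarch_local_field v)
  (muG : {measure set (MXm v n) -> \bar R}) (HmuG : haar_for Gset (Gi v 0) muG)
  (muZ : {measure set (MXm v n) -> \bar R}) (HmuZ : haar_for Zset (@Zcpt F v n) muZ)
  (m : MXm v n -> R[i])
  (Hsmooth : smooth_on_G m) (Hcusp : cuspidal m) (Hcpt : cpt_mod_center m) :
  exists alpha : {poly nat},
    forall x : 'M[F]_n, rss x ->
    forall (muGx : {measure set (MXm v n) -> \bar R}),
      haar_for (centralizer x) (maxcpt v x) muGx ->
    forall psiZ : MXm v n -> R, quot_weight muZ psiZ ->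
    forall psix : MXm v n -> R, quot_weight muGx psix ->
    forall i : nat,
      ((cmod (Acal muG psiZ i m x))%:E
         <= (map_poly (fun k : nat => k%:R : R) alpha).[(ovrss v x)%:~R]%:E
            * Omega_abs muG psix m x)%E.
Proof.
case: n n_gt0 muG HmuG muZ HmuZ m Hsmooth Hcusp Hcpt => [//|n'] _ muG HmuG muZ HmuZ m.
move=> Hsmooth Hcusp [c hc].
have hc' (g : MXm v n'.+1) : \det (g : 'M[F]_n'.+1) != 0 -> m g != 0 -> ZGi v `|c|%N%:Z g.
  by move=> dg mg; apply: (ZGi_mono HF _ (hc g dg mg)); lia.
exists (bound_poly n'.+1 `|c|%N) => x hx muGx hmuGx psiZ hpsiZ psix hpsix i.
have eo : ovrss v x = `|ovrss v x|%N%:Z by rewrite gez0_abs // (ovrss_ge0 HF hx).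
have ho : ovrss v x <= `|ovrss v x|%N%:Z by rewrite -eo.
apply: le_trans (final_bound HF HmuG HmuZ Hsmooth Hcusp hc' hx hmuGx hpsiZ hpsix i ho) _.
apply: lee_wpmul2r.
  apply: integral_ge0 => g _; rewrite lee_fin mulr_ge0 ?sqrtr_ge0 //.
  by have [h _ _] := hpsix; exact: h.
by rewrite lee_fin [in X in _ <= X]eo; exact: bound_polyE.
Qed.
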